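(* For every $n\ge 5$ and every super-reflexive Banach space $\mathbb{E}$, the groups $\mathrm{SL}_n(\mathbb{Z})$ and $\mathrm{SL}_n(\mathbb{R})$ have property $(FF_{\mathbb{E}})$.
   Context: A Banach space $\mathbb{E}$ is uniformly convex if there is a function $\delta:(0,2]\to(0,1]$ such that for every $0<\varepsilon\le 2$ and all unit vectors $\xi,\eta\in\mathbb{E}$ with $\|\xi-\eta\|\ge\varepsilon$ one has $\|\frac{\xi+\eta}{2}\|\le 1-\delta(\varepsilon)$. A Banach space is super-reflexive if and only if it admits an equivalent uniformly convex norm (this can be taken as the definition). $O(\mathbb{E})$ is the group of invertible linear isometries of $\mathbb{E}$ with the strong operator topology. Given a topological group $G$ and a continuous isometric linear representation $\pi:G\to O(\mathbb{E})$, a continuous quasi-$1$-cocycle into $\pi$ is a continuous map $c:G\to\mathbb{E}$ such that $$\sup_{g,h\in G}\|c(gh)-(c(g)+\pi(g)c(h))\|<\infty.$$ $G$ has property $(FF_{\mathbb{E}})$ if for every continuous isometric linear representation $\pi:G\to O(\mathbb{E})$, every continuous quasi-$1$-cocycle into $\pi$ is bounded. $\mathrm{SL}_n(\mathbb{Z})$ is a discrete group and $\mathrm{SL}_n(\mathbb{R})$ has its Lie group topology. *)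

(* Defs.v *)
From HB Require Import structures.
From mathcomp Require Import all_boot all_order all_algebra perm.
From mathcomp Require Import all_classical all_reals all_analysis.

Set Implicit Arguments.
Unset Strict Implicit.
Unset Printing Implicit Defensive.

Import Order.TTheory GRing.Theory Num.Theory.
Import numFieldNormedType.Exports.

Local Open Scope classical_set_scope.
Local Open Scope ring_scope.

HB.mixin Record isTopologicalGroup G of Group G & Topological G := {
  mulg_continuous : continuous (fun x : G * G => (x.1 * x.2)%g);
  invg_continuous : continuous (fun x : G => (x^-1)%g)
}.

#[short(type="topologicalGroupType")]
HB.structure Definition TopologicalGroup :=
  {G of Group G & Topological G & isTopologicalGroup G}.

(* Banach-space notions are over a scalar field K, to be instantiated with R and
   R[i]; norms, moduli of convexity and bounds then take values in K, where
   0 <= x forces x to be real. *)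

Section Convexity.
Variables (K : numFieldType) (E : normedModType K).
Implicit Types (N : E -> K) (x y : E).

Definition is_norm N : Prop :=
  [/\ forall x y, N (x + y) <= N x + N y,
      forall (a : K) x, N (a *: x) = `|a| * N x
    & forall x, N x = 0 -> x = 0].

Definition equivalent_norm N : Prop :=
  is_norm N /\
  exists a b : K, [/\ 0 < a, 0 < b
                    & forall x, a * `|x| <= N x /\ N x <= b * `|x|].

Definition uniformly_convex N : Prop :=
  exists delta : K -> K, forall eps : K, 0 < eps <= 2 ->
    0 < delta eps <= 1 /\
    forall x y, N x = 1 -> N y = 1 -> eps <= N (x - y) ->
      N (2^-1 *: (x + y)) <= 1 - delta eps.

Definition super_reflexive : Prop :=
  exists N, equivalent_norm N /\ uniformly_convex N.

End Convexity.

Section IsometryGroup.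
Variables (K : numFieldType) (E : normedModType K).

Definition linear_isometries : set {ptws E -> E} :=
  [set f : E -> E | [/\ linear f, forall x, `|f x| = `|x| & bijective f]].

(* The topology of pointwise convergence induced by {ptws E -> E} is the strong
   operator topology. *)
Definition isometry_group : Type := set_type linear_isometries.

HB.instance Definition _ :=
  Topological.copy isometry_group (set_type linear_isometries).

Definition isometry_fun (u : isometry_group) : E -> E := set_val u.

Lemma isometry_funP (u : isometry_group) :
  [/\ linear (isometry_fun u),
      forall x, `|isometry_fun u x| = `|x| & bijective (isometry_fun u)].
Proof. exact: (set_valP u). Qed.

Lemma isometry_fun_inj : injective isometry_fun.
Proof. exact: val_inj. Qed.

Lemma id_isometryP : linear_isometries (fun x : E => x).
Proof. by split=> //; exists id. Qed.

Lemma comp_isometryP (u v : isometry_group) :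
  linear_isometries (fun x => isometry_fun u (isometry_fun v x)).
Proof.
have [lu nu bu] := isometry_funP u; have [lv nv bv] := isometry_funP v.
by split=> [a x y|x|]; rewrite ?lv ?lu ?nu ?nv //; exact: bij_comp.
Qed.

Lemma inv_isometry_subproof (u : isometry_group) :
  exists2 g, linear_isometries g &
    cancel (isometry_fun u) g /\ cancel g (isometry_fun u).
Proof.
have [lu nu [g fK gK]] := isometry_funP u; exists g => //; split.
- by move=> a x y; apply: (can_inj fK); rewrite lu !gK.
- by move=> x; rewrite -nu gK.
- by exists (isometry_fun u).
Qed.

Definition one_isometry : isometry_group := SigSub (mem_set id_isometryP).

Definition mul_isometry (u v : isometry_group) : isometry_group :=
  SigSub (mem_set (comp_isometryP u v)).

Definition inv_isometry (u : isometry_group) : isometry_group :=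
  SigSub (mem_set (s2valP (cid2 (inv_isometry_subproof u)))).

Lemma mul_isometryA : associative mul_isometry.
Proof. by move=> u v w; exact: isometry_fun_inj. Qed.

Lemma mul1isometry : left_id one_isometry mul_isometry.
Proof. by move=> u; exact: isometry_fun_inj. Qed.

Lemma mulisometry1 : right_id one_isometry mul_isometry.
Proof. by move=> u; exact: isometry_fun_inj. Qed.

Lemma mulVisometry : left_inverse one_isometry inv_isometry mul_isometry.
Proof.
move=> u; apply: isometry_fun_inj; apply/funext => x.
exact: (s2valP' (cid2 (inv_isometry_subproof u))).1.
Qed.

Lemma mulisometryV : right_inverse one_isometry inv_isometry mul_isometry.
Proof.
move=> u; apply: isometry_fun_inj; apply/funext => x.
exact: (s2valP' (cid2 (inv_isometry_subproof u))).2.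
Qed.

HB.instance Definition _ := isGroup.Build isometry_group
  mul_isometryA mul1isometry mulisometry1 mulVisometry mulisometryV.

End IsometryGroup.

Section PropertyFF.
Variables (G : topologicalGroupType) (K : numFieldType) (E : normedModType K).

Definition quasi_cocycle (pi : G -> isometry_group E) (c : G -> E) : Prop :=
  [bounded c (gh.1 * gh.2)%g - (c gh.1 + isometry_fun (pi gh.1) (c gh.2))
    | gh in [set: G * G]].

Definition property_FF : Prop :=
  forall pi : {multiplicative G -> isometry_group E}, continuous pi ->
  forall c : G -> E, continuous c -> quasi_cocycle pi c ->
  [bounded c g | g in [set: G]].

End PropertyFF.

Section SpecialLinear.
Variables (A : comNzRingType) (n : nat).

Definition SL : Type := {M : 'M[A]_n | \det M == 1}.

HB.instance Definition _ := Choice.on SL.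

Let det_eq1 (M : 'M[A]_n) : bool := \det M == 1.

Definition one_SL : SL := exist det_eq1 1%:M (introT eqP (det1 A n)).

Lemma mul_SL_subproof (M N : SL) : \det (val M *m val N) == 1.
Proof. by rewrite det_mulmx (eqP (valP M)) (eqP (valP N)) mulr1. Qed.

Definition mul_SL (M N : SL) : SL := exist det_eq1 _ (mul_SL_subproof M N).

Lemma inv_SL_subproof (M : SL) : \det (\adj (val M)) == 1.
Proof.
rewrite -[X in X == _]mul1r -{1}(eqP (valP M)) -det_mulmx mul_mx_adj.
by rewrite (eqP (valP M)) det1.
Qed.

Definition inv_SL (M : SL) : SL := exist det_eq1 _ (inv_SL_subproof M).

Lemma mul_SLA : associative mul_SL.
Proof. by move=> M N P; apply: val_inj; rewrite /= mulmxA. Qed.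

Lemma mul1SL : left_id one_SL mul_SL.
Proof. by move=> M; apply: val_inj; rewrite /= mul1mx. Qed.

Lemma mulSL1 : right_id one_SL mul_SL.
Proof. by move=> M; apply: val_inj; rewrite /= mulmx1. Qed.

Lemma mulVSL : left_inverse one_SL inv_SL mul_SL.
Proof.
by move=> M; apply: val_inj; rewrite /= mul_adj_mx (eqP (valP M)).
Qed.

Lemma mulSLV : right_inverse one_SL inv_SL mul_SL.
Proof.
by move=> M; apply: val_inj; rewrite /= mul_mx_adj (eqP (valP M)).
Qed.

HB.instance Definition _ := isGroup.Build SL mul_SLA mul1SL mulSL1 mulVSL mulSLV.

End SpecialLinear.

Section SLZ.
Variable n : nat.

Definition SLZ : Type := discrete_topology (SL int n).

HB.instance Definition _ := Group.copy SLZ (SL int n).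
HB.instance Definition _ := Topological.copy SLZ (discrete_topology (SL int n)).

Let SLZ_nbhs (x : SLZ) (A : set SLZ) : A x -> nbhs x A.
Proof. by move=> Ax; apply/principal_filterP. Qed.

Let SLZ_mulg_continuous : continuous (fun x : SLZ * SLZ => (x.1 * x.2)%g).
Proof.
move=> [x y] B /nbhs_singleton Bxy.
exists ([set x], [set y]) => /=; first by split; exact: SLZ_nbhs.
by move=> [? ?] /= [-> ->].
Qed.

Let SLZ_invg_continuous : continuous (fun x : SLZ => (x^-1)%g).
Proof. by move=> x B /nbhs_singleton Bx; exact: SLZ_nbhs. Qed.

HB.instance Definition _ :=
  isTopologicalGroup.Build SLZ SLZ_mulg_continuous SLZ_invg_continuous.

End SLZ.

Section SLR.
Variables (R : realType) (n : nat).

Definition SLR : Type := initial_topology (val : SL R n -> 'M[R]_n).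

HB.instance Definition _ := Group.copy SLR (SL R n).
HB.instance Definition _ := Topological.copy SLR
  (initial_topology (val : SL R n -> 'M[R]_n)).

Let entry (i j : 'I_n) (M : SLR) : R := (val M : 'M[R]_n) i j.

Let entry_continuous i j : continuous (entry i j).
Proof.
move=> M; apply: (@continuous_comp SLR 'M[R]_n R (val : SL R n -> 'M[R]_n)
  (fun A => A i j)).
  exact: initial_continuous.
exact: coord_continuous.
Qed.

Let continuous_SLR (T : topologicalType) (f : T -> SLR) :
  (forall i j, continuous (entry i j \o f)) -> continuous f.
Proof.
move=> fc x B [_ [[C oC <-] /= Cfx] CB].
have : nbhs (val (f x) : 'M[R]_n) C by apply: open_nbhs_nbhs; split.
case=> P nP PC.
have : \forall y \near x, forall ij : 'I_n * 'I_n,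
    P ij.1 ij.2 (entry ij.1 ij.2 (f y)).
  by apply: filter_forall => -[i j]; exact: (fc i j x _ (nP i j)).
by apply: filterS => y Py; apply: CB; apply: PC => i j; exact: (Py (i, j)).
Qed.

Let continuous_cstf (T : topologicalType) (a : R) :
  continuous (fun _ : T => a).
Proof. by move=> x; exact: cvg_cst. Qed.

Let continuous_mulf (T : topologicalType) (f g : T -> R) :
  continuous f -> continuous g -> continuous (fun x => f x * g x).
Proof. by move=> fc gc x; exact: (cvgM (fc x) (gc x)). Qed.

Let continuous_sumf (T : topologicalType) (I : Type) (r : seq I)
    (f : I -> T -> R) :
  (forall i, continuous (f i)) -> continuous (fun x => \sum_(i <- r) f i x).
Proof.
move=> fc; elim: r => [|i r IHr] x.
  by under eq_fun do rewrite big_nil; exact: cvg_cst.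
by under eq_fun do rewrite big_cons; apply: cvgD; [exact: fc | exact: IHr].
Qed.

Let continuous_prodf (T : topologicalType) (I : Type) (r : seq I)
    (f : I -> T -> R) :
  (forall i, continuous (f i)) -> continuous (fun x => \prod_(i <- r) f i x).
Proof.
move=> fc; elim: r => [|i r IHr] x.
  by under eq_fun do rewrite big_nil; exact: cvg_cst.
by under eq_fun do rewrite big_cons; apply: cvgM; [exact: fc | exact: IHr].
Qed.

Let SLR_mulg_continuous : continuous (fun x : SLR * SLR => (x.1 * x.2)%g).
Proof.
apply: continuous_SLR => i j.
rewrite (_ : _ \o _ =
    (fun x : SLR * SLR => \sum_k entry i k x.1 * entry k j x.2)); last first.
  by apply/funext => x; rewrite /entry /= mxE.
apply: continuous_sumf => k x; apply: cvgM.
  by apply: continuous_comp; [exact: cvg_fst | exact: entry_continuous].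
by apply: continuous_comp; [exact: cvg_snd | exact: entry_continuous].
Qed.

Let SLR_invg_continuous : continuous (fun x : SLR => (x^-1)%g).
Proof.
apply: continuous_SLR => i j.
rewrite (_ : _ \o _ = (fun x : SLR => (-1) ^+ (j + i) *
    \sum_(s : 'S_n.-1) (-1) ^+ s *
      \prod_k entry (lift j k) (lift i (s k)) x)); last first.
  apply/funext => x; rewrite /entry /= mxE /cofactor /determinant.
  congr (_ * _); apply: eq_bigr => s _; congr (_ * _).
  by apply: eq_bigr => k _; rewrite !mxE.
apply: continuous_mulf; first exact: continuous_cstf.
apply: continuous_sumf => s.
apply: continuous_mulf; first exact: continuous_cstf.
by apply: continuous_prodf => k; exact: entry_continuous.
Qed.

HB.instance Definition _ :=
  isTopologicalGroup.Build SLR SLR_mulg_continuous SLR_invg_continuous.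

End SLR.

(* Main.v *)
From HB Require Import structures.
Require Import Defs.
From mathcomp Require Import all_boot all_order all_algebra perm cyclic.
From mathcomp Require Import boolp classical_sets reals.
From mathcomp Require Import zify ring lra.

Set Implicit Arguments.
Unset Strict Implicit.
Unset Printing Implicit Defensive.

Import Order.TTheory GRing.Theory Num.Theory.

(** Restrict the scalars of E to the reals and replace its norm by an
    equivalent one, N, that is uniformly convex and invariant under the
    representation. A quasi-cocycle c has the same meaning for N, so the task
    is to bound c for isometric representations on a uniformly convex space.

    The analytic core concerns three unipotent isometries x, y, z, where z is
    the commutator of x and y and commutes with both. Averages over 2 ^ n powers
    of x and y are products of averages of two terms. If uniform convexity
    fails to make such a product contract, then z almost fixes the vector; in
    heis_decay this dichotomy is applied at every pair of scales and shows that
    the averages of x and y, applied to a vector in the range of a difference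
    1 - z ^+ (2 ^ l), are exponentially small in the number of scales. Hence in
    a word of averages over the six root subgroups of SL_3(Z), the lengths of
    the averages can be changed and the averages exchanged with very small
    errors. Such moves lead to words at larger and larger scales, almost fixed
    by any given element of the first root subgroup, at bounded distance from
    the starting vector. This is hexagon_bounded: a vector moved by at most d
    by the elementary generators of SL_3(Z) is moved by at most a constant times
    d by all elementary matrices.

    A vector that is moved by a bounded amount by all the elementary matrices of
    SL_3(Z) is close to an invariant vector (game_bound, near_invariant). The
    unipotent subgroups M, with roots 13 and 23, and L, with roots 31 and 32,
    are abelian and have fixed vectors nearby; take an M-fixed x and an L-fixed
    y that almost minimise the distance. Uniform convexity makes any other such
    minimal pair parallel to this one. Applied to the images of the pair under
    the normaliser of M and L and under a Weyl element, this shows that x is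
    almost fixed by L too, so that displacements can be halved repeatedly.

    For n >= 5 an elementary matrix e_ij(t) commutes with a copy of SL_3(Z) on
    three other indices. Therefore c (e_ij(t)) is moved by a bounded amount by
    it, and then by all root subgroups up to e_ij itself, so c is additive up to
    a constant along e_ij. Since e_ij(t ^ 2) is a commutator of matrices with
    entry t, c is bounded on elementary matrices (elementary_cocycle_bounded).
    An SL_2 block h normalises the root subgroups linking it to a third index,
    so c h is close to a vector invariant under an SL_3. This makes c additive
    up to a constant on the product of rows (a, b1), (a, b2) |-> (a, b1 * b2) of
    Mennicke; by Euler's theorem some power of b is 1 modulo a, and c is
    bounded on such rows, so c is bounded on all SL_2 blocks
    (blk12_cocycle_bounded).

    By Gaussian elimination every matrix of SL_n over the integers or a field is
    a product of a bounded number of SL_2 blocks (SL_bounded_generation). This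
    finishes the case of the integers. Over the reals every block is a product
    of four elementary matrices, and every elementary matrix is the product of
    an integral one and of one with entry in the compact interval [0, 1], on
    which the continuous map c is bounded. *)

(** * Linear endomorphisms of a real vector space *)

Section Endomorphisms.
Local Open Scope ring_scope.
Variables (R : realType) (V : lmodType R).

(** Bundled, so that with composition as product they form a ring in which
    averages of isometries are computed; 1 = 0 in it when V is trivial. *)
Record endo := Endo {endo_fun :> V -> V; endoP : linear endo_fun}.

Lemma endo_ext (f g : endo) : (forall v, f v = g v) -> f = g.
Proof.
case: f g => [f lf] [g lg] /= /funext fg; rewrite fg in lf *.
by congr Endo; exact: Prop_irrelevance.
Qed.

HB.instance Definition _ := gen_eqMixin endo.
HB.instance Definition _ := gen_choiceMixin endo.

Lemma endoD (f : endo) : {morph f : u v / u + v}.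
Proof. by move=> u v; have := endoP f 1 u v; rewrite !scale1r. Qed.

Lemma endo0 (f : endo) : f 0 = 0.
Proof. by apply: (addrI (f 0)); rewrite -endoD !addr0. Qed.

Lemma endoZ (f : endo) a v : f (a *: v) = a *: f v.
Proof. by have := endoP f a v 0; rewrite endo0 !addr0. Qed.

Lemma endoN (f : endo) v : f (- v) = - f v.
Proof. by rewrite -scaleN1r endoZ scaleN1r. Qed.

Lemma endoB (f : endo) : {morph f : u v / u - v}.
Proof. by move=> u v; rewrite endoD endoN. Qed.

Lemma endo_zero_subproof : linear (fun _ : V => 0 : V).
Proof. by move=> a u v; rewrite scaler0 addr0. Qed.

Lemma endo_add_subproof (f g : endo) : linear (fun v => f v + g v).
Proof. by move=> a u v; rewrite !endoP scalerDr addrACA. Qed.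

Lemma endo_opp_subproof (f : endo) : linear (fun v => - f v).
Proof. by move=> a u v; rewrite endoP opprD scalerN. Qed.

Lemma endo_id_subproof : linear (fun v : V => v).
Proof. by []. Qed.

Lemma endo_comp_subproof (f g : endo) : linear (fun v => f (g v)).
Proof. by move=> a u v; rewrite !endoP. Qed.

Lemma endo_scale_subproof (c : R) : linear (fun v : V => c *: v).
Proof. by move=> a u v; rewrite scalerDr !scalerA mulrC. Qed.

Definition endo_zero := Endo endo_zero_subproof.
Definition endo_add f g := Endo (endo_add_subproof f g).
Definition endo_opp f := Endo (endo_opp_subproof f).
Definition endo_id := Endo endo_id_subproof.
Definition endo_comp f g := Endo (endo_comp_subproof f g).
Definition endo_scale c := Endo (endo_scale_subproof c).

Lemma endo_addA : associative endo_add.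
Proof. by move=> f g h; apply: endo_ext => v; rewrite /= addrA. Qed.
Lemma endo_addC : commutative endo_add.
Proof. by move=> f g; apply: endo_ext => v; rewrite /= addrC. Qed.
Lemma endo_add0 : left_id endo_zero endo_add.
Proof. by move=> f; apply: endo_ext => v; rewrite /= add0r. Qed.
Lemma endo_addN : left_inverse endo_zero endo_opp endo_add.
Proof. by move=> f; apply: endo_ext => v; rewrite /= addNr. Qed.

HB.instance Definition _ :=
  GRing.isZmodule.Build endo endo_addA endo_addC endo_add0 endo_addN.

Lemma endo_compA : associative endo_comp.
Proof. by move=> f g h; apply: endo_ext. Qed.
Lemma endo_comp1 : left_id endo_id endo_comp.
Proof. by move=> f; apply: endo_ext. Qed.
Lemma endo_1comp : right_id endo_id endo_comp.
Proof. by move=> f; apply: endo_ext. Qed.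
Lemma endo_compDl : left_distributive endo_comp endo_add.
Proof. by move=> f g h; apply: endo_ext. Qed.
Lemma endo_compDr : right_distributive endo_comp endo_add.
Proof. by move=> f g h; apply: endo_ext => v; rewrite /= endoD. Qed.

HB.instance Definition _ := GRing.Zmodule_isPzRing.Build endo
  endo_compA endo_comp1 endo_1comp endo_compDl endo_compDr.

Lemma endoDE (f g : endo) v : (f + g) v = f v + g v. Proof. by []. Qed.
Lemma endoNE (f : endo) v : (- f) v = - f v. Proof. by []. Qed.
Lemma endoBE (f g : endo) v : (f - g) v = f v - g v. Proof. by []. Qed.
Lemma endoME (f g : endo) v : (f * g) v = f (g v). Proof. by []. Qed.
Lemma endo1E v : (1 : endo) v = v. Proof. by []. Qed.
Lemma endo0E v : (0 : endo) v = 0. Proof. by []. Qed.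

Lemma endo_sumE I (r : seq I) (P : pred I) (F : I -> endo) v :
  (\sum_(i <- r | P i) F i) v = \sum_(i <- r | P i) F i v.
Proof. exact: (big_morph (fun f : endo => f v)). Qed.

Definition half : endo := endo_scale 2^-1.

Lemma halfC (f : endo) : GRing.comm half f.
Proof. by apply: endo_ext => v; rewrite /= endoZ. Qed.

Lemma half2 : half + half = 1.
Proof.
apply: endo_ext => v; rewrite endoDE endo1E /= -scalerDl.
by rewrite -[RHS]scale1r; congr (_ *: _); lra.
Qed.

End Endomorphisms.

(** * Dyadic averages of isometries *)

Section DyadicAverages.
Local Open Scope ring_scope.
Variables (R : realType) (V : lmodType R).
Implicit Types (x y z : endo V) (v : V).

(** Locked, so that simplification does not unfold the averages inside long
    products. *)
Definition midavg x : endo V := locked (half V * (1 + x)).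

Lemma midavg_def x : midavg x = half V * (1 + x).
Proof. by rewrite /midavg -lock. Qed.

(** This is the mean of the powers x ^+ (k * 2 ^ i) for k < 2 ^ (n - i), each
    factor deciding one binary digit of k. Since the mean over a long
    interval is a product of means of two terms, statements about it can be
    proved one scale at a time. *)
Definition dyavg x (i n : nat) : endo V :=
  \prod_(i <= k < n) midavg (x ^+ (2 ^ k)).

Lemma dyavg_geq x i n : (n <= i)%N -> dyavg x i n = 1.
Proof. exact: big_geq. Qed.

Lemma dyavg_recr x i n : (i <= n)%N ->
  dyavg x i n.+1 = dyavg x i n * midavg (x ^+ (2 ^ n)).
Proof. by move=> le_in; rewrite /dyavg big_nat_recr. Qed.

Lemma dyavg_recl x i n : (i < n)%N ->
  dyavg x i n = midavg (x ^+ (2 ^ i)) * dyavg x i.+1 n.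
Proof. exact: big_ltn. Qed.

Lemma dyavg_cat x k i n : (i <= k <= n)%N ->
  dyavg x i n = dyavg x i k * dyavg x k n.
Proof. by case/andP=> ik kn; rewrite /dyavg -big_cat_nat. Qed.

Lemma comm_midavg x y : GRing.comm y x -> GRing.comm y (midavg x).
Proof.
move=> yx; rewrite midavg_def; apply: commrM; first exact/commr_sym/halfC.
by apply: commrD => //; exact: commr1.
Qed.

Lemma comm_dyavg x y i n : GRing.comm y x -> GRing.comm y (dyavg x i n).
Proof.
by move=> yx; apply: commr_prod => k _; exact/comm_midavg/commrX.
Qed.

Lemma comm_dyavg2 x y i n j m : GRing.comm x y ->
  GRing.comm (dyavg x i n) (dyavg y j m).
Proof. by move=> xy; apply/comm_dyavg/commr_sym/comm_dyavg/commr_sym. Qed.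

Lemma half_expE k v : (half V ^+ k) v = (2^-1) ^+ k *: v.
Proof.
elim: k v => [|k IHk] v; first by rewrite !expr0 scale1r.
by rewrite !exprS endoME IHk /= scalerA.
Qed.

Lemma midavgE x v : midavg x v = 2^-1 *: (v + x v).
Proof. by rewrite midavg_def. Qed.

(** Each factor of the average turns 1 - q into half of 1 - q ^+ 2. *)
Lemma dyavg_sub x l m : (l <= m)%N ->
  (1 - x ^+ (2 ^ l)) * dyavg x l m = half V ^+ (m - l) * (1 - x ^+ (2 ^ m)).
Proof.
elim: m => [|m IHm].
  by rewrite leqn0 => /eqP ->; rewrite dyavg_geq // mulr1 mul1r.
rewrite leq_eqVlt => /predU1P[-> | ]; first by rewrite dyavg_geq // subnn mulr1 mul1r.
rewrite ltnS => lm; rewrite dyavg_recr // mulrA IHm // subSn // exprSr -!mulrA.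
congr (_ * _); rewrite midavg_def mulrA (commr_sym (halfC _)) -mulrA; congr (_ * _).
rewrite mulrDr mulr1 mulrBl mul1r -exprD addnn -mul2n -expnS.
by rewrite addrA subrK.
Qed.

Lemma one_sub_midavg x : 1 - midavg x = half V * (1 - x).
Proof.
apply/eqP; rewrite midavg_def subr_eq -mulrDr addrC addrA addrAC addrK.
by rewrite mulrDr mulr1 half2.
Qed.

(** Telescoping over the partial products of the average. *)
Lemma one_sub_dyavg x l m : (l <= m)%N ->
  1 - dyavg x l m =
  \sum_(l <= k < m) half V * dyavg x l k * (1 - x ^+ (2 ^ k)).
Proof.
elim: m => [|m IHm].
  by rewrite leqn0 => /eqP ->; rewrite dyavg_geq // subrr big_geq.
rewrite leq_eqVlt => /predU1P[-> | ]; first by rewrite dyavg_geq // subrr big_geq.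
rewrite ltnS => lm; rewrite big_nat_recr //= -IHm // dyavg_recr //.
rewrite (halfC (dyavg _ _ _)) -mulrA -one_sub_midavg mulrBr mulr1.
by rewrite addrA subrK.
Qed.

(** Telescoping over the position at which the product switches from the
    factors of y to those of w * y. *)
Lemma dyavg_tw y w (m : nat) : GRing.comm w y ->
  dyavg (w * y) 0 m - dyavg y 0 m =
  \sum_(0 <= t < m) dyavg y 0 t *
     (half V * (w ^+ (2 ^ t) - 1) * y ^+ (2 ^ t)) * dyavg (w * y) t.+1 m.
Proof.
move=> wy; elim: m => [|m IHm]; first by rewrite !dyavg_geq // subrr big_geq.
rewrite big_nat_recr //= (dyavg_geq _ (leqnn m.+1)) mulr1 !dyavg_recr //.
rewrite [X in _ = X + _](_ : _ =
   (dyavg (w * y) 0 m - dyavg y 0 m) * midavg ((w * y) ^+ (2 ^ m))); last first.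
  rewrite IHm mulr_suml; apply: eq_big_nat => t /andP[_ tm].
  by rewrite dyavg_recr // !mulrA.
have -> : half V * (w ^+ (2 ^ m) - 1) * y ^+ (2 ^ m) =
    midavg ((w * y) ^+ (2 ^ m)) - midavg (y ^+ (2 ^ m)).
  rewrite !midavg_def -mulrBr -mulrA; congr (_ * _).
  by rewrite exprMn_comm // mulrBl mul1r opprD addrACA subrr add0r.
by rewrite mulrBl mulrBr addrA subrK.
Qed.

End DyadicAverages.

Section Norms.
Local Open Scope ring_scope.
Variables (R : realType) (V : lmodType R) (N : V -> R).
Implicit Types (x y z : endo V) (v : V).

Record seminorm : Prop := Seminorm {
  snD : forall u v, N (u + v) <= N u + N v;
  snZ : forall a v, N (a *: v) = `|a| * N v }.

Hypothesis snN : seminorm.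

Lemma sn0 : N 0 = 0.
Proof. by rewrite -(scale0r 0) (snZ snN) normr0 mul0r. Qed.

Lemma snopp v : N (- v) = N v.
Proof. by rewrite -scaleN1r (snZ snN) normrN1 mul1r. Qed.

Lemma snB u v : N (u - v) <= N u + N v.
Proof. by rewrite -(snopp v); exact: snD. Qed.

Lemma sn_ge0 v : 0 <= N v.
Proof.
have := snD snN v (- v); rewrite subrr sn0 snopp -mulr2n -(mulr_natr (N v)).
by rewrite pmulr_lge0.
Qed.

Lemma snC u v : N (u - v) = N (v - u).
Proof. by rewrite -opprB snopp. Qed.

Lemma sn_tri w u v : N (u - v) <= N (u - w) + N (w - v).
Proof. by apply: le_trans (snD snN _ _); rewrite addrA subrK. Qed.

Lemma sn_half v : N (2^-1 *: v) = 2^-1 * N v.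
Proof. by rewrite (snZ snN) ger0_norm // invr_ge0. Qed.

Lemma sn_halfE v : N (half V v) = 2^-1 * N v.
Proof. exact: sn_half. Qed.

Lemma sn_sum I (r : seq I) (P : pred I) (F : I -> V) :
  N (\sum_(i <- r | P i) F i) <= \sum_(i <- r | P i) N (F i).
Proof.
elim/big_rec2: _ => [|i a b _ ab]; first by rewrite sn0.
by apply: le_trans (snD snN _ _) _; exact: lerD.
Qed.

Definition contr x := forall v, N (x v) <= N v.
Definition isometric x := forall v, N (x v) = N v.

Lemma isometric_contr x : isometric x -> contr x.
Proof. by move=> xi v; rewrite xi. Qed.

Lemma contr1 : contr 1. Proof. by move=> v. Qed.

Lemma contrM x y : contr x -> contr y -> contr (x * y).
Proof. by move=> xc yc v; exact: le_trans (xc _) (yc _). Qed.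

Lemma contrX x n : contr x -> contr (x ^+ n).
Proof.
move=> xc; elim: n => [|n IHn]; first exact: contr1.
by rewrite exprS; exact: contrM.
Qed.

Lemma isometricM x y : isometric x -> isometric y -> isometric (x * y).
Proof. by move=> xc yc v; rewrite endoME xc yc. Qed.

Lemma isometricX x n : isometric x -> isometric (x ^+ n).
Proof.
move=> xc; elim: n => [|n IHn] //.
by rewrite exprS; exact: isometricM.
Qed.

Lemma contr_midavg x : contr x -> contr (midavg x).
Proof.
move=> xc v; rewrite midavgE sn_half.
have := snD snN v (x v); have := xc v; lra.
Qed.

Lemma contr_dyavg x i n : contr x -> contr (dyavg x i n).
Proof.
move=> xc; rewrite /dyavg; elim/big_rec: _ => [|k y _]; first exact: contr1.
by apply/contrM/contr_midavg/contrX.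
Qed.

Lemma contr_sub x v : contr x -> N ((1 - x) v) <= 2 * N v.
Proof.
move=> xc; rewrite endoBE; apply: le_trans (snB _ _) _.
by have := xc v; rewrite endo1E; lra.
Qed.

Lemma sn_halfX k v : N ((half V ^+ k) v) = 2^-1 ^+ k * N v.
Proof. by rewrite half_expE (snZ snN) ger0_norm // exprn_ge0 // invr_ge0. Qed.

Lemma midavg_disp x u v d : N (u - v) <= d -> N (x u - v) <= d ->
  N (midavg x u - v) <= d.
Proof.
move=> h1 h2; rewrite midavgE.
have -> : 2^-1 *: (u + x u) - v = 2^-1 *: ((u - v) + (x u - v)).
  rewrite addrACA -opprD -(mulr2n v) scalerBr -(scaler_nat 2 v) scalerA.
  by rewrite mulVf ?scale1r // pnatr_eq0.
by rewrite sn_half; have := snD snN (u - v) (x u - v); lra.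
Qed.

Lemma dyavg_disp x a v d :
  (forall s, (s < 2 ^ a)%N -> N ((x ^+ s) v - v) <= d) ->
  N (dyavg x 0 a v - v) <= d.
Proof.
suff: forall a s, (forall t, (t < s + 2 ^ a)%N -> N ((x ^+ t) v - v) <= d) ->
    N (dyavg x 0 a ((x ^+ s) v) - v) <= d.
  by move=> /(_ a 0); rewrite expr0 endo1E; apply.
elim=> {a} [|a IHa] s hs.
  by rewrite dyavg_geq // endo1E; apply: hs; rewrite expn0 addn1.
have comm : dyavg x 0 a.+1 = midavg (x ^+ (2 ^ a)) * dyavg x 0 a.
  rewrite dyavg_recr //; apply/comm_midavg/commrX/commr_sym/comm_dyavg.
  exact: commr_refl.
rewrite comm endoME; apply: midavg_disp.
  by apply: IHa => t ht; apply: hs; rewrite expnS mul2n -addnn; lia.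
rewrite -endoME (comm_dyavg _ _ (commr_sym (commrX _ (commr_refl x)))) endoME.
rewrite -(endoME (x ^+ _)) -exprD; apply: IHa => t ht; apply: hs.
by rewrite expnS mul2n -addnn; lia.
Qed.

End Norms.

(** * Uniform convexity and almost commuting isometries *)

Section HeisenbergGap.
Local Open Scope ring_scope.
Variables (R : realType) (V : lmodType R) (N : V -> R).
Hypothesis snN : seminorm N.
Implicit Types (x y z : endo V) (v : V).

(** Uniform convexity for balls of every radius, with a modulus that does not
    depend on the radius. This form, unlike the one for unit vectors, passes
    to a supremum of comparable norms. *)
Definition unif_convex := forall e : R, 0 < e -> exists2 d : R, 0 < d < 1 &
  forall (r : R) u v, N u <= r -> N v <= r -> e * r <= N (u - v) ->
    N (2^-1 *: (u + v)) <= (1 - d) * r.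

(** The element z is the commutator of x and y. A vector that the two
    averages do not shrink is almost fixed by x and by y, hence by z. *)
Definition pair_gap (rho : R) := forall x y z,
  isometric N x -> isometric N y -> isometric N z ->
  GRing.comm z x -> GRing.comm z y -> x * y = z * y * x ->
  forall v, N (midavg x (midavg y v)) <= rho * N v \/
            N ((1 - z) v) <= 24^-1 * N v.

(** If the double average of v is almost as long as v, then uniform convexity
    forces y to move v, and x to move the average, by very little. The
    products x * y and y * x then move v by little as well, and they differ
    by z. *)
Lemma unif_convex_pair_gap : unif_convex ->
  exists2 rho : R, 1 / 2 <= rho < 1 & pair_gap rho.
Proof.
move=> uc; have e0 : 0 < (192 : R)^-1 by rewrite invr_gt0.
have [d /andP[d0 d1] dP] := uc _ e0.
exists (Num.max (1 / 2) (1 - d)); first by rewrite le_max gt_max; lra.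
move=> x y z xi yi zi zx zy xy v; set rho := Num.max _ _.
have rho1 : 1 - d <= rho by rewrite le_max lexx orbT.
have [|hlt] := leP (N (midavg x (midavg y v))) (rho * N v); [by left|right].
have hlt' : (1 - d) * N v < N (midavg x (midavg y v)).
  by apply: le_lt_trans hlt; rewrite ler_wpM2r // sn_ge0.
set w := midavg y v in hlt'.
have cw : N w <= N v by apply: contr_midavg => //; exact: isometric_contr.
have h1 : N (w - x w) <= 192^-1 * N v.
  rewrite leNgt; apply/negP => h.
  have := dP (N v) w (x w) cw; rewrite xi => /(_ cw (ltW h)).
  by rewrite -midavgE; lra.
have hw : (1 - d) * N v < N w.
  apply: lt_le_trans hlt' _; apply: contr_midavg => //; exact: isometric_contr.
have h2 : N (v - y v) <= 192^-1 * N v.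
  rewrite leNgt; apply/negP => h.
  have := dP (N v) v (y v) (lexx _); rewrite yi => /(_ (lexx _) (ltW h)).
  by rewrite -midavgE -/w; lra.
have h3 : N (v - w) <= 192^-1 * N v.
  rewrite snC // /w; apply: midavg_disp => //.
    by rewrite subrr sn0 // mulr_ge0 ?(sn_ge0 snN) ?invr_ge0.
  by rewrite snC.
have h4 : N (v - x v) <= 3 * (192^-1 * N v).
  have := sn_tri snN w v (x v); have := sn_tri snN (x w) w (x v).
  by rewrite -endoB xi (snC snN w v); lra.
have h5 : N (v - x (y v)) <= 4 * (192^-1 * N v).
  have := sn_tri snN (x v) v (x (y v)); rewrite -endoB xi; lra.
have h6 : N (v - y (x v)) <= 4 * (192^-1 * N v).
  have := sn_tri snN (y v) v (y (x v)); rewrite -endoB yi; lra.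
(* 192 = 8 * 24: x * y and y * x each move v by at most 4 / 192 of its norm. *)
have -> : N ((1 - z) v) = N (y (x v) - x (y v)).
  have -> : y (x v) - x (y v) = (y * x) ((1 - z) v).
    rewrite -!endoME xy mulrBr mulr1 endoBE -[z * y * x]mulrA.
    by rewrite (commrM zy zx).
  by rewrite endoME yi xi.
have := sn_tri snN v (y (x v)) (x (y v)); rewrite (snC snN (y _) v).
have := sn_ge0 snN v; lra.
Qed.

End HeisenbergGap.

(** * Decay of averages along a Heisenberg triple *)

Section Decay.
Local Open Scope ring_scope.

(** The rearrangements needed below are identities in an abstract ring, where
    rewriting does not meet the expressions that the letters stand for. *)
Lemma term_rearrange (A : pzRingType) (p p' h q e f d : A) :
  (forall g, GRing.comm h g) -> GRing.comm (e * f) d ->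
  p * (p' * (h * q * e) * f) * d = h * (p * p' * (q * d)) * (e * f).
Proof.
move=> hC efd; rewrite -!mulrA -efd -!mulrA (mulrA h p) (hC p) -!mulrA.
by rewrite (mulrA h p') (hC p') -!mulrA.
Qed.

Lemma level_rearrange (A : pzRingType) (p h q d : A) :
  (forall g, GRing.comm h g) -> GRing.comm q d ->
  p * (h * q * d * q) = h * (p * (d * q)) * q.
Proof.
move=> hC qd; rewrite -!mulrA (mulrA h p) (hC p) -!mulrA.
by rewrite (mulrA q d) qd -!mulrA.
Qed.

Lemma block_rearrange (A : pzRingType) (p d q e h q' d' : A) :
  (forall f, GRing.comm h f) -> (1 - q) * e = h * (1 - q') -> d * e = d' ->
  GRing.comm e (1 - q') ->
  p * (d * (1 - q)) * e * e = h * (p * (d' * (1 - q'))).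
Proof.
move=> hC qe <- eq'; rewrite (mulrA p) (mulrA h) (hC p) -!mulrA; congr (_ * _).
by rewrite (mulrA _ e e) qe -!mulrA eq' !mulrA -(hC d).
Qed.

Variables (R : realType) (V : lmodType R) (N : V -> R).
Hypothesis snN : seminorm N.

Lemma geom_tail (s m : nat) :
  \sum_(0 <= t < m) (4 / 5 : R) ^+ (m - t + s) <= 4 * (4 / 5) ^+ s.
Proof.
have q0 k : 0 <= (4 / 5 : R) ^+ k by apply: exprn_ge0; lra.
elim: m => [|m IHm]; first by rewrite big_geq // mulr_ge0.
rewrite big_nat_recr //= subSnn.
rewrite (_ : \sum_(0 <= i < m) _ =
    4 / 5 * \sum_(0 <= t < m) (4 / 5 : R) ^+ (m - t + s)).
  rewrite add1n exprS; have := q0 s; nra.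
rewrite mulr_sumr; apply: eq_big_nat => t /andP[_ tm].
by rewrite subSn ?(ltnW tm) // addSn exprS.
Qed.

Lemma gap_tail (g : nat) : (1 + g%:R) * (2 / 3 : R) ^+ g <= 3 * (4 / 5) ^+ g.
Proof.
suff h : (1 + g%:R) * (5 : R) ^+ g <= 3 * 6 ^+ g.
  have e1 : (2 / 3 : R) ^+ g = 5 ^+ g * (2 / 15) ^+ g by rewrite -exprMn;
    congr (_ ^+ _); lra.
  have e2 : (4 / 5 : R) ^+ g = 6 ^+ g * (2 / 15) ^+ g by rewrite -exprMn;
    congr (_ ^+ _); lra.
  by rewrite e1 e2 !mulrA ler_wpM2r // exprn_ge0 //; lra.
elim: g => [|g IHg]; first by rewrite !expr0; lra.
have [g3|g4] := ltnP g 4.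
  by move: g g3 {IHg} => [|[|[|[|//]]]] _; rewrite !exprS ?expr0; lra.
have g4' : (4 : R) <= g%:R by rewrite ler_nat.
have p5 : 0 < (5 : R) ^+ g by rewrite exprn_gt0.
have p6 : 0 < (6 : R) ^+ g by rewrite exprn_gt0.
rewrite !exprS -natr1; nra.
Qed.

Lemma expr_subn_le (k : R) n m : 0 < k <= 1 -> k ^+ (n - m) <= k ^+ n / k ^+ m.
Proof.
case/andP=> k0 k1; rewrite ler_pdivlMr ?exprn_gt0 // -exprD.
by apply: ler_wiXn2l; [exact: ltW | by [] | lia].
Qed.

Variables (rho kappa : R) (s : nat).
Hypothesis gapP : pair_gap N rho.
Hypothesis rhoP : 1 / 2 <= rho < 1.
Hypothesis kappaP : 3 / 4 <= kappa <= 1.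
Hypothesis sP : 16 * (4 / 5) ^+ s <= 1 - rho.
Hypothesis kP : rho <= (1 + rho) / 2 * kappa ^+ (s + 3).

Let k_gt0 : 0 < kappa. Proof. by case/andP: kappaP; lra. Qed.
Let k_ge0 n : 0 <= kappa ^+ n. Proof. by rewrite exprn_ge0 // ltW. Qed.

Let main_coef n : rho * kappa ^+ (n - (s + 3)) <= (1 + rho) / 2 * kappa ^+ n.
Proof.
have rho0 : 0 <= rho by case/andP: rhoP; lra.
apply: le_trans (ler_wpM2l rho0 (expr_subn_le n (s + 3) _)) _.
  by rewrite k_gt0; case/andP: kappaP.
by rewrite mulrA ler_pdivrMr ?exprn_gt0 // mulrAC ler_wpM2r.
Qed.

Let err_coef n g : 2^-1 ^+ g * (1 + g%:R) * kappa ^+ (n - (1 + g)) <=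
  4 * (4 / 5) ^+ g * kappa ^+ n.
Proof.
have c0 : 0 <= 2^-1 ^+ g * (1 + g%:R) :> R.
  by rewrite mulr_ge0 ?exprn_ge0 ?invr_ge0 // addr_ge0.
apply: le_trans (ler_wpM2l c0 (expr_subn_le n (1 + g) _)) _.
  by rewrite k_gt0; case/andP: kappaP.
rewrite mulrA ler_pdivrMr ?exprn_gt0 // [leRHS]mulrAC; apply: ler_wpM2r => //.
have kg : (3 / 4 : R) ^+ (1 + g) <= kappa ^+ (1 + g).
  by apply: lerXn2r; rewrite ?nnegrE; case/andP: kappaP; lra.
have g45 : 0 <= 4 * (4 / 5 : R) ^+ g by rewrite mulr_ge0 // exprn_ge0; lra.
apply: le_trans (ler_wpM2l g45 kg).
have -> : 2^-1 ^+ g = (2 / 3) ^+ g * (3 / 4) ^+ g :> R.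
  by rewrite -exprMn; congr (_ ^+ _); lra.
have p : 0 <= (3 / 4 : R) ^+ g by rewrite exprn_ge0; lra.
have := gap_tail g; rewrite add1n exprS; nra.
Qed.

Variables x y z : endo V.
Hypotheses (xi : isometric N x) (yi : isometric N y) (zi : isometric N z).
Hypotheses (zx : GRing.comm z x) (zy : GRing.comm z y).
Hypothesis xy : x * y = z * y * x.

Lemma heis_pow a b : x ^+ a * y ^+ b = z ^+ (a * b) * y ^+ b * x ^+ a.
Proof.
have x1 : forall b, x * y ^+ b = z ^+ b * y ^+ b * x.
  elim=> [|c IHc]; first by rewrite !expr0 !mulr1 mul1r.
  rewrite exprSr mulrA IHc -mulrA xy !mulrA [z ^+ c.+1]exprSr; congr (_ * _).
  by rewrite -!mulrA; congr (_ * _); rewrite mulrA -(commrX c zy) mulrA.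
elim: a => [|a IHa]; first by rewrite mul0n !expr0 mulr1 !mul1r.
rewrite exprS -mulrA IHa !mulrA (commrX _ (commr_sym zx)) -(mulrA _ x) x1.
by rewrite !mulrA -exprD mulSn addnC.
Qed.

(** Moving a power of x across an average of y twists the base of the average
    by a central element. All error terms of this part come from this twist. *)
Lemma x_dyavg i j :
  x ^+ (2 ^ i) * dyavg y 0 j = dyavg (z ^+ (2 ^ i) * y) 0 j * x ^+ (2 ^ i).
Proof.
elim: j => [|j IHj]; first by rewrite !dyavg_geq // mulr1 mul1r.
rewrite !dyavg_recr // mulrA IHj -!mulrA; congr (_ * _).
rewrite !midavg_def mulrA -halfC -!mulrA; congr (_ * _).
rewrite mulrDr mulrDl mulr1 mul1r heis_pow; congr (_ + _ * _).
by rewrite exprMn_comm -?exprM //; exact/commr_sym/commrX/commr_sym.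
Qed.

(** The part of the average at the scales from l' up to l telescopes against
    1 - z ^+ (2 ^ l'). *)
Lemma z_dyavg_small l' l : (l' <= l)%N ->
  (1 - z ^+ (2 ^ l')) * dyavg z 0 l =
  half V ^+ (l - l') * (1 - z ^+ (2 ^ l)) * dyavg z 0 l'.
Proof.
move=> l'l; rewrite -dyavg_sub // (@dyavg_cat _ _ z l') // -mulrA; congr (_ * _).
exact: comm_dyavg2 (commr_refl z).
Qed.

(** The factor 1 - z ^+ (2 ^ l) measures how far z is from being trivial at
    scale l, and the average over the scales below l is what lets the level l
    be changed. The two are always moved together, hence the lock. *)
Definition zblock l := locked (dyavg z 0 l * (1 - z ^+ (2 ^ l))).

Lemma zblock_def l : zblock l = dyavg z 0 l * (1 - z ^+ (2 ^ l)).
Proof. by rewrite /zblock -lock. Qed.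

Lemma comm_zblock u l : GRing.comm u z -> GRing.comm u (zblock l).
Proof.
move=> uz; rewrite zblock_def; apply: commrM; first exact: comm_dyavg.
by apply: commrB; [exact: commr1 | exact: commrX].
Qed.

Let xc := isometric_contr xi.
Let yc := isometric_contr yi.
Let zc := isometric_contr zi.
Let yz := commr_sym zy.

Lemma zblock_bound l v : N (zblock l v) <= 2 * N v.
Proof.
rewrite zblock_def; apply: le_trans (contr_dyavg snN _ _ zc _) _.
by apply: contr_sub => //; exact: contrX.
Qed.

Lemma decay_trivial i0 a b l v :
  N ((dyavg x i0 a * dyavg y 0 b * zblock l) v) <= 2 * N v.
Proof.
apply: le_trans (zblock_bound l v); rewrite endoME.
by apply: contrM; exact: contr_dyavg.
Qed.

Lemma zblock_lower l' l : (l' <= l)%N ->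
  dyavg z 0 l' * (1 - z ^+ (2 ^ l)) =
  zblock l + (\sum_(l' <= k < l) half V * zblock k) * (1 - z ^+ (2 ^ l)).
Proof.
move=> l'l; rewrite zblock_def -mulrDl; congr (_ * _).
have -> : \sum_(l' <= k < l) half V * zblock k =
    dyavg z 0 l' * (1 - dyavg z l' l).
  rewrite one_sub_dyavg // mulr_sumr; apply: eq_big_nat => k /andP[l'k _].
  rewrite zblock_def !mulrA -(halfC (dyavg _ _ _)) (@dyavg_cat _ _ z l' 0 k) ?l'k //.
  by rewrite !mulrA.
by rewrite (@dyavg_cat _ _ z l' 0 l) ?l'l // mulrBr mulr1 addrC subrK.
Qed.

(** An average over fewer scales than the level is a sum of blocks of lower
    level, one for each missing scale. *)
Lemma decay_lower X l' l c v : (l' <= l)%N -> 0 <= c ->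
  (forall m u, (l' <= m <= l)%N -> N ((X * zblock m) u) <= c * N u) ->
  N ((X * (dyavg z 0 l' * (1 - z ^+ (2 ^ l)))) v) <=
  (1 + (l - l')%:R) * c * N v.
Proof.
move=> l'l c0 hc; rewrite zblock_lower // mulrDr endoDE.
apply: le_trans (snD snN _ _) _; rewrite -mulrA mulrDl mul1r.
apply: lerD; first by apply: hc; rewrite l'l /=.
rewrite mulrA mulr_sumr endoME endo_sumE.
apply: le_trans (sn_sum snN _ _ _) _.
have -> : (l - l')%:R * (c * N v) = \sum_(l' <= k < l) (c * N v).
  by rewrite big_const_nat iter_addr_0 mulr_natl.
rewrite big_nat [leRHS]big_nat; apply: ler_sum => k /andP[l'k kl].
rewrite mulrA -halfC -mulrA endoME sn_halfE //.
have := hc k ((1 - z ^+ (2 ^ l)) v); rewrite l'k (ltnW kl) => /(_ isT).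
have /(contr_sub snN v) := contrX (2 ^ l) zc.
have := ler_wpM2l c0 (contr_sub snN v (contrX (2 ^ l) zc)); lra.
Qed.

(** The number of pairs of scales, i for x and l - i for y, that are present
    in both averages. The commutator of x ^+ (2 ^ i) and y ^+ (2 ^ (l - i))
    is z ^+ (2 ^ l). *)
Definition npeel i0 a b l := (minn a l - maxn i0 (l.+1 - b))%N.

Lemma npeel_main a i j l n m t : (i + j = l)%N -> (n.+1 <= minn a l - i)%N ->
  (m = l \/ m = l.+2) -> (n.+1 - (t + 3) <= npeel i.+1 a (j - t) m)%N.
Proof. by rewrite /npeel => ij nij [] ->; lia. Qed.

Lemma npeel_error a i j l n m t : (i + j = l)%N -> (n.+1 <= minn a l - i)%N ->
  (t < j)%N -> (i + t <= m)%N -> (m <= l)%N ->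
  (n.+1 - (1 + (j - t)) <= npeel i.+1 a t m)%N.
Proof. by rewrite /npeel => ij nij tj h1 h2; lia. Qed.

Definition decays n := forall i0 a b l v, (n <= npeel i0 a b l)%N ->
  N ((dyavg x i0 a * dyavg y 0 b * zblock l) v) <= 2 * kappa ^+ n * N v.

(** Peel off the averages of x and of y at two scales i and j with i + j = l.
    By pair_gap they either contract the vector by rho, or z ^+ (2 ^ l)
    almost fixes it. In the second case averaging over the scales l and l + 1
    of z changes the vector by little and raises the level to l + 2 at the
    price of a factor 1/4. Moving the peeled average of x past the remaining
    average of y twists the latter; the twist at the scale t of y produces
    blocks of level at least i + t, so the induction hypothesis applies to it
    with the prefactor 2 ^- (j - t), and these errors are summed over t. The
    scales between j - s and j are discarded in order to make this sum small
    compared with 1 - rho. *)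
Lemma heis_decay n : decays n.
Proof.
elim/ltn_ind: n => n IHn i0 a b l v.
case: n IHn => [|n] IHn npl.
  by rewrite expr0 mulr1; exact: decay_trivial.
set i := maxn i0 (l.+1 - b); set j := (l - i)%N.
have [i0i ia il jb ij] : [/\ i0 <= i, i < a, i < l, j < b & i + j = l]%N.
  by rewrite /j; move: npl; rewrite /npeel -/i; split; lia.
have nij : (n.+1 <= minn a l - i)%N by [].
clearbody j i.
(* Y omits the s scales of y just below j, so that the twists that it meets
   are all small. *)
set X := dyavg x i.+1 a; set Y := dyavg y 0 (j - s).
set xj := x ^+ (2 ^ i); set yj := y ^+ (2 ^ j).
set Yr := dyavg y (j - s) j * dyavg y j.+1 b.
have eT : dyavg x i0 a * dyavg y 0 b * zblock l =
    dyavg x i0 i * ((X * (midavg xj * Y * midavg yj) * zblock l) * Yr).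
  rewrite (@dyavg_cat _ _ x i i0 a) ?i0i ?(ltnW ia) // (dyavg_recl x ia).
  rewrite (@dyavg_cat _ _ y (j - s) 0 b) ?leq_subr; last by lia.
  rewrite (@dyavg_cat _ _ y j (j - s) b); last by lia.
  rewrite (dyavg_recl y jb) -/X -/Y -/xj -/yj.
  have cX : GRing.comm (midavg xj) X.
    apply/comm_dyavg/commr_sym/comm_midavg/commrX; exact: commr_refl.
  have cD : GRing.comm (dyavg y (j - s) j) (midavg yj).
    by apply/comm_midavg/commrX/commr_sym/comm_dyavg/commr_refl.
  have cZ : GRing.comm Yr (zblock l).
    by apply/comm_zblock/commr_sym/commrM; exact/comm_dyavg.
  rewrite -!mulrA; congr (_ * _); rewrite [LHS]mulrA cX -[LHS]mulrA.
  do 3 congr (_ * _); rewrite [LHS]mulrA cD -[LHS]mulrA; congr (_ * _).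
  by rewrite [LHS]mulrA; exact: cZ.
have Yrc : contr N Yr by apply: contrM; exact: contr_dyavg.
rewrite eT endoME; apply: le_trans (contr_dyavg snN _ _ xc _) _.
rewrite endoME; move: (Yr v) (Yrc v) => w wv.
apply: (@le_trans _ _ (2 * kappa ^+ n.+1 * N w)); last first.
  by rewrite ler_wpM2l // mulr_ge0.
have {eT Yrc v wv Yr} -> : X * (midavg xj * Y * midavg yj) * zblock l =
    X * Y * zblock l * (midavg xj * midavg yj) +
    half V * (X * (dyavg (z ^+ (2 ^ i) * y) 0 (j - s) - Y) * zblock l) *
      (xj * midavg yj).
  have -> : midavg xj * Y = Y * midavg xj +
      half V * ((dyavg (z ^+ (2 ^ i) * y) 0 (j - s) - Y) * xj).
    rewrite mulrBl -x_dyavg -/Y -/xj midavg_def [Y * _]mulrA -(halfC Y) -!mulrA.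
    rewrite -mulrDr; congr (_ * _); rewrite mulrDr mulrDl mulr1 mul1r.
    by rewrite -addrA; congr (_ + _); rewrite addrC subrK.
  have cZ : GRing.comm (midavg xj * midavg yj) (zblock l).
    apply/comm_zblock/commr_sym/commrM; exact/comm_midavg/commrX.
  have cZ' : GRing.comm (xj * midavg yj) (zblock l).
    by apply/comm_zblock/commr_sym/commrM; [exact/commrX | exact/comm_midavg/commrX].
  rewrite mulrDl mulrDr mulrDl; congr (_ + _).
    by rewrite -!mulrA; do 2 congr (_ * _); rewrite mulrA cZ.
  rewrite -!mulrA [LHS]mulrA -halfC -[LHS]mulrA; do 3 congr (_ * _).
  by rewrite mulrA cZ'.
rewrite endoDE; apply: le_trans (snD snN _ _) _.
have zetac : contr N (z ^+ (2 ^ l)) by exact: contrX.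
have main : N ((X * Y * zblock l * (midavg xj * midavg yj)) w) <=
    2 * (rho * kappa ^+ (n.+1 - (s + 3))) * N w.
  set K := kappa ^+ _; have K0 : 0 <= K by exact: k_ge0.
  have hn m : (m = l \/ m = l.+2) -> forall u,
      N ((X * Y * zblock m) u) <= 2 * K * N u.
    by move=> hm u; apply: IHn; [rewrite ltn_subrL addnS | exact: npeel_main hm].
  have mc : contr N (midavg xj * midavg yj).
    by apply: contrM; apply/contr_midavg/contrX.
  have gap : N (midavg xj (midavg yj w)) <= rho * N w \/
      N ((1 - z ^+ (2 ^ l)) w) <= 24^-1 * N w.
    apply: gapP; try exact: isometricX.
    - exact/commrX/commr_sym/commrX.
    - exact/commrX/commr_sym/commrX.
    - by rewrite heis_pow -expnD ij.
  rewrite endoME; case: gap => h.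
    apply: le_trans (hn l (or_introl erefl) _) _.
    by rewrite -!mulrA !ler_pM2l // mulrCA; apply: ler_wpM2l.
  set w1 := (midavg xj * midavg yj) w.
  have w1w : N w1 <= N w by exact: mc.
  have zw1 : N ((z ^+ (2 ^ l)) w1 - w1) <= 24^-1 * N w.
    rewrite snC // -[X in N (X - _)]endo1E -endoBE /w1 -endoME.
    have -> : (1 - z ^+ (2 ^ l)) * (midavg xj * midavg yj) =
        (midavg xj * midavg yj) * (1 - z ^+ (2 ^ l)).
      apply/commr_sym/commrB; first exact: commr1.
      by apply/commrX/commr_sym/commrM; exact/comm_midavg/commrX.
    by rewrite endoME; apply: le_trans (mc _) h.
  have N0 := sn_ge0 snN w.
  (* Z2 moves w1 by little because z ^+ (2 ^ l) does, and multiplication by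
     Z2 turns the factor 1 - z ^+ (2 ^ l) into a quarter of 1 - z ^+ (2 ^
     l.+2). *)
  set Z2 := dyavg z l l.+2.
  have Z2c : contr N Z2 by exact: contr_dyavg.
  have Z2E : Z2 = midavg (z ^+ (2 ^ l)) * midavg (z ^+ (2 ^ l.+1)).
    by rewrite /Z2 !dyavg_recr // dyavg_geq // mul1r.
  have hZ2 : N (w1 - Z2 w1) <= 8^-1 * N w.
    rewrite snC // Z2E endoME.
    have h2 : N (midavg (z ^+ (2 ^ l.+1)) w1 - w1) <= 12^-1 * N w.
      apply: midavg_disp => //; first by rewrite subrr sn0 // mulr_ge0 // invr_ge0.
      rewrite expnS mulSn mul1n exprD endoME.
      have := sn_tri snN ((z ^+ (2 ^ l)) w1) ((z ^+ (2 ^ l)) ((z ^+ (2 ^ l)) w1)) w1.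
      by rewrite -endoB; have := zetac ((z ^+ (2 ^ l)) w1 - w1); lra.
    apply: midavg_disp => //; first by lra.
    set u := midavg _ w1 in h2 *.
    have := sn_tri snN ((z ^+ (2 ^ l)) w1) ((z ^+ (2 ^ l)) u) w1.
    by rewrite -endoB; have := zetac (u - w1); lra.
  set u1 := w1 - Z2 w1 in hZ2 *.
  have -> : w1 = u1 + (Z2 u1 + Z2 (Z2 w1)) by rewrite /u1 endoB !subrK.
  have e3 : (X * Y * zblock l) (Z2 (Z2 w1)) =
      (half V ^+ 2 * (X * Y * zblock l.+2)) w1.
    rewrite -!endoME; congr (endo_fun _ w1); rewrite !zblock_def.
    apply: block_rearrange.
    - by move=> f; apply/commr_sym/commrX/commr_sym/halfC.
    - by rewrite dyavg_sub ?leqW // -(addn2 l) addKn.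
    - by rewrite -dyavg_cat // !leqW.
    - by apply: commrB; [exact: commr1 | exact/commrX/commr_sym/comm_dyavg/commr_refl].
  clearbody u1; rewrite !endoD e3 (endoME (half V ^+ 2)).
  have t1 := hn l (or_introl erefl) u1.
  have t2 := hn l (or_introl erefl) (Z2 u1).
  have t3 := hn l.+2 (or_intror erefl) w1.
  have t4 := Z2c u1.
  apply: le_trans (snD snN _ _) _; apply: le_trans (lerD (lexx _) (snD snN _ _)) _.
  rewrite sn_halfX //.
  move: rhoP => /andP[r1 _].
  have KN : 0 <= K * N w by rewrite mulr_ge0.
  have m1 := ler_wpM2l K0 hZ2; have m2 := ler_wpM2l K0 t4.
  have m3 := ler_wpM2l K0 w1w; have m4 := ler_wpM2r KN r1.
  lra.
have err : N ((half V * (X * (dyavg (z ^+ (2 ^ i) * y) 0 (j - s) - Y) *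
    zblock l) * (xj * midavg yj)) w) <= (1 - rho) * kappa ^+ n.+1 * N w.
  have w2w : N ((xj * midavg yj) w) <= N w.
    by apply: contrM => //; [exact: contrX | apply/contr_midavg/contrX].
  rewrite endoME; set w2 := (xj * midavg yj) w in w2w *; clearbody w2.
  rewrite endoME sn_halfE // dyavg_tw; last exact/commr_sym/commrX/commr_sym.
  rewrite mulr_sumr mulr_suml endo_sumE.
  have hsum : \sum_(0 <= t < j - s) (2^-1 ^+ (j - t) *
      (1 + (j - t)%:R) * (2 * kappa ^+ (n.+1 - (1 + (j - t)))) * N w) <=
      2 * (1 - rho) * kappa ^+ n.+1 * N w.
    have h1 : \sum_(0 <= t < j - s) (2^-1 ^+ (j - t) *
      (1 + (j - t)%:R) * (2 * kappa ^+ (n.+1 - (1 + (j - t)))) * N w) <=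
      \sum_(0 <= t < j - s) (8 * kappa ^+ n.+1 * N w) * (4 / 5) ^+ (j - s - t + s).
      rewrite big_nat [leRHS]big_nat; apply: ler_sum => t /andP[_ tj].
      have -> : (j - s - t + s = j - t)%N by rewrite subnAC subnK // ltnW // -subn_gt0 -subnDA addnC subnDA subn_gt0.
      have := ler_wpM2r (sn_ge0 snN w) (err_coef n.+1 (j - t)); lra.
    apply: le_trans h1 _; rewrite -mulr_sumr.
    have kn : 0 <= 8 * kappa ^+ n.+1 * N w.
      by rewrite mulr_ge0 ?(sn_ge0 snN) // mulr_ge0.
    apply: le_trans (ler_wpM2l kn (geom_tail _ _)) _.
    have := ler_wpM2l kn sP; lra.
  have -> : (1 - rho) * kappa ^+ n.+1 * N w =
      2^-1 * (2 * (1 - rho) * kappa ^+ n.+1 * N w) by lra.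
  rewrite ler_pM2l ?invr_gt0 //; apply: le_trans hsum.
  apply: le_trans (sn_sum snN _ _ _) _.
  rewrite big_nat [leRHS]big_nat; apply: ler_sum => t /andP[_ tj].
  set Yt := dyavg y 0 t; set Ytw := dyavg _ t.+1 _.
  have cw : GRing.comm (y ^+ (2 ^ t) * Ytw) (zblock l).
    apply/comm_zblock/commr_sym/commrM; first exact/commrX.
    by apply/comm_dyavg/commrM => //; exact/commrX/commr_refl.
  have -> : X * (Yt * (half V * ((z ^+ (2 ^ i)) ^+ (2 ^ t) - 1) * y ^+ (2 ^ t))
    * Ytw) * zblock l
     = half V * (X * Yt * (((z ^+ (2 ^ i)) ^+ (2 ^ t) - 1) * zblock l))
       * (y ^+ (2 ^ t) * Ytw).
    exact: (term_rearrange _ _ _ (@halfC R V) cw).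
  have v3w : N ((y ^+ (2 ^ t) * Ytw) w2) <= N w.
    apply: le_trans _ w2w; apply: (contrM (contrX _ yc)) => u.
    by apply: contr_dyavg => //; exact: contrM (contrX _ zc) yc.
  rewrite endoME; move: ((_ * Ytw) w2) v3w => v3 v3w.
  rewrite endoME sn_halfE // -exprM -expnD.
  have tj' : (t < j)%N := leq_trans tj (leq_subr _ _).
  have lE : ((i + t) <= l)%N by rewrite -ij leq_add2l ltnW.
  have gE : (l - (i + t) = j - t)%N by rewrite -ij subnDl.
  set l' := (i + t)%N in lE gE *.
  have -> : X * Yt * ((z ^+ (2 ^ l') - 1) * zblock l) =
      - (half V ^+ (j - t) * (X * Yt * (dyavg z 0 l' * (1 - z ^+ (2 ^ l))))
         * (1 - z ^+ (2 ^ l))).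
    rewrite -opprB mulNr mulrN zblock_def (mulrA (1 - _)) z_dyavg_small // gE.
    have hC f : GRing.comm (half V ^+ (j - t)) f.
      exact/commr_sym/commrX/commr_sym/halfC.
    have dC : GRing.comm (1 - z ^+ (2 ^ l)) (dyavg z 0 l').
      by apply/comm_dyavg/commr_sym/commrB; [exact: commr1 | exact/commrX/commr_refl].
    by congr (- _); exact: (level_rearrange _ hC dC).
  rewrite endoNE snopp // endoME endoME sn_halfX //.
  set u := (1 - z ^+ (2 ^ l)) v3.
  have uw : N u <= 2 * N w.
    by apply: le_trans (contr_sub snN _ zetac) _; lra.
  have := @decay_lower (X * Yt) l' l (2 * kappa ^+ (n.+1 - (1 + (j - t)))) u lE.
  rewrite gE => /(_ _ _)/wrap[].
  - by rewrite mulr_ge0.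
  - move=> m u' /andP[m1 m2]; apply: IHn; first by rewrite ltn_subrL.
    exact: npeel_error ij nij tj' m1 m2.
  set A := N _; set c := _ * kappa ^+ _ => hA.
  have c0 : 0 <= c by rewrite mulr_ge0.
  have g0 : 0 <= 1 + (j - t)%:R :> R by rewrite addr_ge0.
  have := ler_wpM2l (mulr_ge0 g0 c0) uw.
  have h0 : 0 <= 2^-1 ^+ (j - t) :> R by rewrite exprn_ge0 // invr_ge0.
  move=> h1; have := ler_wpM2l h0 (le_trans hA h1); lra.
have := main_coef n.+1; have := sn_ge0 snN w; nra.
Qed.

End Decay.

(** * Decay for vectors of bounded displacement *)

Section Numeric.
Local Open Scope ring_scope.
Variable R : realType.

Lemma bernoulli (h : R) n : 0 <= h -> 1 + n%:R * h <= (1 + h) ^+ n.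
Proof.
move=> h0; elim: n => [|n IHn]; first by rewrite expr0; lra.
have n0 : 0 <= n%:R :> R by [].
rewrite exprS -natr1; have := mulr_ge0 (mulr_ge0 n0 h0) h0; nra.
Qed.

Lemma bernoulli_sub (t : R) n : 0 <= t <= 1 -> 1 - n%:R * t <= (1 - t) ^+ n.
Proof.
case/andP=> t0 t1; elim: n => [|n IHn]; first by rewrite expr0; lra.
have n0 : 0 <= n%:R :> R by [].
rewrite exprS -natr1; have := mulr_ge0 (mulr_ge0 n0 t0) t0; nra.
Qed.

Lemma geometric_small (q e : R) : 0 <= q < 1 -> 0 < e ->
  exists n, forall m, (n <= m)%N -> q ^+ m <= e.
Proof.
case/andP=> q0 q1 e0.
suff [n hn] : exists n, q ^+ n <= e.
  exists n => m nm; apply: le_trans hn.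
  by apply: ler_wiXn2l => //; exact: ltW.
have [->|qn0] := eqVneq q 0; first by exists 1%N; rewrite expr1 ltW.
have qp : 0 < q by rewrite lt_def qn0.
set h := q^-1 - 1; have h0 : 0 < h by rewrite subr_gt0 invf_gt1.
have [n hn] : exists n : nat, (e * h)^-1 < n%:R.
  exists (Num.Def.archi_bound (e * h)^-1).
  by apply: archi_boundP; rewrite invr_ge0 ltW // mulr_gt0.
exists n; rewrite -[q ^+ n]invrK -exprVn -[leRHS]invrK lef_pV2 ?posrE ?invr_gt0 //.
  have -> : q^-1 = 1 + h by rewrite /h addrC subrK.
  apply: le_trans (bernoulli n (ltW h0)).
  have : e^-1 < n%:R * h.
    by rewrite -ltr_pdivrMr // -invfM.
  lra.
by rewrite exprn_gt0 // invr_gt0.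
Qed.

End Numeric.

Section HeisenbergTriples.
Local Open Scope ring_scope.
Variables (R : realType) (V : lmodType R) (N : V -> R).
Hypothesis snN : seminorm N.

(** The commutator may be z or its inverse, which makes the notion symmetric
    in x and y. *)
Record heisenberg (x y z : endo V) : Prop := Heisenberg {
  heis_ix : isometric N x; heis_iy : isometric N y; heis_iz : isometric N z;
  heis_zx : GRing.comm z x; heis_zy : GRing.comm z y;
  heis_rel : exists zV, [/\ isometric N zV, zV * z = 1, z * zV = 1 &
    (x * y = z * y * x \/ x * y = zV * y * x)] }.

Lemma comm_inv (x z zV : endo V) : zV * z = 1 -> z * zV = 1 ->
  GRing.comm z x -> GRing.comm zV x.
Proof.
move=> zVz zzV zx; rewrite /GRing.comm -[LHS]mulr1 -zzV -mulrA (mulrA x).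
by rewrite -zx -(mulrA z) mulrA zVz mul1r.
Qed.

Lemma heisenberg_sym (x y z : endo V) : heisenberg x y z -> heisenberg y x z.
Proof.
case=> ix iy iz zx zy [zV [izV zVz zzV rel]]; split => //.
exists zV; split => //.
by case: rel => rel; [right|left]; rewrite -mulrA rel !mulrA ?zVz ?zzV mul1r.
Qed.

Definition decay_rate (kappa : R) := forall (x y z : endo V) n a b l (v : V),
  heisenberg x y z -> (n <= npeel 0 a b l)%N ->
  N ((dyavg x 0 a * dyavg y 0 b * zblock z l) v) <= 2 * kappa ^+ n * N v.

(** Replacing z by its inverse changes a block by a sign and an isometry, so
    the decay does not depend on the sign of the commutator. *)
Lemma zblock_inv (z zV : endo V) l : zV * z = 1 -> z * zV = 1 ->
  exists n, zblock z l = - (z ^+ n * zblock zV l).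
Proof.
move=> zVz zzV; have c : GRing.comm z zV by rewrite /GRing.comm zzV.
have zk k : z ^+ k * zV ^+ k = 1.
  by rewrite -exprMn_comm // zzV expr1n.
have hd : forall m, exists n, dyavg z 0 m = z ^+ n * dyavg zV 0 m.
  elim=> [|m [n IHm]]; first by exists 0%N; rewrite !dyavg_geq // expr0 mulr1.
  exists (n + 2 ^ m)%N; rewrite !dyavg_recr // IHm exprD -!mulrA; congr (_ * _).
  rewrite mulrA (comm_dyavg _ _ (commr_sym (commrX _ (commr_sym c)))) -mulrA.
  congr (_ * _); rewrite !midavg_def mulrA -halfC -mulrA; congr (_ * _).
  by rewrite mulrDr mulr1 zk addrC.
have [n hn] := hd l; exists (n + 2 ^ l)%N.
rewrite !zblock_def hn exprD -!mulrA -mulrN; congr (_ * _).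
rewrite [z ^+ _ * _]mulrA (comm_dyavg _ _ (commr_sym (commrX _ (commr_sym c)))) -mulrA.
by rewrite -mulrN; congr (_ * _); rewrite mulrBr zk mulr1 opprB.
Qed.

(** The parameter s of heis_decay is chosen first, so that (4/5) ^+ s is
    small compared with 1 - rho; then kappa is taken close enough to 1 for
    kappa ^+ (s + 3) to absorb the loss of s + 3 levels. *)
Lemma decay_rate_exists : unif_convex N ->
  exists2 kappa : R, 3 / 4 <= kappa < 1 & decay_rate kappa.
Proof.
move=> /(unif_convex_pair_gap snN)[rho rhoP gapP].
have /andP[r0 r1] := rhoP.
have [s sP] : exists s, 16 * (4 / 5 : R) ^+ s <= 1 - rho.
  have [||s /(_ s (leqnn s)) hs] := @geometric_small R (4 / 5) ((1 - rho) / 16).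
  - by lra.
  - by lra.
  by exists s; lra.
have m0 : 0 < (s + 3)%:R :> R by rewrite ltr0n addn3.
set t := (1 - rho) / (4 * (s + 3)%:R).
have t0 : 0 < t by rewrite divr_gt0 ?mulr_gt0 // subr_gt0.
have tE : (s + 3)%:R * t = (1 - rho) / 4
  by rewrite /t invfM mulrCA (mulrCA _ 4^-1) mulfV ?gt_eqF // mulr1.
have m1 : 1 <= (s + 3)%:R :> R by rewrite ler1n addn3.
have t1 : t <= 1 / 4 by have : t <= (s + 3)%:R * t; [rewrite ler_peMl // ltW | lra].
exists (1 - t); first by lra.
have kP : rho <= (1 + rho) / 2 * (1 - t) ^+ (s + 3).
  have t01 : 0 <= t <= 1 by lra.
  have := bernoulli_sub (s + 3) t01; rewrite tE => hb.
  have rp : 0 <= (1 + rho) / 2 by lra.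
  by have := ler_wpM2l rp hb; nra.
have kk : 3 / 4 <= 1 - t <= 1 by lra.
move=> x y z n a b l v [ix iy iz zx zy [zV [izV zVz zzV rel]]] npl.
have zVx := comm_inv zVz zzV zx; have zVy := comm_inv zVz zzV zy.
case: rel => rel.
  exact: (@heis_decay _ _ _ snN _ _ _ gapP rhoP kk sP kP x y z).
have [k ->] := zblock_inv l zVz zzV.
rewrite mulrN endoNE snopp // mulrA.
have -> : dyavg x 0 a * dyavg y 0 b * z ^+ k = z ^+ k * (dyavg x 0 a * dyavg y 0 b).
  by apply/commr_sym/commrM; apply/comm_dyavg/commr_sym/commrX/commr_sym.
rewrite -(mulrA (z ^+ k)) (endoME (z ^+ k)) isometricX //.
exact: (@heis_decay _ _ _ snN _ _ _ gapP rhoP kk sP kP x y zV).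
Qed.

Variable kappa : R.
Hypothesis kappaP : 3 / 4 <= kappa < 1.
Hypothesis kdecay : decay_rate kappa.

Section Triple.
Variables x y z : endo V.
Hypothesis hxyz : heisenberg x y z.

Let zz := commr_refl z.

Lemma split_rearrange (A : pzRingType) (d q e : A) :
  GRing.comm d e -> GRing.comm d q -> GRing.comm e q ->
  d * q = q * e * d + d * (1 - e) * q.
Proof.
by move=> de dq eq; rewrite mulrBr mulr1 mulrBl -eq -mulrA -dq mulrA -de addrC subrK.
Qed.

(** Inserting the average over the next H scales either telescopes, leaving
    the factor 2^-1 ^+ H, or produces blocks of higher level. *)
Lemma zblock_split l H : zblock z l =
  half V ^+ H * ((1 - z ^+ (2 ^ (l + H))) * dyavg z 0 l) +
  \sum_(l <= k < l + H) half V * zblock z k * (1 - z ^+ (2 ^ l)).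
Proof.
have lH : (l <= l + H)%N by rewrite leq_addr.
rewrite zblock_def -mulr_suml.
have -> : \sum_(l <= k < l + H) half V * zblock z k =
    dyavg z 0 l * (1 - dyavg z l (l + H)).
  rewrite one_sub_dyavg // mulr_sumr; apply: eq_big_nat => k /andP[lk _].
  rewrite zblock_def !mulrA -(halfC (dyavg _ _ _)) (@dyavg_cat _ _ z l 0 k) ?lk //.
  by rewrite !mulrA.
have c k m : GRing.comm (dyavg z k m) (1 - z ^+ (2 ^ l)).
  by apply: commrB; [exact: commr1 | exact/commrX/commr_sym/comm_dyavg].
have S : (1 - z ^+ (2 ^ l)) * dyavg z l (l + H) =
    half V ^+ H * (1 - z ^+ (2 ^ (l + H))) by rewrite dyavg_sub // addKn.
rewrite (mulrA (half V ^+ H)) -S.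
exact: (split_rearrange (comm_dyavg2 _ _ _ _ zz) (c _ _) (c _ _)).
Qed.

(** Decay stated for a vector u of which only the displacement under powers
    of z is controlled, not its norm: u is hit by a second difference 1 - z
    ^+ (2 ^ l), and zblock_split provides it. *)
Lemma level_bound a b l H u d : (0 < H)%N ->
  (forall m, (m < H)%N -> (H <= npeel 0 a b (l + m))%N) ->
  (forall t, (t <= l + H)%N -> N ((1 - z ^+ (2 ^ t)) u) <= d) ->
  N ((dyavg x 0 a * dyavg y 0 b * zblock z l) u) <= H.+1%:R * kappa ^+ H * d.
Proof.
move=> H0 hp hd; have [ix iy iz zx zy _] := hxyz.
have d0 : 0 <= d by apply: le_trans (hd 0 _) => //; exact: sn_ge0.
have [k1 k2] := andP kappaP; have k0 : 0 < kappa by lra.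
have xc := isometric_contr ix; have yc := isometric_contr iy.
have zc := isometric_contr iz.
rewrite (zblock_split l H) mulrDr endoDE; apply: le_trans (snD snN _ _) _.
rewrite addrC; have -> : H.+1%:R * kappa ^+ H * d =
    H%:R * kappa ^+ H * d + kappa ^+ H * d by rewrite -natr1; ring.
apply: lerD.
  rewrite mulr_sumr endo_sumE; apply: le_trans (sn_sum snN _ _ _) _.
  have -> : H%:R * kappa ^+ H * d = \sum_(l <= k < l + H) kappa ^+ H * d.
    by rewrite big_const_nat iter_addr_0 addKn -mulrA mulr_natl.
  rewrite big_nat [leRHS]big_nat; apply: ler_sum => k /andP[lk kl].
  rewrite !mulrA -(halfC (_ * _)) -!(mulrA (half V)) endoME sn_halfE // endoME.
  have h1 := hp (k - l)%N; rewrite subnKC // in h1.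
  have := @kdecay x y z H a b k ((1 - z ^+ (2 ^ l)) u) hxyz (h1 _).
  have := ler_wpM2l (exprn_ge0 H (ltW k0)) (hd l (leq_addr _ _)).
  move=> hh /(_ _)/wrap[]; [lia | lra].
rewrite mulrA -(commr_sym (commrX H (commr_sym (halfC (_ * _))))) -mulrA endoME.
rewrite sn_halfX //; apply: ler_pM => //.
- by rewrite exprn_ge0 // invr_ge0.
- exact: sn_ge0.
- by apply: lerXn2r; rewrite ?nnegrE; lra.
rewrite endoME; apply: le_trans (contrM (contr_dyavg snN _ _ xc)
  (contr_dyavg snN _ _ yc) _) _.
have -> : (1 - z ^+ (2 ^ (l + H)))
  * dyavg z 0 l = dyavg z 0 l * (1 - z ^+ (2 ^ (l + H))).
  by apply/commr_sym/commrB; [exact: commr1 | exact/commrX/commr_sym/comm_dyavg].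
by rewrite endoME; apply: le_trans (contr_dyavg snN _ _ zc _) _; exact: hd.
Qed.

End Triple.
End HeisenbergTriples.

(** * Adjusting and exchanging averages *)

Section Moves.
Local Open Scope ring_scope.
Variables (R : realType) (V : lmodType R) (N : V -> R).
Hypothesis snN : seminorm N.
Lemma swap_rearrange (A : pzRingType) (p m q z : A) : GRing.comm m z ->
  (p * m * q - q * (p * m)) * z =
  p * ((m * q - q * m) * z) + (p * q - q * p) * z * m.
Proof.
move=> mz; rewrite -(mulrA _ z m) -mz (mulrA _ m z) (mulrA p) -mulrDl.
by congr (_ * _); rewrite mulrBr mulrBl !mulrA addrA subrK.
Qed.

(** An average of z over many scales almost absorbs the powers of z at small
    scales. *)
Lemma small_z (z : endo V) l c u : isometric N z -> (l <= c)%N ->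
  N (((1 - z ^+ (2 ^ l)) * dyavg z 0 c) u) <=
  2^-1 ^+ (c - l) * N ((1 - z ^+ (2 ^ c)) u).
Proof.
move=> iz lc; rewrite z_dyavg_small // -mulrA endoME sn_halfX //.
rewrite ler_wpM2l ?exprn_ge0 ?invr_ge0 //.
have -> : (1 - z ^+ (2 ^ c)) * dyavg z 0 l = dyavg z 0 l * (1 - z ^+ (2 ^ c)).
  apply/commr_sym/commrB; first exact: commr1.
  exact/commrX/commr_sym/comm_dyavg/commr_refl.
by rewrite endoME; apply: contr_dyavg => //; exact: isometric_contr.
Qed.

Lemma comm_disp (z T : endo V) n u : contr N T -> GRing.comm z T ->
  N ((1 - z ^+ n) (T u)) <= N ((1 - z ^+ n) u).
Proof.
move=> Tc zT; rewrite -endoME.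
have -> : (1 - z ^+ n) * T = T * (1 - z ^+ n).
  by apply/commr_sym/commrB; [exact: commr1 | exact/commrX/commr_sym].
by rewrite endoME.
Qed.

Section PositiveTriple.
Variables x y z : endo V.
Hypotheses (ix : isometric N x) (iy : isometric N y) (iz : isometric N z).
Hypotheses (zx : GRing.comm z x) (zy : GRing.comm z y) (xy : x * y = z * y * x).

Lemma swap_factor i b c u : (i + b <= c)%N ->
  N (((midavg (x ^+ (2 ^ i)) * dyavg y 0 b - dyavg y 0 b * midavg (x ^+ (2 ^ i)))
      * dyavg z 0 c) u) <=
  b%:R * 2^-1 ^+ (c - (i + b)) * N ((1 - z ^+ (2 ^ c)) u).
Proof.
move=> ibc; set xj := x ^+ (2 ^ i); set Y := dyavg y 0 b.
set Yt := dyavg (z ^+ (2 ^ i) * y) 0 b.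
have xjc : contr N xj by apply/contrX/isometric_contr.
have zxj : GRing.comm z xj by exact: commrX.
have -> : midavg xj * Y - Y * midavg xj = half V * ((Yt - Y) * xj).
  rewrite midavg_def [Y * _]mulrA -(halfC Y) -!mulrA -mulrBr; congr (_ * _).
  rewrite mulrBl -x_dyavg // -/Y -/xj mulrDl mulrDr mul1r mulr1.
  by rewrite opprD addrACA subrr add0r.
rewrite -mulrA endoME sn_halfE // -mulrA (comm_dyavg 0 c (commr_sym zxj)).
rewrite mulrA endoME -/Yt.
have hu := @comm_disp z xj (2 ^ c) u xjc zxj; move: (xj u) hu => u' hu.
rewrite dyavg_tw; last exact/commr_sym/commrX/commr_sym.
rewrite mulr_suml endo_sumE.
set d := N ((1 - z ^+ (2 ^ c)) u).
suff hs : forall t, (t < b)%N ->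
  N ((dyavg y 0 t * (half V * ((z ^+ (2 ^ i)) ^+ (2 ^ t) - 1)
   * y ^+ (2 ^ t)) * dyavg (z ^+ (2 ^ i) * y) t.+1 b * dyavg z 0 c) u') <=
   2^-1 ^+ (c - (i + b)) * d.
  have d0 : 0 <= d by exact: sn_ge0.
  have e0 : 0 <= 2^-1 ^+ (c - (i + b))
    * d :> R by rewrite mulr_ge0 // exprn_ge0 // invr_ge0.
  apply: (@le_trans _ _ (2^-1 * (b%:R * (2^-1 ^+ (c - (i + b)) * d)))); last first.
    by rewrite -mulrA; have : 0 <= b%:R * (2^-1 ^+ (c - (i + b)) * d) :> R;
      [rewrite mulr_ge0 | lra].
  rewrite ler_pM2l ?invr_gt0 //; apply: le_trans (sn_sum snN _ _ _) _.
  have -> : b%:R * (2^-1 ^+ (c - (i + b)) * d) =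
      \sum_(0 <= t < b) 2^-1 ^+ (c - (i + b)) * d.
    by rewrite big_const_nat iter_addr_0 subn0 mulr_natl.
  by rewrite big_nat [leRHS]big_nat; apply: ler_sum => t /andP[_ tb]; exact: hs.
move=> t tb; set Ytw := dyavg _ t.+1 b.
have zYtw : GRing.comm z (y ^+ (2 ^ t) * Ytw).
  apply: commrM; first exact: commrX.
  by apply/comm_dyavg/commrM => //; exact/commrX/commr_refl.
have cw : GRing.comm (y ^+ (2 ^ t) * Ytw) (dyavg z 0 c) by exact/comm_dyavg/commr_sym.
rewrite -[X in X * dyavg z 0 c]mul1r (mulrA 1) -(mulrA 1)
  (term_rearrange _ _ _ (@halfC R V) cw).
rewrite mul1r endoME.
have Tc : contr N (y ^+ (2 ^ t) * Ytw).
  apply: contrM; first exact/contrX/isometric_contr.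
  apply: contr_dyavg => //; apply: contrM; last exact: isometric_contr.
  exact/contrX/isometric_contr.
have := @comm_disp z _ (2 ^ c) u' Tc zYtw; move: ((y ^+ (2 ^ t) * Ytw) u') => w hw.
rewrite endoME sn_halfE // endoME -exprM -expnD -opprB mulNr endoNE.
apply: (@le_trans _ _ (2^-1 * N (((1 - z ^+ (2 ^ (i + t))) * dyavg z 0 c) w))).
  rewrite ler_pM2l ?invr_gt0 //;
    apply: le_trans (contr_dyavg snN _ _ (isometric_contr iy) _) _.
  by rewrite snopp.
have itc : (i + t <= c)%N by lia.
have h1 := @small_z z (i + t) c w iz itc.
have h2 : 2^-1 ^+ (c - (i + t)) <= 2^-1 ^+ (c - (i + b)) :> R.
  by apply: ler_wiXn2l; [rewrite invr_ge0 | lra | lia].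
have p1 : 0 <= 2^-1 ^+ (c - (i + t)) :> R by rewrite exprn_ge0 // invr_ge0.
have d0 : 0 <= d by exact: sn_ge0.
have h3 := ler_wpM2l p1 (le_trans hw hu); have h4 := ler_wpM2r d0 h2.
have h5 := sn_ge0 snN (((1 - z ^+ (2 ^ (i + t))) * dyavg z 0 c) w).
rewrite -/d in h3; lra.
Qed.

(** Exchanging the averages of x and y costs powers of z up to the scale a0 +
    b, and these are absorbed by the average of z at the larger scale c. *)
Lemma swap_positive a0 a b c u : (a <= a0)%N -> (a0 + b <= c)%N ->
  N (((dyavg x 0 a * dyavg y 0 b - dyavg y 0 b * dyavg x 0 a) * dyavg z 0 c) u) <=
  (a * b)%:R * 2^-1 ^+ (c - (a0 + b)) * N ((1 - z ^+ (2 ^ c)) u).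
Proof.
move=> + abc; elim: a u => [|a IHa] u aa.
  by rewrite dyavg_geq // mul1r mulr1 subrr mul0r endo0E sn0 // mul0n !mul0r.
rewrite dyavg_recr //; set Xa := dyavg x 0 a; set m := midavg _; set Y := dyavg y 0 b.
have mc : contr N m by apply/contr_midavg/contrX/isometric_contr.
have zm : GRing.comm z m by exact/comm_midavg/commrX.
have -> : (Xa * m * Y - Y * (Xa * m)) * dyavg z 0 c =
    Xa * ((m * Y - Y * m) * dyavg z 0 c) + (Xa * Y - Y * Xa) * dyavg z 0 c * m.
  by apply: swap_rearrange; exact/comm_dyavg/commr_sym.
rewrite endoDE; apply: le_trans (snD snN _ _) _.
rewrite endoME (endoME _ m).
have h1 := IHa (m u) (ltnW aa).
have h2 := @comm_disp z m (2 ^ c) u mc zm.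
have ibc : (a + b <= c)%N by lia.
have h3 := @swap_factor a b c u ibc.
have h4 := contr_dyavg snN 0 a (isometric_contr ix) (((m * Y - Y * m) * dyavg z 0 c) u).
have h5 : 2^-1 ^+ (c - (a + b)) <= 2^-1 ^+ (c - (a0 + b)) :> R.
  by apply: ler_wiXn2l; [rewrite invr_ge0 | lra | lia].
have p1 : 0 <= 2^-1 ^+ (c - (a0 + b)) :> R by rewrite exprn_ge0 // invr_ge0.
have d0 := sn_ge0 snN ((1 - z ^+ (2 ^ c)) u).
have b0 : 0 <= b%:R :> R by [].
have ab0 : 0 <= (a * b)%:R * 2^-1 ^+ (c - (a0 + b)) :> R by rewrite mulr_ge0.
have h6 := ler_wpM2l ab0 h2.
have h7 := ler_wpM2r d0 (ler_wpM2l b0 h5).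
rewrite mulSn natrD; lra.
Qed.

End PositiveTriple.

(** The sign of the commutator is dealt with by exchanging the roles of x and
    y. *)
Lemma swap A (x y z : endo V) a b c u d : heisenberg N x y z -> contr N A ->
  (a + b <= c)%N -> N ((1 - z ^+ (2 ^ c)) u) <= d ->
  N ((A * (dyavg x 0 a * dyavg z 0 c * dyavg y 0 b)) u -
     (A * (dyavg y 0 b * dyavg z 0 c * dyavg x 0 a)) u) <=
  (a * b)%:R * 2^-1 ^+ (c - (a + b)) * d.
Proof.
move=> hxyz Ac abc hd.
wlog xy : x y a b hxyz abc / x * y = z * y * x.
  move=> hw; have [_ _ _ zx zy [zV [_ zVz zzV [/hw|]]]] := hxyz; first exact.
  move=> xy; rewrite snC // mulnC (addnC a); apply: hw; first exact: heisenberg_sym.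
    by rewrite addnC.
  by rewrite -mulrA xy !mulrA zzV mul1r.
case: hxyz => ix iy iz zx zy _.
have c0 : 0 <= (a * b)%:R * 2^-1 ^+ (c - (a + b)) :> R.
  by rewrite mulr_ge0 // exprn_ge0 // invr_ge0.
apply: le_trans (ler_wpM2l c0 hd).
have -> : (A * (dyavg x 0 a * dyavg z 0 c * dyavg y 0 b)) u -
    (A * (dyavg y 0 b * dyavg z 0 c * dyavg x 0 a)) u =
    A (((dyavg x 0 a * dyavg y 0 b - dyavg y 0 b * dyavg x 0 a) * dyavg z 0 c) u).
  rewrite -endoBE -endoME -mulrBr mulrBl -!mulrA.
  by rewrite (comm_dyavg2 _ _ _ _ zy) (comm_dyavg2 _ _ _ _ zx).
apply: le_trans (Ac _) _; exact: swap_positive.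
Qed.

Variable kappa : R.
Hypothesis kappaP : 3 / 4 <= kappa < 1.
Hypothesis kdecay : decay_rate N kappa.

Lemma sub_dyavg_blocks (z : endo V) l0 l1 : (l0 <= l1)%N ->
  dyavg z 0 l0 - dyavg z 0 l1 = \sum_(l0 <= k < l1) half V * zblock z k.
Proof.
move=> ll; rewrite (@dyavg_cat _ _ z l0 0 l1) ?ll // -{1}[dyavg z 0 l0]mulr1.
rewrite -mulrBr one_sub_dyavg // mulr_sumr; apply: eq_big_nat => k /andP[lk _].
rewrite zblock_def !mulrA -(halfC (dyavg _ _ _)) (@dyavg_cat _ _ z l0 0 k) ?lk //.
by rewrite !mulrA.
Qed.

(** The difference of two averages of z is a sum of the blocks in between.
    The bounds on l0 and l1 leave at least H pairs of scales to be peeled off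
    from the averages of x and y at each of these levels. *)
Lemma adjust_le (x y z : endo V) a b l0 l1 H u d : heisenberg N x y z ->
  (0 < H)%N -> (2 * H <= a)%N -> (2 * H <= b)%N -> (H <= l0 <= l1)%N ->
  (l1 + 2 * H <= a + b)%N ->
  (forall t, (t <= a + b)%N -> N ((1 - z ^+ (2 ^ t)) u) <= d) ->
  N ((dyavg x 0 a * dyavg y 0 b * (dyavg z 0 l0 - dyavg z 0 l1)) u) <=
  (a + b)%:R * H.+1%:R * kappa ^+ H * d.
Proof.
move=> hxyz H0 Ha Hb /andP[Hl ll] lab hd.
have [k1 k2] := andP kappaP; have k0 : 0 < kappa by lra.
have d0 : 0 <= d by apply: le_trans (hd 0 _) => //; exact: sn_ge0.
rewrite sub_dyavg_blocks // mulr_sumr endo_sumE.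
apply: le_trans (sn_sum snN _ _ _) _.
have c0 : 0 <= H.+1%:R * kappa ^+ H * d by rewrite !mulr_ge0 // exprn_ge0 // ltW.
apply: (@le_trans _ _ (\sum_(l0 <= k < l1) (H.+1%:R * kappa ^+ H * d))); last first.
  rewrite big_const_nat iter_addr_0 -[leLHS]mulr_natl.
  rewrite -(mulrA _ H.+1%:R) -(mulrA (a + b)%:R).
  by apply: ler_wpM2r => //; rewrite ler_nat; lia.
rewrite big_nat [leRHS]big_nat; apply: ler_sum => l /andP[l0l ll1].
rewrite mulrA -halfC -mulrA endoME sn_halfE //.
have h := @level_bound _ _ _ snN _ kappaP kdecay x y z hxyz a b l H u d H0.
have : N ((dyavg x 0 a * dyavg y 0 b * zblock z l) u) <= H.+1%:R * kappa ^+ H * d.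
  apply: h => [m mH | t tH]; last by apply: hd; lia.
  rewrite /npeel; lia.
by have := sn_ge0 snN ((dyavg x 0 a * dyavg y 0 b * zblock z l) u); lra.
Qed.

Lemma word_rearrange (A : pzRingType) (a x z y z' : A) : GRing.comm y z ->
  GRing.comm y z' -> a * (x * z * y) - a * (x * z' * y) = a * (x * y * (z - z')).
Proof.
by move=> yz yz'; rewrite (mulrBr (x * y)) (mulrBr a) -!mulrA yz yz'.
Qed.

(** Between an average of x and one of y, the length of the average of the
    commutator z can be changed almost for free within a wide range. *)
Lemma adjust A (x y z : endo V) a b l0 l1 H u d : heisenberg N x y z ->
  contr N A -> (0 < H)%N -> (2 * H <= a)%N -> (2 * H <= b)%N ->
  (H <= l0)%N -> (H <= l1)%N ->
  (l0 + 2 * H <= a + b)%N -> (l1 + 2 * H <= a + b)%N ->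
  (forall t, (t <= a + b)%N -> N ((1 - z ^+ (2 ^ t)) u) <= d) ->
  N ((A * (dyavg x 0 a * dyavg z 0 l0 * dyavg y 0 b)) u -
     (A * (dyavg x 0 a * dyavg z 0 l1 * dyavg y 0 b)) u) <=
  (a + b)%:R * H.+1%:R * kappa ^+ H * d.
Proof.
move=> hxyz Ac H0 Ha Hb Hl0 Hl1 h0 h1 hd.
wlog ll : l0 l1 Hl0 Hl1 h0 h1 / (l0 <= l1)%N.
  move=> hw; have [|/ltnW] := leqP l0 l1; first exact: hw.
  by rewrite snC //; exact: hw.
have c l : GRing.comm (dyavg y 0 b) (dyavg z 0 l).
  by apply/comm_dyavg2/commr_sym; case: hxyz.
rewrite -endoBE word_rearrange // endoME; apply: le_trans (Ac _) _.
by apply: adjust_le => //; rewrite Hl0.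
Qed.

End Moves.

(** * Words in the six root subgroups of SL_3 *)

Section Hexagon.
Local Open Scope ring_scope.
Variables (R : realType) (V : lmodType R) (N : V -> R).
Hypothesis snN : seminorm N.

(** The unipotents x1, ..., x6 stand for the root subgroups 12, 13, 23, 21,
    31, 32 of SL_3 in cyclic order: neighbours commute, and two roots at
    distance two have the root between them as commutator. *)
Record hexagon (x1 x2 x3 x4 x5 x6 : endo V) : Prop := Hexagon {
  hex1 : heisenberg N x6 x2 x1; hex2 : heisenberg N x1 x3 x2;
  hex3 : heisenberg N x2 x4 x3; hex4 : heisenberg N x3 x5 x4;
  hex5 : heisenberg N x4 x6 x5; hex6 : heisenberg N x5 x1 x6 }.

Lemma hexagon_flip x1 x2 x3 x4 x5 x6 :
  hexagon x1 x2 x3 x4 x5 x6 -> hexagon x3 x2 x1 x6 x5 x4.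
Proof. by case=> *; split; exact: heisenberg_sym. Qed.

Definition disp (v : V) (m : nat) (D : R) (x : endo V) :=
  forall s, (s <= m)%N -> N ((x ^+ s) v - v) <= D.

Lemma isometric_disp_mul (x y : endo V) v : isometric N x ->
  N ((x * y) v - v) <= N (x v - v) + N (y v - v).
Proof.
move=> ix; apply: le_trans (sn_tri snN (x v) _ _) _.
by rewrite endoME -endoB ix addrC.
Qed.

Lemma disp_exp (x : endo V) v s d : isometric N x -> N (x v - v) <= d ->
  N ((x ^+ s) v - v) <= s%:R * d.
Proof.
move=> ix hd; elim: s => [|s IHs].
  by rewrite expr0 endo1E subrr sn0 // mul0r.
rewrite exprS (_ : s.+1%:R * d = d + s%:R * d); last by rewrite -natr1; ring.
by apply: le_trans (isometric_disp_mul _ _ ix) _; exact: lerD.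
Qed.

Lemma disp_commutator (x y z : endo V) v m D : heisenberg N x y z ->
  disp v m D x -> disp v m D y ->
  forall q r, (q <= m)%N -> (r <= m)%N -> N ((z ^+ (q * r)) v - v) <= 4 * D.
Proof.
move=> h; wlog xy : x y h / x * y = z * y * x.
  move=> hw dx dy; have [_ _ _ zx zy [zV [_ zVz zzV [xy|xy]]]] := h;
    first exact: (hw x y).
  apply: (hw y x) => //; first exact: heisenberg_sym.
  by rewrite -mulrA xy !mulrA zzV mul1r.
move=> dx dy q r qm rm; have [ix iy iz zx zy _] := h.
have e := heis_pow zx zy xy q r.
have h1 : N ((x ^+ q * y ^+ r) v - v) <= 2 * D.
  apply: le_trans (isometric_disp_mul _ _ (isometricX _ ix)) _.
  by have := dx q qm; have := dy r rm; lra.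
have h2 : N ((y ^+ r * x ^+ q) v - v) <= 2 * D.
  apply: le_trans (isometric_disp_mul _ _ (isometricX _ iy)) _.
  by have := dx q qm; have := dy r rm; lra.
have e' : (z ^+ (q * r)) ((y ^+ r * x ^+ q) v) = (x ^+ q * y ^+ r) v.
  by rewrite e -mulrA.
apply: le_trans (sn_tri snN ((x ^+ q * y ^+ r) v) _ _) _.
have : N ((z ^+ (q * r)) v - (x ^+ q * y ^+ r) v) <= 2 * D.
  by rewrite -e' -endoB isometricX // snC.
lra.
Qed.

(** Every power z ^+ (q * r) is the commutator of x ^+ q and y ^+ r, so
    squaring the range of exponents multiplies the displacement by a
    constant. It is thus polynomial in the logarithm of the exponent. *)
Lemma disp_growth x1 x2 x3 x4 x5 x6 v d : hexagon x1 x2 x3 x4 x5 x6 ->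
  N (x1 v - v) <= d -> N (x2 v - v) <= d -> N (x3 v - v) <= d ->
  N (x4 v - v) <= d -> N (x5 v - v) <= d -> N (x6 v - v) <= d ->
  forall j, let D := disp v (2 ^ (2 ^ j)) (2 * 5 ^+ j * d) in
  (D x1 /\ D x2 /\ D x3) /\ (D x4 /\ D x5 /\ D x6).
Proof.
move=> hex d1 d2 d3 d4 d5 d6.
have d0 : 0 <= d by apply: le_trans d1; exact: sn_ge0.
have base x : isometric N x -> N (x v - v) <= d -> disp v 2 (2 * d) x.
  move=> ix hx s s2; apply: le_trans (disp_exp s ix hx) _.
  by rewrite ler_wpM2r // ler_nat.
have step x y z m D : heisenberg N x y z -> (0 < m)%N ->
    disp v m D x -> disp v m D y -> disp v m D z -> disp v (m * m) (5 * D) z.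
  move=> h m0 dx dy dz s sm; rewrite (divn_eq s m) exprD.
  have iz := heis_iz h.
  apply: le_trans (isometric_disp_mul _ _ (isometricX _ iz)) _.
  have hq : (s %/ m <= m)%N by have := leq_div2r m sm; rewrite mulnK.
  have := disp_commutator h dx dy hq (leqnn m).
  have := dz (s %% m)%N (ltnW (ltn_pmod _ m0)); lra.
case: (hex) => h1 h2 h3 h4 h5 h6.
elim=> [|j]; first rewrite expn0 expn1 expr0 mulr1.
  by do !split; apply: base => //;
    [case: h1|case: h2|case: h3|case: h4|case: h5|case: h6].
move=> [[e1 [e2 e3]] [e4 [e5 e6]]].
have m0 : (0 < 2 ^ 2 ^ j)%N by rewrite expn_gt0.
rewrite /= expnS mul2n -addnn expnD exprS.
have -> : 2 * (5 * 5 ^+ j) * d = 5 * (2 * 5 ^+ j * d) by ring.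
by do !split; [exact: step h1 _ _ _ _|exact: step h2 _ _ _ _|exact: step h3 _ _ _ _
  |exact: step h4 _ _ _ _|exact: step h5 _ _ _ _|exact: step h6 _ _ _ _].
Qed.

Variable kappa : R.
Hypothesis kappaP : 3 / 4 <= kappa < 1.
Hypothesis kdecay : decay_rate N kappa.

Section FixedScale.
Variables (v : V) (H : nat) (D : R).
Hypothesis H0 : (0 < H)%N.
Hypothesis D0 : 0 <= D.
Let disps := disp v (2 ^ (40 * H)) D.

(** Here k counts the averages of which B is made. *)
Definition near (k : nat) (B : endo V) := contr N B /\ N (B v - v) <= k%:R * D.

Lemma near_mul k B l C : near k B -> near l C -> near (k + l) (B * C).
Proof.
move=> [cB nB] [cC nC]; split; first exact: contrM.
apply: le_trans (sn_tri snN (B v) _ _) _;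
  rewrite endoME -endoB natrD mulrDl [leRHS]addrC.
by apply: lerD => //; apply: le_trans (cB _) nC.
Qed.

Lemma near1 : near 0 1.
Proof. by split; [exact: contr1 | rewrite endo1E subrr sn0 // mul0r]. Qed.

Lemma near_dyavg (x : endo V) a : isometric N x -> disps x -> (a <= 40 * H)%N ->
  near 1 (dyavg x 0 a).
Proof.
move=> ix dx aH; split; first exact/contr_dyavg/isometric_contr.
rewrite mul1r; apply: dyavg_disp => // s sa; apply: dx.
by apply: leq_trans (ltnW sa) _; rewrite leq_exp2l.
Qed.

Lemma near_disp k B (z : endo V) t : (k <= 6)%N -> near k B -> isometric N z ->
  disps z -> (t <= 40 * H)%N -> N ((1 - z ^+ (2 ^ t)) (B v)) <= 13 * D.
Proof.
move=> k6 [cB nB] iz dz tH; have zc := contrX (2 ^ t) (isometric_contr iz).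
have := contr_sub snN (B v - v) zc.
rewrite endoB; set u := _ (B v); set w := _ v => h.
have hw : N w <= D.
  rewrite /w endoBE endo1E snC //; apply: dz; by rewrite leq_exp2l.
have k6' : k%:R * D <= 6 * D by rewrite ler_wpM2r // ler_nat.
have := snD snN (u - w) w; rewrite subrK; lra.
Qed.

(** The error of a single move at scale H. For fixed D it decays
    exponentially with H, whereas the displacements used for D grow
    polynomially. *)
Definition move_err := 1040 * (H ^ 2)%:R * kappa ^+ H * D.

Let k_gt0 : 0 < kappa. Proof. by case/andP: kappaP; lra. Qed.

Lemma adjust_word A B (x y z : endo V) a b l0 l1 k : heisenberg N x y z ->
  contr N A -> near k B -> (k <= 6)%N -> disps z ->
  (2 * H <= a <= 20 * H)%N -> (2 * H <= b <= 20 * H)%N ->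
  (H <= l0)%N -> (H <= l1)%N ->
  (l0 + 2 * H <= a + b)%N -> (l1 + 2 * H <= a + b)%N ->
  N ((A * (dyavg x 0 a * dyavg z 0 l0 * dyavg y 0 b) * B) v -
     (A * (dyavg x 0 a * dyavg z 0 l1 * dyavg y 0 b) * B) v) <= move_err.
Proof.
move=> h cA nB k6 dz /andP[a1 a2] /andP[b1 b2] hl0 hl1 s0 s1.
have iz := heis_iz h.
rewrite endoME (endoME _ B).
apply: le_trans (@adjust _ _ _ snN _ kappaP kdecay A x y z a b l0 l1 H (B v) (13 * D)
  h cA H0 a1 b1 hl0 hl1 s0 s1 _) _.
  by move=> t tab; apply: near_disp k6 nB iz dz _; lia.
have p : 0 <= kappa ^+ H * (13 * D) by rewrite !mulr_ge0 // exprn_ge0 // ltW.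
have hn : ((a + b) * H.+1 <= 80 * H ^ 2)%N by rewrite -mulnn; nia.
have hr : (a + b)%:R * H.+1%:R <= 80 * (H ^ 2)%:R :> R by rewrite -!natrM ler_nat.
have := ler_wpM2r p hr; rewrite /move_err; lra.
Qed.

Lemma swap_word A B (x y z : endo V) a b c k : heisenberg N x y z ->
  contr N A -> near k B -> (k <= 6)%N -> disps z ->
  (a <= 8 * H)%N -> (b <= 8 * H)%N -> (a + b + H <= c <= 40 * H)%N ->
  N ((A * (dyavg x 0 a * dyavg z 0 c * dyavg y 0 b) * B) v -
     (A * (dyavg y 0 b * dyavg z 0 c * dyavg x 0 a) * B) v) <= move_err.
Proof.
move=> h cA nB k6 dz a1 b1 /andP[c1 c2].
have iz := heis_iz h.
rewrite endoME (endoME _ B).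
have abc : (a + b <= c)%N by lia.
apply: le_trans (swap snN h cA abc (near_disp k6 nB iz dz c2)) _.
have hk : 2^-1 ^+ (c - (a + b)) <= kappa ^+ H.
  apply: (@le_trans _ _ (2^-1 ^+ H)).
    by apply: ler_wiXn2l; [rewrite invr_ge0 | lra | lia].
  by case/andP: kappaP => k1 k2; apply: lerXn2r; rewrite ?nnegrE; lra.
have hn : (a * b)%:R <= 64 * (H ^ 2)%:R :> R.
  by rewrite -natrM ler_nat -mulnn; nia.
have p0 : 0 <= kappa ^+ H by rewrite exprn_ge0 // ltW.
have q0 : 0 <= 2^-1 ^+ (c - (a + b)) :> R by rewrite exprn_ge0 // invr_ge0.
have e1 : (a * b)%:R * 2^-1 ^+ (c - (a + b)) <= 64 * (H ^ 2)%:R * kappa ^+ H.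
  by apply: ler_pM.
have D13 : 0 <= 13 * D by rewrite mulr_ge0.
have D1 : 0 <= (H ^ 2)%:R * kappa ^+ H * D by rewrite !mulr_ge0.
have := ler_wpM2r D13 e1; rewrite /move_err; lra.
Qed.

Definition word (x1 x2 x3 x4 x5 x6 : endo V) a1 a2 a3 a4 a5 a6 :=
  dyavg x1 0 a1 * dyavg x2 0 a2 * dyavg x3 0 a3 *
  dyavg x4 0 a4 * dyavg x5 0 a5 * dyavg x6 0 a6.

Section FixedHexagon.
Variables x1 x2 x3 x4 x5 x6 : endo V.
Hypothesis hex : hexagon x1 x2 x3 x4 x5 x6.
Hypothesis disp3 : disps x1 /\ disps x2 /\ disps x3.
Hypothesis disp6 : disps x4 /\ disps x5 /\ disps x6.
Let W := word x1 x2 x3 x4 x5 x6.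

Let i1 : isometric N x1 := heis_iz (hex1 hex).
Let i2 : isometric N x2 := heis_iz (hex2 hex).
Let i3 : isometric N x3 := heis_iz (hex3 hex).
Let i4 : isometric N x4 := heis_iz (hex4 hex).
Let i5 : isometric N x5 := heis_iz (hex5 hex).
Let i6 : isometric N x6 := heis_iz (hex6 hex).
Let cd x a : isometric N x -> contr N (dyavg x 0 a).
Proof. by move=> ix; exact/contr_dyavg/isometric_contr. Qed.
Let n4 a : (a <= 40 * H)%N -> near 1 (dyavg x4 0 a).
Proof. by case: disp6 => h _; exact: near_dyavg. Qed.
Let n5 a : (a <= 40 * H)%N -> near 1 (dyavg x5 0 a).
Proof. by case: disp6 => _ [h _]; exact: near_dyavg. Qed.
Let n6 a : (a <= 40 * H)%N -> near 1 (dyavg x6 0 a).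
Proof. by case: disp6 => _ [_ h]; exact: near_dyavg. Qed.

Lemma word2 a1 a2 a2' a3 a4 a5 a6 :
  (2 * H <= a1 <= 20 * H)%N -> (2 * H <= a3 <= 20 * H)%N ->
  (H <= a2)%N -> (H <= a2')%N ->
  (a2 + 2 * H <= a1 + a3)%N -> (a2' + 2 * H <= a1 + a3)%N ->
  (a4 <= 40 * H)%N -> (a5 <= 40 * H)%N -> (a6 <= 40 * H)%N ->
  N (W a1 a2 a3 a4 a5 a6 v - W a1 a2' a3 a4 a5 a6 v) <= move_err.
Proof.
move=> *; have e b : W a1 b a3 a4 a5 a6 =
    1 * (dyavg x1 0 a1 * dyavg x2 0 b * dyavg x3 0 a3) *
    (dyavg x4 0 a4 * dyavg x5 0 a5 * dyavg x6 0 a6).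
  by rewrite /W /word mul1r !mulrA.
rewrite !e; apply: (@adjust_word _ _ _ _ _ _ _ _ _ (1 + 1 + 1) (hex2 hex)) => //.
- by apply: near_mul; [apply: near_mul; [exact: n4 | exact: n5] | exact: n6].
- by case: disp3 => _ [].
Qed.

Lemma word3 a1 a2 a3 a3' a4 a5 a6 :
  (2 * H <= a2 <= 20 * H)%N -> (2 * H <= a4 <= 20 * H)%N ->
  (H <= a3)%N -> (H <= a3')%N ->
  (a3 + 2 * H <= a2 + a4)%N -> (a3' + 2 * H <= a2 + a4)%N ->
  (a5 <= 40 * H)%N -> (a6 <= 40 * H)%N ->
  N (W a1 a2 a3 a4 a5 a6 v - W a1 a2 a3' a4 a5 a6 v) <= move_err.
Proof.
move=> *; have e b : W a1 a2 b a4 a5 a6 =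
    dyavg x1 0 a1 * (dyavg x2 0 a2 * dyavg x3 0 b * dyavg x4 0 a4) *
    (dyavg x5 0 a5 * dyavg x6 0 a6).
  by rewrite /W /word !mulrA.
rewrite !e; apply: (@adjust_word _ _ _ _ _ _ _ _ _ (1 + 1) (hex3 hex)) => //.
- exact: cd.
- by apply: near_mul; [exact: n5 | exact: n6].
- by case: disp3 => _ [].
Qed.

Lemma word4 a1 a2 a3 a4 a4' a5 a6 :
  (2 * H <= a3 <= 20 * H)%N -> (2 * H <= a5 <= 20 * H)%N ->
  (H <= a4)%N -> (H <= a4')%N ->
  (a4 + 2 * H <= a3 + a5)%N -> (a4' + 2 * H <= a3 + a5)%N ->
  (a6 <= 40 * H)%N ->
  N (W a1 a2 a3 a4 a5 a6 v - W a1 a2 a3 a4' a5 a6 v) <= move_err.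
Proof.
move=> *; have e b : W a1 a2 a3 b a5 a6 =
    (dyavg x1 0 a1 * dyavg x2 0 a2) * (dyavg x3 0 a3 * dyavg x4 0 b * dyavg x5 0 a5) *
    dyavg x6 0 a6.
  by rewrite /W /word !mulrA.
rewrite !e; apply: (@adjust_word _ _ _ _ _ _ _ _ _ 1 (hex4 hex)) => //.
- by apply: contrM; exact: cd.
- exact: n6.
- by case: disp6.
Qed.

Lemma word5 a1 a2 a3 a4 a5 a5' a6 :
  (2 * H <= a4 <= 20 * H)%N -> (2 * H <= a6 <= 20 * H)%N ->
  (H <= a5)%N -> (H <= a5')%N ->
  (a5 + 2 * H <= a4 + a6)%N -> (a5' + 2 * H <= a4 + a6)%N ->
  N (W a1 a2 a3 a4 a5 a6 v - W a1 a2 a3 a4 a5' a6 v) <= move_err.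
Proof.
move=> *; have e b : W a1 a2 a3 a4 b a6 =
    (dyavg x1 0 a1 * dyavg x2 0 a2 * dyavg x3 0 a3) *
    (dyavg x4 0 a4 * dyavg x5 0 b * dyavg x6 0 a6) * 1.
  by rewrite /W /word mulr1 !mulrA.
rewrite !e; apply: (@adjust_word _ _ _ _ _ _ _ _ _ 0 (hex5 hex)) => //.
- by apply: contrM; [apply: contrM|]; exact: cd.
- exact: near1.
- by case: disp6 => _ [].
Qed.

Lemma word_swap a1 a2 a3 a4 a5 a6 :
  (a1 <= 8 * H)%N -> (a3 <= 8 * H)%N -> (a1 + a3 + H <= a2 <= 40 * H)%N ->
  (a4 <= 8 * H)%N -> (a6 <= 8 * H)%N -> (a4 + a6 + H <= a5 <= 40 * H)%N ->
  N (W a1 a2 a3 a4 a5 a6 v - word x3 x2 x1 x6 x5 x4 a3 a2 a1 a6 a5 a4 v) <=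
  2 * move_err.
Proof.
move=> h1 h3 h2 h4 h6 h5.
set B := dyavg x4 0 a4 * dyavg x5 0 a5 * dyavg x6 0 a6.
set A := dyavg x3 0 a3 * dyavg x2 0 a2 * dyavg x1 0 a1.
apply: le_trans (sn_tri snN ((A * B) v) _ _) _.
have -> : 2 * move_err = move_err + move_err by rewrite mulr_natl mulr2n.
have [[_ [d2 _]] [_ [d5 _]]] := (disp3, disp6).
apply: lerD.
  have := @swap_word 1 B x1 x3 x2 a1 a3 a2 (1 + 1 + 1) (hex2 hex) (@contr1 _ _ N)
    _ isT d2 h1 h3 h2.
  rewrite !mul1r /W /word /A /B !mulrA; apply.
  by apply: near_mul; [apply: near_mul; [apply: n4 | apply: n5] | apply: n6]; lia.
have cA : contr N A by apply: contrM; [apply: contrM|]; exact: cd.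
have := @swap_word A 1 x4 x6 x5 a4 a6 a5 0 (hex5 hex) cA near1 isT d5 h4 h6 h5.
by rewrite !mulr1 /word /A /B !mulrA.
Qed.

End FixedHexagon.

Lemma sn_chain u w z p q : N (u - w) <= p -> N (w - z) <= q -> N (u - z) <= p + q.
Proof. by move=> h1 h2; apply: le_trans (sn_tri snN w _ _) _; exact: lerD. Qed.

(** An average can be adjusted only between its two neighbours, so x1 and x6
    stay as they are at first. The others are stretched to 20 * H one after
    the other, then x3 and x4 are shortened to 8 * H so that each half can be
    reversed, and finally x1 and x6, which are now inside, are stretched to 8
    * H. *)
Lemma word_step x1 x2 x3 x4 x5 x6 : hexagon x1 x2 x3 x4 x5 x6 ->
  disps x1 /\ disps x2 /\ disps x3 -> disps x4 /\ disps x5 /\ disps x6 ->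
  N (word x1 x2 x3 x4 x5 x6 (4 * H) (10 * H) (4 * H) (4 * H) (10 * H) (4 * H) v -
     word x3 x2 x1 x6 x5 x4 (8 * H) (20 * H) (8 * H) (8 * H) (20 * H) (8 * H) v)
  <= 11 * move_err.
Proof.
move=> hex d3 d6.
have hexf := hexagon_flip hex.
have df3 : disps x3 /\ disps x2 /\ disps x1 by case: d3 => ? [].
have df6 : disps x6 /\ disps x5 /\ disps x4 by case: d6 => ? [].
have -> : 11 * move_err = move_err + (move_err + (move_err + (move_err + (move_err
  + (move_err + (move_err + (2 * move_err + (move_err + move_err)))))))) by ring.
pose w := word x1 x2 x3 x4 x5 x6; pose w' := word x3 x2 x1 x6 x5 x4.
apply: (@sn_chain _ (w (4 * H) (10 * H) (4 * H) (12 * H) (10 * H) (4 * H) v)).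
  by apply: word4 => //; lia.
apply: (@sn_chain _ (w (4 * H) (10 * H) (20 * H) (12 * H) (10 * H) (4 * H) v)).
  by apply: word3 => //; lia.
apply: (@sn_chain _ (w (4 * H) (20 * H) (20 * H) (12 * H) (10 * H) (4 * H) v)).
  by apply: word2 => //; lia.
apply: (@sn_chain _ (w (4 * H) (20 * H) (20 * H) (20 * H) (10 * H) (4 * H) v)).
  by apply: word4 => //; lia.
apply: (@sn_chain _ (w (4 * H) (20 * H) (20 * H) (20 * H) (20 * H) (4 * H) v)).
  by apply: word5 => //; lia.
apply: (@sn_chain _ (w (4 * H) (20 * H) (8 * H) (20 * H) (20 * H) (4 * H) v)).
  by apply: word3 => //; lia.
apply: (@sn_chain _ (w (4 * H) (20 * H) (8 * H) (8 * H) (20 * H) (4 * H) v)).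
  by apply: word4 => //; lia.
apply: (@sn_chain _ (w' (8 * H) (20 * H) (4 * H) (4 * H) (20 * H) (8 * H) v)).
  by apply: word_swap => //; lia.
apply: (@sn_chain _ (w' (8 * H) (20 * H) (8 * H) (4 * H) (20 * H) (8 * H) v)).
  by apply: word3 => //; lia.
by apply: word4 => //; lia.
Qed.

(** A word that starts with a long average of x1 is almost fixed by x1. *)
Lemma word_near x1 x2 x3 x4 x5 x6 a1 a2 a3 a4 a5 a6 : hexagon x1 x2 x3 x4 x5 x6 ->
  disps x1 /\ disps x2 /\ disps x3 -> disps x4 /\ disps x5 /\ disps x6 ->
  (a1 <= 40 * H)%N -> (a2 <= 40 * H)%N -> (a3 <= 40 * H)%N ->
  (a4 <= 40 * H)%N -> (a5 <= 40 * H)%N -> (a6 <= 40 * H)%N ->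
  near 6 (word x1 x2 x3 x4 x5 x6 a1 a2 a3 a4 a5 a6) /\
  N ((1 - x1) (word x1 x2 x3 x4 x5 x6 a1 a2 a3 a4 a5 a6 v)) <=
    2^-1 ^+ a1 * (13 * D).
Proof.
move=> hex [d1 [d2 d3]] [d4 [d5 d6]] h1 h2 h3 h4 h5 h6.
have [[i1 i2] i3] := (heis_iz (hex1 hex), heis_iz (hex2 hex), heis_iz (hex3 hex)).
have [[i4 i5] i6] := (heis_iz (hex4 hex), heis_iz (hex5 hex), heis_iz (hex6 hex)).
set B := dyavg x2 0 a2 * dyavg x3 0 a3 * dyavg x4 0 a4 * dyavg x5 0 a5 * dyavg x6 0 a6.
have nB : near 5 B.
  rewrite /B; change 5%N with (1 + 1 + 1 + 1 + 1)%N.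
  by do !apply: near_mul; exact: near_dyavg.
have -> : word x1 x2 x3 x4 x5 x6 a1 a2 a3 a4 a5 a6 = dyavg x1 0 a1 * B.
  by rewrite /word /B !mulrA.
split; first by change 6%N with (1 + 5)%N; apply: near_mul => //; exact: near_dyavg.
have := @dyavg_sub _ _ x1 0 a1 (leq0n _); rewrite expn0 expr1 subn0 => e.
rewrite -endoME mulrA e -mulrA endoME sn_halfX // endoME.
rewrite ler_wpM2l ?exprn_ge0 ?invr_ge0 //; exact: near_disp nB _ _ _.
Qed.

End FixedScale.
End Hexagon.

(** * Bounded displacement under root subgroups *)

Section HexagonBounded.
Local Open Scope ring_scope.
Variables (R : realType).

Lemma doubly_exponential_sum (kappa : R) : 0 <= kappa < 1 -> exists C : R,
  forall j, \sum_(0 <= i < j) 20 ^+ i * kappa ^+ (2 ^ i) <= C.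
Proof.
move=> kP; have /andP[k0 k1] := kP.
set t := fun i => 20 ^+ i * kappa ^+ (2 ^ i).
have t0 i : 0 <= t i by rewrite mulr_ge0 // exprn_ge0.
have [|n nP] := @geometric_small R kappa 40^-1 kP; first by rewrite invr_gt0.
have tS i : (n <= i)%N -> t i.+1 <= t i / 2.
  move=> ni; have := nP (2 ^ i)%N (leq_trans ni (ltnW (ltn_expl i (ltnSn 1)))).
  have -> : t i.+1 = t i * (20 * kappa ^+ (2 ^ i)).
    by rewrite /t exprS expnS mul2n -addnn exprD; ring.
  by move=> h; apply: ler_wpM2l => //; lra.
set S := fun j => \sum_(0 <= i < j) t i.
have SS j : S j.+1 = S j + t j by rewrite /S big_nat_recr.
have hS m : S (n + m)%N + 2 * t (n + m)%N <= S n + 2 * t n.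
  elim: m => [|m IHm]; first by rewrite addn0.
  by rewrite addnS SS; have := tS (n + m)%N (leq_addr _ _); lra.
exists (S n + 2 * t n) => j; rewrite -/(S j).
have [nj|jn] := leqP n j.
  by have := hS (j - n)%N; rewrite subnKC //; have := t0 j; lra.
have : S j <= S n.
  rewrite /S (@big_cat_nat _ _ _ j 0 n) //=; last exact: ltnW.
  by rewrite lerDl big_nat; apply: sumr_ge0.
by have := t0 n; lra.
Qed.

Variables (V : lmodType R) (N : V -> R).
Hypothesis snN : seminorm N.
Hypothesis uc : unif_convex N.

(** Follow the words of word_step at the scales 2 ^ j. Their values at v move
    by at most 20 ^+ j * kappa ^+ (2 ^ j) * d up to a constant, which is
    summable, so all of them stay within a constant multiple of d from v. For
    a fixed s the isometry x1 ^+ s moves the word of scale 2 ^ j at v by an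
    amount that tends to 0 with j, so it moves v by at most a constant
    multiple of d. *)
Theorem hexagon_bounded : exists2 C : R, 0 <= C &
  forall x1 x2 x3 x4 x5 x6 v d, hexagon N x1 x2 x3 x4 x5 x6 ->
  N (x1 v - v) <= d -> N (x2 v - v) <= d -> N (x3 v - v) <= d ->
  N (x4 v - v) <= d -> N (x5 v - v) <= d -> N (x6 v - v) <= d ->
  forall s, N ((x1 ^+ s) v - v) <= C * d.
Proof.
have [kappa kappaP kd] := decay_rate_exists snN uc.
have /andP[k1 k2] := kappaP; have k0 : 0 <= kappa by lra.
have [|C0 hC0] := @doubly_exponential_sum kappa; first by rewrite k0.
have C00 : 0 <= C0 by have := hC0 0%N; rewrite big_geq.
set c1 := 11 * (1040 * 2 * 5 ^+ 6) : R.
have c10 : 0 <= c1 by rewrite /c1 !mulr_ge0 // exprn_ge0.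
exists (2 * (c1 * C0 + 12 * 5 ^+ 6) + 1).
  by rewrite addr_ge0 // mulr_ge0 // addr_ge0 ?mulr_ge0 // exprn_ge0.
move=> x1 x2 x3 x4 x5 x6 v d hex d1 d2 d3 d4 d5 d6 s.
have d0 : 0 <= d by apply: le_trans d1; exact: sn_ge0.
have i1 := heis_iz (hex1 hex).
(* The exponent j + 6 comes from 40 * 2 ^ j <= 2 ^ (j + 6): the words of
   scale 2 ^ j involve powers up to 2 ^ (40 * 2 ^ j). *)
pose D j : R := 2 * 5 ^+ (j + 6) * d.
have D0 j : 0 <= D j by rewrite /D !mulr_ge0 // exprn_ge0.
have hD j : let P := disp N v (2 ^ (40 * 2 ^ j)) (D j) in
    (P x1 /\ P x2 /\ P x3) /\ (P x4 /\ P x5 /\ P x6).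
  have := disp_growth snN hex d1 d2 d3 d4 d5 d6 (j + 6).
  have mono x : disp N v (2 ^ 2 ^ (j + 6)) (2 * 5 ^+ (j + 6) * d) x ->
      disp N v (2 ^ (40 * 2 ^ j)) (D j) x.
    move=> h t ht; apply: h; apply: leq_trans ht _.
    by rewrite leq_exp2l // expnD mulnC leq_pmul2l // expn_gt0.
  by move=> /= [[a1 [a2 a3]] [a4 [a5 a6]]]; do !split; exact: mono.
pose W j y1 y2 y3 y4 y5 y6 : endo V := let H := (2 ^ j)%N in
  word y1 y2 y3 y4 y5 y6 (4 * H) (10 * H) (4 * H) (4 * H) (10 * H) (4 * H).
have H0 j : (0 < 2 ^ j)%N by rewrite expn_gt0.
have step j y1 y2 y3 y4 y5 y6 : hexagon N y1 y2 y3 y4 y5 y6 ->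
   (let P := disp N v (2 ^ (40 * 2 ^ j)) (D j) in
    (P y1 /\ P y2 /\ P y3) /\ (P y4 /\ P y5 /\ P y6)) ->
   N (W j y1 y2 y3 y4 y5 y6 v - W j.+1 y3 y2 y1 y6 y5 y4 v) <=
   c1 * d * (20 ^+ j * kappa ^+ (2 ^ j)).
  move=> hy [hP1 hP2].
  have := word_step snN kappaP kd (H0 j) (D0 j) hy hP1 hP2.
  rewrite /W /= expnS.
  rewrite (_ : 4 * (2 * 2 ^ j) = 8 * 2 ^ j)%N; last by rewrite mulnA.
  rewrite (_ : 10 * (2 * 2 ^ j) = 20 * 2 ^ j)%N; last by rewrite mulnA.
  move/le_trans; apply; rewrite /move_err /D /c1 exprD.
  have -> : ((2 ^ j) ^ 2)%:R = 4 ^+ j :> R by rewrite -expnM mulnC expnM natrX.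
  have -> : 20 ^+ j = 4 ^+ j * 5 ^+ j :> R by rewrite -exprMn; congr (_ ^+ _); ring.
  by rewrite le_eqVlt; apply/orP; left; apply/eqP; ring.
(* Two steps at a time, since each step reflects the hexagon. *)
have close i : N (W 0 x1 x2 x3 x4 x5 x6 v - W (2 * i)%N x1 x2 x3 x4 x5 x6 v) <=
    c1 * d * \sum_(0 <= k < 2 * i) 20 ^+ k * kappa ^+ (2 ^ k).
  elim: i => [|i IHi]; first by rewrite muln0 subrr sn0 // big_geq // mulr0.
  rewrite (_ : 2 * i.+1 = (2 * i).+2)%N; last by rewrite mulnS.
  rewrite 2?big_nat_recr //= 2!mulrDr -addrA.
  apply: (sn_chain snN IHi).
  apply: (sn_chain snN (step (2 * i)%N _ _ _ _ _ _ hex (hD _))).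
  apply: step; first exact: hexagon_flip.
  by have [[a1 [a2 a3]] [a4 [a5 a6]]] := hD (2 * i).+1; do !split.
have hn j : near N v (D j) 6 (W j x1 x2 x3 x4 x5 x6) /\
    N ((1 - x1) (W j x1 x2 x3 x4 x5 x6 v)) <= 2^-1 ^+ (4 * 2 ^ j) * (13 * D j).
  have [hP1 hP2] := hD j.
  by apply: (word_near snN (D0 j) hex hP1 hP2); rewrite leq_mul2r orbT.
have Wv i : N (W (2 * i)%N x1 x2 x3 x4 x5 x6 v - v) <= (c1 * C0 + 12 * 5 ^+ 6) * d.
  have [[_ n0] _] := hn 0%N.
  have := sn_tri snN (W 0 x1 x2 x3 x4 x5 x6 v) (W (2 * i)%N x1 x2 x3 x4 x5 x6 v) v.
  have := close i; rewrite (snC snN (W 0%N _ _ _ _ _ _ _) (W _ _ _ _ _ _ _ _));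
    have := ler_wpM2l (mulr_ge0 c10 d0) (hC0 (2 * i)%N).
  move: n0; rewrite /D add0n; lra.
have [||n nP] := @geometric_small R (1 / 4) (s%:R * (26 * 5 ^+ 6 * C0) + 1)^-1.
- by lra.
- by rewrite invr_gt0 ltr_wpDl // !mulr_ge0 // exprn_ge0.
set j := (2 * n)%N.
have hW := Wv n.
set w := W _ _ _ _ _ _ _ v in hW.
have hs : N ((x1 ^+ s) w - w) <= d.
  have h1 : N (x1 w - w) <= 26 * 5 ^+ 6 * C0 * (1 / 4) ^+ j * d.
    have [_] := hn j; rewrite -/w endoBE endo1E snC // => /le_trans; apply.
    have e1 : 2^-1 ^+ (4 * 2 ^ j) <= kappa ^+ (2 ^ j).
      apply: (@le_trans _ _ (2^-1 ^+ (2 ^ j))).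
        by apply: ler_wiXn2l; [rewrite invr_ge0 | lra | rewrite leq_pmull].
      by apply: lerXn2r; rewrite ?nnegrE; lra.
    have e2 : 20 ^+ j * kappa ^+ (2 ^ j) <= C0.
      apply: le_trans (hC0 j.+1); rewrite big_nat_recr //= lerDr.
      by apply: sumr_ge0 => k _; rewrite mulr_ge0 // exprn_ge0.
    have e3 : 5 ^+ j = 20 ^+ j * (1 / 4) ^+ j :> R.
      by rewrite -exprMn; congr (_ ^+ _); lra.
    have q0 : 0 <= (1 / 4) ^+ j :> R by rewrite exprn_ge0; lra.
    have D13 : 0 <= 13 * D j by rewrite mulr_ge0.
    apply: le_trans (ler_wpM2r D13 e1) _; rewrite /D exprD e3.
    have p : 0 <= 26 * 5 ^+ 6 * (1 / 4) ^+ j * d.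
      by rewrite !mulr_ge0 // exprn_ge0.
    have := ler_wpM2l p e2; lra.
  apply: le_trans (disp_exp snN s i1 h1) _.
  have nj : (n <= j)%N by rewrite leq_pmull.
  have P0 : 0 <= s%:R * (26 * 5 ^+ 6 * C0) by rewrite !mulr_ge0 // exprn_ge0.
  have := nP j nj; rewrite -[X in _ <= X]mul1r ler_pdivlMr; last by rewrite ltr_wpDl.
  have q0 : 0 <= (1 / 4) ^+ j :> R by rewrite exprn_ge0; lra.
  set q := (1 / 4) ^+ j in q0 *; set M := 26 * _ * _ => hq.
  have h2 : s%:R * M * q <= 1 by lra.
  by have := ler_wpM2r d0 h2; lra.
have := sn_tri snN ((x1 ^+ s) w) ((x1 ^+ s) v) v.
have := sn_tri snN w ((x1 ^+ s) w) v.
rewrite -endoB isometricX // (snC snN v w); lra.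
Qed.

End HexagonBounded.

(** * Circumcenters and fixed points *)

Section Circumcenter.
Local Open Scope ring_scope.
Variables (R : realType) (V : lmodType R) (N : V -> R).

Definition cvg_seq (u : nat -> V) (l : V) :=
  forall e : R, 0 < e -> exists n0, forall n, (n0 <= n)%N -> N (u n - l) <= e.

Definition cauchy_seq_norm (u : nat -> V) := forall e : R, 0 < e -> exists n0,
  forall m n, (n0 <= m)%N -> (n0 <= n)%N -> N (u m - u n) <= e.

(** V carries no topology of its own, hence completeness is stated for N. *)
Record uc_banach : Prop := UCBanach {
  ucb_sn : seminorm N;
  ucb_sep : forall v, N v = 0 -> v = 0;
  ucb_uc : unif_convex N;
  ucb_complete : forall u, cauchy_seq_norm u -> exists l, cvg_seq u l }.

Hypothesis ucN : uc_banach.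
Let snN := ucb_sn ucN.

Lemma le_eps (a b : R) : (forall e, 0 < e -> a <= b + e) -> a <= b.
Proof.
move=> h; rewrite leNgt; apply/negP => ba.
by have := h ((a - b) / 2); rewrite divr_gt0 ?subr_gt0 // => /(_ isT); lra.
Qed.

Lemma inv_nat_small (e : R) : 0 < e -> exists n : nat, n.+1%:R^-1 <= e.
Proof.
move=> e0; exists (Num.Def.archi_bound e^-1).
have h : e^-1 < (Num.Def.archi_bound e^-1)%:R.
  by apply: archi_boundP; rewrite invr_ge0 ltW.
rewrite -[leRHS]invrK lef_pV2 ?posrE ?invr_gt0 //.
by apply: le_trans (ltW h) _; rewrite ler_nat.
Qed.

Lemma sn_mid (q y z : V) : q - 2^-1 *: (y + z) = 2^-1 *: ((q - y) + (q - z)).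
Proof.
rewrite addrACA -opprD scalerBr -mulr2n -(scaler_nat 2 q) scalerA mulVf ?scale1r //.
by rewrite pnatr_eq0.
Qed.

(** Otherwise the midpoint of y and z would be a better center. *)
Lemma uc_centers (e rho : R) : 0 < e -> 0 < rho -> exists2 eta : R, 0 < eta &
  forall (Q : V -> Prop) y z,
  (forall q, Q q -> N (q - y) <= rho + eta) ->
  (forall q, Q q -> N (q - z) <= rho + eta) ->
  N (y - z) <= e \/
  exists2 s : R, s < rho & forall q, Q q -> N (q - 2^-1 *: (y + z)) <= s.
Proof.
move=> e0 rho0; have e1 : 0 < e / (rho + 1) by rewrite divr_gt0 // addr_gt0.
have [d /andP[d0 d1] hd] := ucb_uc ucN e1.
exists (Num.min 1 (d * rho / 2)); first by rewrite lt_min ltr01 /= divr_gt0 // mulr_gt0.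
set eta := Num.min _ _; move=> Q y z hy hz.
have eta1 : eta <= 1 by rewrite ge_min lexx.
have eta2 : eta <= d * rho / 2 by rewrite ge_min lexx orbT.
have [|yz] := leP (N (y - z)) e; [by left | right].
exists ((1 - d) * (rho + eta)); first by have := mulr_gt0 d0 rho0; nra.
move=> q Qq; rewrite sn_mid; apply: hd; [exact: hy | exact: hz |].
have -> : q - y - (q - z) = z - y by rewrite opprB addrC addrA subrK.
rewrite snC //; apply: le_trans (ltW yz).
rewrite -mulrA -[leRHS]mulr1 ler_pM2l // ler_pdivrMl ?addr_gt0 // mulr1.
lra.
Qed.

(** Almost optimal centers of Q form a Cauchy sequence by uc_centers, and its
    limit is the only optimal center. The condition on g says that g maps
    optimal centers to optimal centers; it is a form of invariance of Q that
    does not mention the inverse of g. *)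
Lemma circumcenter (Q : V -> Prop) v r : Q v ->
  (forall q, Q q -> N (q - v) <= r) ->
  exists2 x, N (v - x) <= r & forall g : endo V,
    (forall q, Q q -> exists2 q', Q q' & forall z, N (q - g z) = N (q' - z)) ->
    g x = x.
Proof.
move=> Qv hr; pose ub z rho := forall q, Q q -> N (q - z) <= rho.
pose A : classical_sets.set R := fun rho => exists z, ub z rho.
have Ar : A r by exists v.
have A0 rho : A rho -> 0 <= rho.
  by case=> z /(_ v Qv); apply: le_trans; exact: sn_ge0.
have hA : has_inf A by split; [exists r | exists 0 => rho; exact: A0].
set rho0 := inf A.
have rho00 : 0 <= rho0 by apply: lb_le_inf; [exists r | move=> rho; exact: A0].
have rho0r : rho0 <= r by apply: ge_inf => //; case: hA.
have lb z s : ub z s -> rho0 <= s by move=> h; apply: ge_inf; [case: hA | exists z].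
have hz0 (n : nat) : exists y, ub y (rho0 + n.+1%:R^-1).
  have [|rho [y hy] hrho] := @inf_adherent _ A n.+1%:R^-1 _ hA.
    by rewrite invr_gt0.
  by exists y => q /hy h; apply: le_trans h (ltW hrho).
have [z hz] := choice hz0.
have ubM y s t : s <= t -> ub y s -> ub y t.
  by move=> st h q /h hq; exact: le_trans hq st.
have mono n0 n : (n0 <= n)%N -> n.+1%:R^-1 <= n0.+1%:R^-1 :> R.
  by move=> h; rewrite lef_pV2 ?posrE // ler_nat.
have czz : cauchy_seq_norm z.
  move=> e e0; have [rho0z|] := eqVneq rho0 0.
    have [|n0 hn0] := @inv_nat_small (e / 2); first by rewrite divr_gt0.
    exists n0 => m n hm hn.
    have h k : (n0 <= k)%N -> N (v - z k) <= e / 2.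
      move=> hk; apply: le_trans (hz k v Qv) _; rewrite rho0z add0r.
      by apply: le_trans (mono _ _ hk) hn0.
    have := sn_tri snN v (z m) (z n); rewrite (snC snN (z m) v).
    by have := h m hm; have := h n hn; lra.
  move=> rho0n; have rho0p : 0 < rho0 by rewrite lt_def rho0n.
  have [eta eta0 heta] := uc_centers e0 rho0p.
  have [n0 hn0] := inv_nat_small eta0.
  exists n0 => m n hm hn.
  have h k : (n0 <= k)%N -> ub (z k) (rho0 + eta).
    move=> hk; apply: ubM (hz k); rewrite lerD2l.
    by apply: le_trans (mono _ _ hk) hn0.
  have [//|[s srho hs]] := heta Q (z m) (z n) (h m hm) (h n hn).
  by have := lb _ _ hs; lra.
have [x hx] := ucb_complete ucN czz.
have ubx : ub x rho0.
  move=> q Qq; apply: le_eps => e e0.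
  have [|n0 hn0] := hx (e / 2); first by rewrite divr_gt0.
  have [|n1 hn1] := @inv_nat_small (e / 2); first by rewrite divr_gt0.
  have := sn_tri snN (z (maxn n0 n1)) q x.
  have := hn0 _ (leq_maxl n0 n1); have := hz (maxn n0 n1) q Qq.
  have := le_trans (mono _ _ (leq_maxr n0 n1)) hn1.
  by move: (_.+1%:R^-1) => i; lra.
exists x; first exact: le_trans (ubx v Qv) rho0r.
move=> g hg; have ubg : ub (g x) rho0.
  by move=> q /hg[q' /ubx h ->].
have [rho0z|rho0n] := eqVneq rho0 0.
  have h y : ub y rho0 -> v = y.
    move=> /(_ v Qv); rewrite rho0z => h; apply/eqP; rewrite -subr_eq0; apply/eqP.
    by apply: (ucb_sep ucN); apply/eqP; rewrite eq_le h sn_ge0.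
  by rewrite -(h _ ubg) -(h _ ubx).
have rho0p : 0 < rho0 by rewrite lt_def rho0n.
apply/eqP; rewrite -subr_eq0; apply/eqP; apply: (ucb_sep ucN); apply/eqP.
rewrite eq_le (sn_ge0 snN) // andbT; apply: le_eps => e e0; rewrite add0r.
have [eta eta0 heta] := uc_centers e0 rho0p.
have le1 : rho0 <= rho0 + eta by lra.
have [//|[s srho hs]] := heta Q (g x) x (ubM _ _ _ le1 ubg) (ubM _ _ _ le1 ubx).
by have := lb _ _ hs; lra.
Qed.

(** The circumcenter of the orbit of v. *)
Lemma commuting_fixed (a b : int -> endo V) v r :
  (forall t, isometric N (a t)) -> (forall t, isometric N (b t)) ->
  a 0 = 1 -> b 0 = 1 ->
  (forall s t, a (s + t) = a s * a t) -> (forall s t, b (s + t) = b s * b t) ->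
  (forall s t, GRing.comm (a s) (b t)) ->
  (forall s t, N ((a s * b t) v - v) <= r) ->
  exists2 x, N (v - x) <= r & (forall t, a t x = x) /\ (forall t, b t x = x).
Proof.
move=> ia ib a0 b0 aD bD ab hr.
pose Q q := exists s t, q = (a s * b t) v.
have [||x vx hx] := @circumcenter Q v r.
- by exists 0, 0; rewrite a0 b0 mulr1 endo1E.
- by move=> _ [s [t ->]].
have tK (t s : int) : t + (s - t) = s by rewrite addrC subrK.
exists x => //; split=> t; apply: hx => _ [s1 [s2 ->]].
  exists ((a (s1 - t) * b s2) v); first by exists (s1 - t), s2.
  by move=> z; rewrite -(ia t (_ - z)) endoB -endoME mulrA -aD tK.
exists ((a s1 * b (s2 - t)) v); first by exists s1, (s2 - t).
by move=> z; rewrite -(ib t (_ - z)) endoB -endoME mulrA -ab -mulrA -bD tK.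
Qed.

End Circumcenter.

(** * Nearby vectors invariant under SL_3 *)

Section Game.
Local Open Scope ring_scope.
Variables (R : realType) (V : lmodType R) (N : V -> R).
Hypothesis ucN : uc_banach N.
Let snN := ucb_sn ucN.

(** Uniform convexity read backwards: two vectors of norm at most r with a
    midpoint of almost the same norm are close. *)
Definition forces_close (e k : R) := forall r u w, N u <= r -> N w <= r ->
  (1 - k) * r < N (2^-1 *: (u + w)) -> N (u - w) <= e * r.

Lemma forces_closeP e : 0 < e -> exists2 k, 0 < k < 1 & forces_close e k.
Proof.
move=> /(ucb_uc ucN)[k k01 hk]; exists k => // r u w hu hw h.
rewrite leNgt; apply/negP => /ltW/(hk r u w hu hw); lra.
Qed.

Definition one_param (a : int -> endo V) :=
  [/\ forall t, isometric N (a t), a 0 = 1 & forall s t, a (s + t) = a s * a t].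

Definition fixes (a : int -> endo V) x := forall t, a t x = x.
Definition almost_fixes (a : int -> endo V) x (r : R) := forall t, N (a t x - x) <= r.

Variables (km lm mk ml kl lk : int -> endo V) (w wV : endo V).

Let EM x := fixes km x /\ fixes lm x.
Let EL x := fixes mk x /\ fixes ml x.

(** The arguments are the root subgroups of SL_3 and a Weyl element with its
    inverse. Write M for the group generated by km and lm, and L for the one
    generated by mk and ml. Both are normalised by kl and lk, while
    conjugation by w turns km, lm into mk, lk and mk, ml into km, kl. *)
Record sl3_action : Prop := SL3Action {
  act_km : one_param km; act_lm : one_param lm; act_mk : one_param mk;
  act_ml : one_param ml; act_kl : one_param kl; act_lk : one_param lk;
  act_kmlm : forall s t, GRing.comm (km s) (lm t);
  act_mkml : forall s t, GRing.comm (mk s) (ml t);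
  act_mklk : forall s t, GRing.comm (mk s) (lk t);
  act_kmkl : forall s t, GRing.comm (km s) (kl t);
  act_ckl : forall t, km t * ml 1 = kl t * ml 1 * km t;
  act_clk : forall t, lm t * mk 1 = lk t * mk 1 * lm t;
  act_cmk : forall t, ml t * lk 1 = mk t * lk 1 * ml t;
  act_klM : forall t x, EM x -> EM (kl t x);
  act_klL : forall t x, EL x -> EL (kl t x);
  act_lkM : forall t x, EM x -> EM (lk t x);
  act_lkL : forall t x, EL x -> EL (lk t x);
  act_w : w = km 1 * mk (-1) * km 1;
  act_wV : wV * w = 1 /\ w * wV = 1;
  act_wkm : forall t, exists t', w * km t = mk t' * w;
  act_wlm : forall t, exists t', w * lm t = lk t' * w;
  act_wmk : forall t, exists t', w * mk t = km t' * w;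
  act_wml : forall t, exists t', w * ml t = kl t' * w }.

Hypothesis act : sl3_action.

(** Only the generators of M and L occur, since they generate SL_3. *)
Definition bd v r := [/\ almost_fixes km v r, almost_fixes lm v r,
  almost_fixes mk v r & almost_fixes ml v r].

Lemma comm_rel_disp (x y z : endo V) u p q : isometric N x -> isometric N y ->
  isometric N z -> x * y = z * y * x -> N (x u - u) <= p -> N (y u - u) <= q ->
  N (z u - u) <= 2 * (p + q).
Proof.
move=> ix iy iz xy hp hq.
have h1 : N ((x * y) u - u) <= p + q.
  by apply: le_trans (isometric_disp_mul snN _ _ ix) _; exact: lerD.
have h2 : N ((y * x) u - u) <= p + q.
  by rewrite [p + q]addrC; apply: le_trans (isometric_disp_mul snN _ _ iy) _;
    exact: lerD.
have h3 : N (z u - (x * y) u) <= p + q.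
  by rewrite xy -mulrA endoME -endoB iz snC.
by apply: le_trans (sn_tri snN ((x * y) u) _ _) _; lra.
Qed.

Lemma fix_disp (a : endo V) x y : isometric N a -> a x = x ->
  N (a y - y) <= 2 * N (x - y).
Proof.
move=> ia ax; have -> : a y - y = (x - y) - a (x - y).
  by rewrite endoB ax opprB [RHS]addrC addrA subrK.
by apply: le_trans (snB snN _ _) _; rewrite ia; lra.
Qed.

Let ikm t : isometric N (km t). Proof. by case: (act_km act). Qed.
Let ilm t : isometric N (lm t). Proof. by case: (act_lm act). Qed.
Let imk t : isometric N (mk t). Proof. by case: (act_mk act). Qed.
Let iml t : isometric N (ml t). Proof. by case: (act_ml act). Qed.
Let ikl t : isometric N (kl t). Proof. by case: (act_kl act). Qed.
Let ilk t : isometric N (lk t). Proof. by case: (act_lk act). Qed.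

(** The vector x is fixed by M and close to the vector y fixed by L; the
    subgroups kl and lk are commutators of M and L. *)
Lemma pair_x_disp x y : EM x -> EL y ->
  [/\ almost_fixes mk x (2 * N (x - y)), almost_fixes ml x (2 * N (x - y)),
      almost_fixes kl x (4 * N (x - y)) & almost_fixes lk x (4 * N (x - y))].
Proof.
move=> [xkm xlm] [ymk yml].
have h1 : almost_fixes mk x (2 * N (x - y)).
  by move=> t; rewrite (snC snN x); exact: fix_disp.
have h2 : almost_fixes ml x (2 * N (x - y)).
  by move=> t; rewrite (snC snN x); exact: fix_disp.
have z0 a : a x = x -> N (a x - x) <= 0 by move=> ->; rewrite subrr sn0.
split=> // t.
  have := comm_rel_disp (ikm t) (iml 1) (ikl t) (act_ckl act t) (z0 _ (xkm t))
    (h2 1); lra.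
have := comm_rel_disp (ilm t) (imk 1) (ilk t) (act_clk act t) (z0 _ (xlm t))
  (h1 1); lra.
Qed.

Lemma pair_y_disp x y : EM x -> EL y ->
  [/\ almost_fixes km y (2 * N (x - y)), almost_fixes lm y (2 * N (x - y)),
      almost_fixes kl y (4 * N (x - y)) & almost_fixes lk y (4 * N (x - y))].
Proof.
move=> [xkm xlm] [ymk yml].
have h1 : almost_fixes km y (2 * N (x - y)) by move=> t; exact: fix_disp.
have h2 : almost_fixes lm y (2 * N (x - y)) by move=> t; exact: fix_disp.
have z0 a : a y = y -> N (a y - y) <= 0 by move=> ->; rewrite subrr sn0.
split=> // t.
  have := comm_rel_disp (ikm t) (iml 1) (ikl t) (act_ckl act t) (h1 t)
    (z0 _ (yml 1)); lra.
have := comm_rel_disp (ilm t) (imk 1) (ilk t) (act_clk act t) (h2 t)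
  (z0 _ (ymk 1)); lra.
Qed.

Lemma EM_lin a b x y : EM x -> EM y -> EM (a *: x + b *: y).
Proof. by move=> [x1 x2] [y1 y2]; split=> t; rewrite endoD !endoZ ?x1 ?x2 ?y1 ?y2. Qed.

Lemma EL_lin a b x y : EL x -> EL y -> EL (a *: x + b *: y).
Proof. by move=> [x1 x2] [y1 y2]; split=> t; rewrite endoD !endoZ ?x1 ?x2 ?y1 ?y2. Qed.

Lemma EM_sub x y : EM x -> EM y -> EM (x - y).
Proof. by move=> hx hy; rewrite -[x]scale1r -scaleN1r; exact: EM_lin. Qed.

Lemma EL_sub x y : EL x -> EL y -> EL (x - y).
Proof. by move=> hx hy; rewrite -[x]scale1r -scaleN1r; exact: EL_lin. Qed.

Lemma EM_mid x y : EM x -> EM y -> EM (2^-1 *: (x + y)).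
Proof. by move=> hx hy; rewrite scalerDr; exact: EM_lin. Qed.

Lemma EL_mid x y : EL x -> EL y -> EL (2^-1 *: (x + y)).
Proof. by move=> hx hy; rewrite scalerDr; exact: EL_lin. Qed.

Lemma mid_dist x y v d rho : N (x - v) <= rho -> N (y - x) <= 2 * d ->
  N (2^-1 *: (x + y) - v) <= rho + d.
Proof.
move=> h1 h2; apply: le_trans (sn_tri snN x _ _) _; rewrite [rho + d]addrC;
  apply: lerD => //.
rewrite snC // sn_mid subrr add0r (sn_half snN) snC //; lra.
Qed.

Section NearMinimalPair.
Variables (v x y : V) (rho eta : R).
Hypotheses (xM : EM x) (yL : EL y) (xv : N (x - v) <= rho) (yv : N (y - v) <= rho).
Hypotheses (d1 : 4^-1 <= N (x - y)) (d4 : N (x - y) <= 4).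
Hypothesis minxy : forall x' y', EM x' -> EL y' -> N (x' - v) <= rho + 40 ->
  N (y' - v) <= rho + 40 -> N (x - y) - eta < N (x' - y').

(** The midpoints of the two pairs form again a pair in EM and EL, so the
    midpoint of the two differences is almost as long as the shortest
    difference. Uniform convexity makes these differences close. *)
Lemma parallel_pair x' y' e k s : forces_close e k -> EM x' -> EL y' ->
  N (x' - x) <= 80 -> N (y' - y) <= 80 -> 0 <= s -> N (x' - y') <= N (x - y) + s ->
  eta + s <= k / 4 -> 0 <= k <= 1 ->
  N ((x - y) - (x' - y')) <= e * (N (x - y) + s).
Proof.
move=> hf x'M y'L hx hy s0 hs hk /andP[k0 k1].
apply: hf => //; first by rewrite lerDl.
have -> : 2^-1 *: (x - y + (x' - y')) = 2^-1 *: (x + x') - 2^-1 *: (y + y').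
  by rewrite -scalerBr opprD addrACA.
have := @minxy (2^-1 *: (x + x')) (2^-1 *: (y + y')) (EM_mid xM x'M) (EL_mid yL y'L).
rewrite !mid_dist //; try lra.
move=> /(_ isT isT) h; apply: le_lt_trans h.
have := ler_wpM2l k0 d1; have := mulr_ge0 k0 s0; lra.
Qed.

(** The isometry g t maps the pair to another one with the same distance, so
    by parallel_pair it moves x and y by almost the same vector p. As p is
    close to an L-invariant vector and is M-invariant, it is almost fixed by
    g; hence g (n t) moves x by almost n * p for every n, and boundedness of
    this displacement forces p to be small. *)
Lemma norm_step (g : int -> endo V) (e k : R) (n : nat) :
  one_param g -> almost_fixes g x (4 * N (x - y)) -> almost_fixes g y (4 * N (x - y)) ->
  (forall t u, EM u -> EM (g t u)) -> (forall t u, EL u -> EL (g t u)) ->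
  (forall s u r, EM u -> almost_fixes mk u r -> almost_fixes ml u r ->
    N (g s u - u) <= 2 * r) ->
  0 < e -> forces_close (e / 4) k -> 0 <= k <= 1 -> eta <= k / 4 -> 16 <= n%:R * e ->
  almost_fixes g x (5 * e) /\ almost_fixes g y (6 * e).
Proof.
move=> [ig g0 gD] gx gy gM gL gd e0 hf k01 hk hn.
have n0 : 0 < n%:R :> R.
  by rewrite ltr0n; case: (n) hn => //; rewrite mul0r; lra.
suff h t : N (g t x - x) <= 5 * e /\ N (g t y - y) <= 6 * e.
  by split=> t; case: (h t).
have close : N ((x - y) - (g t x - g t y)) <= e.
  have := @parallel_pair (g t x) (g t y) (e / 4) k 0 hf (gM t x xM) (gL t y yL).
  rewrite -endoB ig !addr0 => h.
  have d16 : 4 * N (x - y) <= 80.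
    by have := d4; lra.
  have h1 : N (g t x - x) <= 80 := le_trans (gx t) d16.
  have h2 : N (g t y - y) <= 80 := le_trans (gy t) d16.
  apply: le_trans (h h1 h2 (lexx _) (lexx _) hk k01) _.
  by have := ler_wpM2l (ltW e0) d4; lra.
set p := g t x - x; set q := g t y - y.
have pM : EM p by apply: EM_sub => //; exact: gM.
have qL : EL q by apply: EL_sub => //; exact: gL.
have pq : N (p - q) <= e.
  have -> : p - q = (g t x - g t y) - (x - y).
    by rewrite /p /q !opprD !opprK addrACA.
  by rewrite snC.
have ap a : (forall t, isometric N (a t)) -> fixes a q -> almost_fixes a p (2 * e).
  move=> ia aq s; apply: le_trans (fix_disp p (ia s) (aq s)) _.
  by rewrite snC //; lra.
have gp s : N (g s p - p) <= 4 * e.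
  have := gd s p (2 * e) pM (ap _ imk qL.1) (ap _ iml qL.2); lra.
(* g is almost a translation by p along the orbit of x. *)
have sum m : N (g (m%:R * t) x - x - p *+ m) <= m%:R * (4 * e).
  elim: m => [|m IHm]; first by rewrite mul0r g0 mulr0n subr0 subrr sn0 // mul0r.
  have -> : g (m.+1%:R * t) x - x - p *+ m.+1 =
      (g (m%:R * t) p - p) + (g (m%:R * t) x - x - p *+ m).
    rewrite -[in LHS]natr1 mulrDl mul1r gD endoME mulrS opprD.
    rewrite (_ : g _ p = g (m%:R * t) (g t x) - g (m%:R * t) x); last exact: endoB.
    by rewrite [RHS]addrACA; congr (_ + _); rewrite addrA subrK.
  apply: le_trans (snD snN _ _) _; rewrite -natr1 mulrDl mul1r [leRHS]addrC.
  exact: lerD.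
have hp : N p <= 5 * e.
  have := sum n; have := gx (n%:R * t).
  have -> : p *+ n = n%:R *: p by rewrite scaler_nat.
  have h1 := snB snN (g (n%:R * t) x - x) (g (n%:R * t) x - x - n%:R *: p).
  have e2 : g (n%:R * t) x - x - (g (n%:R * t) x - x - n%:R *: p) = n%:R *: p.
    by rewrite opprB addrC subrK.
  have nN : N (n%:R *: p) = n%:R * N p by rewrite (snZ snN) ger0_norm // ltW.
  rewrite e2 nN in h1.
  move=> h2 h3; have h4 := d4.
  have : n%:R * N p <= n%:R * (5 * e) by lra.
  by rewrite ler_pM2l.
split => //; have := sn_tri snN p q 0; rewrite !subr0 (snC snN q); lra.
Qed.

(** By the previous step x and y can be corrected to vectors fixed by km, kl
    and by mk, lk respectively. The inverse of the Weyl element maps these to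
    a pair in EL and EM, with the roles exchanged, whose distance is again
    almost minimal. By parallel_pair the difference of x and the image a of
    the corrected y is close to an L-invariant vector, and a itself is almost
    fixed by ml because y is almost fixed by kl. *)
Lemma weyl_step (e e2 k : R) :
  0 <= e <= 11^-1 -> 0 <= e2 -> forces_close e2 k -> 0 <= k <= 1 ->
    eta + 11 * e <= k / 4 ->
  almost_fixes kl x (5 * e) -> almost_fixes lk x (5 * e) ->
  almost_fixes kl y (6 * e) -> almost_fixes lk y (6 * e) ->
  almost_fixes ml x (10 * e2 + 18 * e) /\ almost_fixes mk x (20 * e2 + 46 * e).
Proof.
move=> /andP[e0 e1] e20 hf k01 hk xkl xlk ykl ylk.
have [wVw wwV] := act_wV act.
have iw : isometric N w by rewrite (act_w act); do !apply: isometricM.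
have iwV : isometric N wV by move=> u; rewrite -(iw (wV u)) -endoME wwV.
have wVK u : w (wV u) = u by rewrite -endoME wwV.
have wKV u : wV (w u) = u by rewrite -endoME wVw.
have dd := d4; have [[xkm xlm] [ymk yml]] := (xM, yL).
have [k1p [k2p [k3p [k4p [k5p k6p]]]]] :
  one_param km /\ one_param lm /\ one_param mk /\ one_param ml /\ one_param kl /\
    one_param lk.
  by case: act.
have [y' yy' [y'mk y'lk]]
  : exists2 y', N (y - y') <= 6 * e & fixes mk y' /\ fixes lk y'.
  case: k3p => _ a0 aD; case: k6p => _ b0 bD.
  apply: (commuting_fixed ucN imk ilk a0 b0 aD bD (act_mklk act)) => s t.
  apply: le_trans (isometric_disp_mul snN _ _ (imk s)) _.
  by rewrite ymk subrr sn0 // add0r.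
have [x' xx' [x'km x'kl]]
  : exists2 x', N (x - x') <= 5 * e & fixes km x' /\ fixes kl x'.
  case: k1p => _ a0 aD; case: k5p => _ b0 bD.
  apply: (commuting_fixed ucN ikm ikl a0 b0 aD bD (act_kmkl act)) => s t.
  apply: le_trans (isometric_disp_mul snN _ _ (ikm s)) _.
  by rewrite xkm subrr sn0 // add0r.
have conj a b u : w * a = b * w -> b u = u -> a (wV u) = wV u.
  move=> wab bu; rewrite -[LHS]wKV -endoME -(endoME (wV * w)) -mulrA wab.
  by rewrite !endoME wVK bu.
have aM : EM (wV y').
  split=> t; first by have [t' h] := act_wkm act t; exact: conj h (y'mk t').
  by have [t' h] := act_wlm act t; exact: conj h (y'lk t').
have bL : EL (wV x').
  split=> t; first by have [t' h] := act_wmk act t; exact: conj h (x'km t').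
  by have [t' h] := act_wml act t; exact: conj h (x'kl t').
set a := wV y' in aM *; set b := wV x' in bL *.
have [xmk _ _ _] := pair_x_disp xM yL; have [ykm _ _ _] := pair_y_disp xM yL.
have z0 (g : endo V) u : g u = u -> N (g u - u) <= 0 by move=> ->; rewrite subrr sn0.
have wd u r1 r2 : N (km 1 u - u) <= r1 -> N (mk (-1) u - u) <= r2 ->
  N (w u - u) <= 2 * r1 + r2.
  move=> h1 h2; rewrite (act_w act).
  apply: le_trans (isometric_disp_mul snN _ _ (isometricM (ikm 1) (imk (-1)))) _.
  have := isometric_disp_mul snN (mk (-1)) u (ikm 1); lra.
have wx : N (w x - x) <= 8 by have := wd x _ _ (z0 _ _ (xkm 1)) (xmk (-1)); lra.
have wy : N (w y - y) <= 16 by have := wd y _ _ (ykm 1) (z0 _ _ (ymk (-1))); lra.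
have ax : N (a - x) <= 80.
  have := sn_tri snN (wV y) a x; have := sn_tri snN y (wV y) x.
  rewrite (snC snN y x) /a -endoB iwV -(iw (wV y - y)) endoB wVK (snC snN y (w y)).
  rewrite (snC snN y' y); lra.
have byy : N (b - y) <= 80.
  have := sn_tri snN (wV x) b y; have := sn_tri snN x (wV x) y.
  rewrite /b -endoB iwV -(iw (wV x - x)) endoB wVK (snC snN x (w x)).
  rewrite (snC snN x' x); lra.
have ab : N (a - b) <= N (x - y) + 11 * e.
  rewrite /a /b -endoB iwV.
  have := sn_tri snN y y' x'; have := sn_tri snN x y x'.
  by rewrite (snC snN y' y) (snC snN y x); lra.
have e11 : 0 <= 11 * e by rewrite mulr_ge0.
have par := parallel_pair hf aM bL ax byy e11 ab hk k01.
set p := x - a; set q := y - b.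
have qL : EL q by exact: EL_sub.
have pq : N (q - p) <= 5 * e2.
  have -> : q - p = - (x - y - (a - b)).
    by rewrite /p /q !opprD !opprK addrACA (addrC y) (addrC (- b)).
  rewrite snopp //; apply: le_trans par _.
  have h : N (x - y) + 11 * e <= 5 by lra.
  by have := ler_wpM2l e20 h; lra.
have xE : x = p + a by rewrite /p subrK.
have pl (l : int -> endo V) t : (forall t, isometric N (l t)) -> fixes l q ->
    N (l t p - p) <= 10 * e2.
  by move=> il lq; apply: le_trans (fix_disp p (il t) (lq t)) _; lra.
have xml : almost_fixes ml x (10 * e2 + 18 * e).
  move=> t; have := pl ml t iml qL.2.
  have ha : N (ml t a - a) <= 18 * e.
    have [t' h] := act_wml act t.
    have -> : ml t a = wV (kl t' y').
      by rewrite /a -[LHS]wKV -endoME -(endoME (wV * w)) -mulrA h !endoME wVK.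
    rewrite /a -endoB iwV.
    have := sn_tri snN y (kl t' y') y'; have := sn_tri snN (kl t' y) (kl t' y') y.
    by rewrite -endoB ikl (snC snN y' y); have := ykl t'; lra.
  have -> : ml t x - x = (ml t p - p) + (ml t a - a).
    by rewrite {1 2}xE endoD opprD addrACA.
  by move=> hp; apply: le_trans (snD snN _ _) _; lra.
split=> // t.
have := comm_rel_disp (iml t) (ilk 1) (imk t) (act_cmk act t) (xml t) (xlk 1); lra.
Qed.

End NearMinimalPair.

(** Start with a fixed point of M and one of L near v and replace the pair by
    a closer one, by at least eta, as long as possible. The first vector of a
    pair at distance less than 1/4 would satisfy bd with 1/2, so this stops
    after at most K steps, and the pair has moved at most 40 at each of them. *)
Lemma near_minimal v (eta : R) (K : nat) : 0 < eta -> 4 <= K%:R * eta -> bd v 1 ->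
  (forall u, N (v - u) <= 2 + 40 * K%:R -> ~ bd u 2^-1) ->
  exists x y rho, [/\ EM x /\ EL y, N (x - v) <= rho /\ N (y - v) <= rho,
    rho <= 2 + 40 * K%:R, 4^-1 <= N (x - y) <= 4 &
    forall x' y', EM x' -> EL y' -> N (x' - v) <= rho + 40 ->
      N (y' - v) <= rho + 40 -> N (x - y) - eta < N (x' - y')].
Proof.
move=> eta0 hK [vkm vlm vmk vml] nohalf.
have [k1p [k2p [k3p k4p]]]
  : one_param km /\ one_param lm /\ one_param mk /\ one_param ml.
  by case: act.
have low x y : EM x -> EL y -> N (x - v) <= 2 + 40 * K%:R -> 4^-1 <= N (x - y).
  move=> xM yL hx; rewrite leNgt; apply/negP => xy.
  apply: (nohalf x); first by rewrite snC.
  have [xmk xml _ _] := pair_x_disp xM yL; have [xkm xlm] := xM.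
  split=> t; [rewrite xkm|rewrite xlm|have := xmk t|have := xml t].
  - by rewrite subrr sn0 // invr_ge0.
  - by rewrite subrr sn0 // invr_ge0.
  - by move=> h; apply: le_trans h _; lra.
  - by move=> h; apply: le_trans h _; lra.
have [x0 vx0 x0M] : exists2 x, N (v - x) <= 2 & EM x.
  case: k1p => _ a0 aD; case: k2p => _ b0 bD.
  apply: (commuting_fixed ucN ikm ilm a0 b0 aD bD (act_kmlm act)) => s t.
  apply: le_trans (isometric_disp_mul snN _ _ (ikm s)) _.
  by have := vkm s; have := vlm t; lra.
have [y0 vy0 y0L] : exists2 y, N (v - y) <= 2 & EL y.
  case: k3p => _ a0 aD; case: k4p => _ b0 bD.
  apply: (commuting_fixed ucN imk iml a0 b0 aD bD (act_mkml act)) => s t.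
  apply: le_trans (isometric_disp_mul snN _ _ (imk s)) _.
  by have := vmk s; have := vml t; lra.
apply: contrapT => nomin.
suff [x [y [[xM yL] [hx hy] hxy]]] : exists x y, [/\ EM x /\ EL y,
    N (x - v) <= 2 + 40 * K%:R /\ N (y - v) <= 2 + 40 * K%:R &
    N (x - y) <= 4 - K%:R * eta].
  by have := low x y xM yL hx; lra.
suff hk k : (k <= K)%N -> exists x y, [/\ EM x /\ EL y,
    N (x - v) <= 2 + 40 * k%:R /\ N (y - v) <= 2 + 40 * k%:R &
    N (x - y) <= 4 - k%:R * eta] by exact: hk.
elim: k => [|k IHk] kK.
  exists x0, y0; split=> //; first by rewrite (snC snN x0) (snC snN y0) mulr0 addr0.
  by have := sn_tri snN v x0 y0; rewrite (snC snN x0 v); lra.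
have [x [y [[xM yL] [hx hy] hxy]]] := IHk (ltnW kK).
have kK' : k.+1%:R <= K%:R :> R by rewrite ler_nat.
have kS : k.+1%:R = k%:R + 1 :> R by rewrite -natr1.
apply: contrapT => nonext; apply: nomin.
have k0 : 0 <= k%:R * eta by rewrite mulr_ge0 // ltW.
have lo := low x y xM yL.
exists x, y, (2 + 40 * k%:R); split=> //.
- by lra.
- by rewrite lo ?(le_trans hx) //=; lra.
move=> x' y' x'M y'L hx' hy'; rewrite ltNge; apply/negP => h.
by apply: nonext; exists x', y'; split=> //; [split|]; lra.
Qed.

(** If no vector near v had half the displacement, the almost minimal pair of
    near_minimal would exist, and norm_step and weyl_step would show that its
    first member has displacement at most 1/2. *)
Lemma halving (e k1 e2 k2 eta : R) (n K : nat) v :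
  0 < e -> e <= 184^-1 -> forces_close (e / 4) k1 -> 0 <= k1 <= 1 -> eta <= k1 / 4 ->
  16 <= n%:R * e ->
  0 <= e2 -> e2 <= 80^-1 -> forces_close e2 k2 -> 0 <= k2 <= 1 ->
    eta + 11 * e <= k2 / 4 ->
  0 < eta -> 4 <= K%:R * eta -> bd v 1 ->
  exists2 u, N (v - u) <= 2 + 40 * K%:R & bd u 2^-1.
Proof.
move=> e0 e184 hf1 k1P hk1 hn e20 e280 hf2 k2P hk2 eta0 hK vbd.
apply: contrapT => nohalf.
have nohalf' u : N (v - u) <= 2 + 40 * K%:R -> ~ bd u 2^-1.
  by move=> h1 h2; apply: nohalf; exists u.
have [x [y [rho [[xM yL] [xv yv] hrho /andP[d1 d4] minxy]]]] :=
  near_minimal eta0 hK vbd nohalf'.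
have [xmk0 xml0 xkl0 xlk0] := pair_x_disp xM yL.
have [_ _ ykl0 ylk0] := pair_y_disp xM yL.
have [klp lkp] : one_param kl /\ one_param lk by case: act.
have z0 (g : endo V) u : g u = u -> N (g u - u) <= 0 by move=> ->; rewrite subrr sn0.
have gd1 s u r : EM u -> almost_fixes mk u r -> almost_fixes ml u r ->
  N (kl s u - u) <= 2 * r.
  move=> [ukm _] _ uml.
  have := comm_rel_disp (ikm s) (iml 1) (ikl s) (act_ckl act s) (z0 _ _ (ukm s))
    (uml 1); lra.
have gd2 s u r : EM u -> almost_fixes mk u r -> almost_fixes ml u r ->
  N (lk s u - u) <= 2 * r.
  move=> [_ ulm] umk _.
  have := comm_rel_disp (ilm s) (imk 1) (ilk s) (act_clk act s) (z0 _ _ (ulm s))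
    (umk 1); lra.
have [xkl ykl] := norm_step xM yL xv yv d1 d4 minxy klp xkl0 ykl0
  (act_klM act) (act_klL act) gd1 e0 hf1 k1P hk1 hn.
have [xlk ylk] := norm_step xM yL xv yv d1 d4 minxy lkp xlk0 ylk0
  (act_lkM act) (act_lkL act) gd2 e0 hf1 k1P hk1 hn.
have e01 : 0 <= e <= 11^-1 by lra.
have [xml xmk] := weyl_step xM yL xv yv d1 d4 minxy e01 e20 hf2 k2P hk2 xkl xlk ykl ylk.
apply: nohalf; exists x; first by rewrite snC //; lra.
have [xkm xlm] := xM; split=> t.
- by rewrite xkm subrr sn0 // invr_ge0.
- by rewrite xlm subrr sn0 // invr_ge0.
- by have := xmk t; lra.
- by have := xml t; lra.
Qed.

Lemma bd_scale c v r : 0 <= c -> bd v r -> bd (c *: v) (c * r).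
Proof.
move=> c0 [h1 h2 h3 h4]; split=> t; rewrite endoZ -scalerBr (snZ snN) ger0_norm //;
  by rewrite ler_wpM2l.
Qed.

(** The successive vectors form a Cauchy sequence, and the limit is fixed. *)
Lemma iterate_halving C : 0 <= C ->
  (forall v, bd v 1 -> exists2 u, N (v - u) <= C & bd u 2^-1) ->
  forall v r, 0 < r -> bd v r -> exists2 u, N (v - u) <= 2 * C * r & EM u /\ EL u.
Proof.
move=> C0 half1 v r r0 vr.
have half (p : V * R) : exists u, 0 < p.2 -> bd p.1 p.2 ->
    N (p.1 - u) <= C * p.2 /\ bd u (p.2 / 2).
  case: p => u s /=; have [s0|] := ltP 0 s; last by move=> h; exists u; lra.
  have [us|//] := pselect (bd u s); last by move=> h; exists u.
  have := bd_scale (ltW (_ : 0 < s^-1)) us;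
    rewrite invr_gt0 mulVf ?gt_eqF // => /(_ s0).
  move=> /half1[z hz zbd]; exists (s *: z) => _ _; split.
    rewrite (_ : u - s *: z = s *: (s^-1 *: u - z)).
      by rewrite (snZ snN) gtr0_norm // mulrC ler_pM2r.
    by rewrite scalerBr scalerA mulfV ?gt_eqF // scale1r.
  exact: bd_scale (ltW s0) zbd.
have [f hf] := choice half.
pose u := fix u n := if n is k.+1 then f (u k, r / 2 ^+ k) else v.
have rk k : 0 < r / 2 ^+ k :> R by rewrite divr_gt0 // exprn_gt0.
have ubd k : bd (u k) (r / 2 ^+ k).
  elim: k => [|k IHk]; first by rewrite expr0 divr1.
  have [_] := hf (u k, r / 2 ^+ k) (rk k) IHk.
  by rewrite /= exprSr invfM mulrA.
have ud k : N (u k - u k.+1) <= C * (r / 2 ^+ k).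
  by have [] := hf (u k, r / 2 ^+ k) (rk k) (ubd k).
have uj k j : N (u k - u (k + j)%N) <= 2 * C * r * (2 ^- k - 2 ^- (k + j)).
  elim: j => [|j IHj]; first by rewrite addn0 !subrr sn0 // mulr0.
  rewrite addnS; apply: le_trans (sn_tri snN (u (k + j)%N) _ _) _.
  apply: le_trans (lerD IHj (ud _)) _.
  by rewrite exprSr invfM; lra.
have uk k j : (k <= j)%N -> N (u k - u j) <= 2 * C * r * 2 ^- k.
  move=> kj; have := uj k (j - k)%N; rewrite subnKC // => h; apply: le_trans h _.
  apply: ler_wpM2l; first by rewrite !mulr_ge0 // ltW.
  by rewrite gerBl invr_ge0 exprn_ge0.
have small (e : R) : 0 < e -> exists k, 2 ^- k <= e.
  move=> e0; have h2 : 0 <= (2^-1 : R) < 1 by lra.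
  by have [k hk] := geometric_small h2 e0; exists k; rewrite -exprVn; exact: hk.
have cu : cauchy_seq_norm N u.
  move=> e e0; have M0 : 0 < 4 * C * r + 1 by rewrite ltr_wpDl // !mulr_ge0 // ltW.
  have [|k hk] := small (e / (4 * C * r + 1)); first by rewrite divr_gt0.
  exists k => m n km' kn.
  have := sn_tri snN (u k) (u m) (u n); rewrite (snC snN (u m) (u k)).
  have := uk _ _ km'; have := uk _ _ kn.
  move: hk; rewrite ler_pdivlMr // => hk.
  have q0 : 0 <= 2 ^- k :> R by rewrite invr_ge0 exprn_ge0.
  lra.
have [l hl] := ucb_complete ucN cu.
have fixl a : isometric N a -> (forall k, N (a (u k) - u k) <= r / 2 ^+ k) -> a l = l.
  move=> ia ha; apply/eqP; rewrite -subr_eq0; apply/eqP; apply: (ucb_sep ucN);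
    apply/eqP.
  rewrite eq_le (sn_ge0 snN) // andbT; apply: le_eps => e e0; rewrite add0r.
  have [|k hk] := small (e / (2 * r)); first by rewrite divr_gt0 // mulr_gt0.
  have [|n0 hn0] := hl (e / 4); first by rewrite divr_gt0.
  set m := maxn n0 k; have h1 := hn0 m (leq_maxl _ _).
  have h2 : r / 2 ^+ m <= e / 2.
    have h3 : 2 ^- m <= 2 ^- k :> R.
      by rewrite lef_pV2 ?posrE ?exprn_gt0 // ler_eXn2l // ?leq_maxr // ltr1n.
    move: hk; rewrite ler_pdivlMr ?mulr_gt0 // => hk.
    have := ler_wpM2l (ltW r0) h3; lra.
  have := ha m; have := sn_tri snN (a (u m)) (a l) l;
    have := sn_tri snN (u m) (a (u m)) l.
  by rewrite -endoB ia (snC snN l (u m)); lra.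
exists l.
  apply: le_eps => e e0; have [n0 hn0] := hl e e0.
  have := uk 0%N n0 (leq0n _); rewrite expr0 invr1 mulr1 /=.
  have := hn0 n0 (leqnn _); have := sn_tri snN (u n0) v l; lra.
split; split=> t; apply: fixl => // k; have [h1 h2 h3 h4] := ubd k.
- exact: h1.
- exact: h2.
- exact: h3.
- exact: h4.
Qed.

End Game.

Section GameBound.
Local Open Scope ring_scope.
Variables (R : realType) (V : lmodType R) (N : V -> R).
Hypothesis ucN : uc_banach N.

Lemma nat_mul_ge (a b : R) : 0 < a -> exists n : nat, b <= n%:R * a.
Proof.
move=> a0; have [b0|b0] := leP b 0; first by exists 0%N; rewrite mul0r.
exists (Num.Def.archi_bound (b / a)); rewrite -ler_pdivrMr // ltW //.
by apply: archi_boundP; rewrite divr_ge0 // ltW.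
Qed.

Theorem game_bound : exists2 C : R, 0 <= C &
  forall km lm mk ml kl lk w wV, sl3_action N km lm mk ml kl lk w wV ->
  forall v r, 0 <= r -> bd N km lm mk ml v r -> exists2 u, N (v - u) <= C * r &
  (fixes km u /\ fixes lm u) /\ (fixes mk u /\ fixes ml u).
Proof.
have snN := ucb_sn ucN.
have e280 : 0 < (80 : R)^-1 by rewrite invr_gt0.
have [k2 /andP[k20 k21] hf2] := forces_closeP ucN e280.
set e := Num.min (184^-1 : R) (k2 / 88).
have e0 : 0 < e by rewrite lt_min invr_gt0 ltr0n /= divr_gt0.
have e184 : e <= 184^-1 by rewrite ge_min lexx.
have ek2 : e <= k2 / 88 by rewrite ge_min lexx orbT.
have e40 : 0 < e / 4 by rewrite divr_gt0.
have [k1 /andP[k10 k11] hf1] := forces_closeP ucN e40.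
set eta := Num.min (k1 / 4) (k2 / 8).
have eta0 : 0 < eta by rewrite lt_min !divr_gt0.
have etak1 : eta <= k1 / 4 by rewrite ge_min lexx.
have etak2 : eta <= k2 / 8 by rewrite ge_min lexx orbT.
have [n hn] := nat_mul_ge 16 e0; have [K hK] := nat_mul_ge 4 eta0.
have C0 : 0 <= 2 + 40 * K%:R :> R by rewrite addr_ge0 // mulr_ge0.
exists (2 * (2 + 40 * K%:R)); first by rewrite mulr_ge0.
move=> km lm mk ml kl lk w wV act v r r0 vr.
have [r0'|rn0] := eqVneq r 0.
  exists v; first by rewrite subrr sn0 // r0' mulr0.
  have fx a : almost_fixes N a v r -> fixes a v.
    move=> h t; apply/eqP; rewrite -subr_eq0; apply/eqP; apply: (ucb_sep ucN).
    by apply/eqP; rewrite eq_le (sn_ge0 snN) // andbT -r0'; exact: h.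
  by case: vr => h1 h2 h3 h4; do !split; apply: fx.
have rp : 0 < r by rewrite lt_def rn0.
apply: (iterate_halving ucN act C0 _ rp vr) => u ubd.
have k1P : 0 <= k1 <= 1 by rewrite !ltW.
have k2P : 0 <= k2 <= 1 by rewrite !ltW.
apply: (@halving _ _ _ ucN _ _ _ _ _ _ _ _ act e k1 (80^-1) k2 eta n K) => //; lra.
Qed.

End GameBound.

(** * Representations of elementary matrices *)

Section SteinbergRep.
Local Open Scope ring_scope.
Variables (R : realType) (V : lmodType R) (N : V -> R) (I : eqType).

(** The Steinberg relations of the elementary matrices over the integers,
    represented by isometries. The case i = j is left unconstrained except at
    0. *)
Record steinberg_rep (a : I -> I -> int -> endo V) : Prop := SteinbergRep {
  st_iso : forall i j t, isometric N (a i j t);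
  st_0 : forall i j, a i j 0 = 1;
  st_D : forall i j s t, i != j -> a i j (s + t) = a i j s * a i j t;
  st_C : forall i j k l s t, i != j -> k != l -> j != k -> i != l ->
    GRing.comm (a i j s) (a k l t);
  st_R : forall i j k s t, i != j -> j != k -> i != k ->
    a i j s * a j k t = a i k (s * t) * a j k t * a i j s }.

Definition all_distinct (k l m : I) := [&& k != l, l != m & k != m].

Hypothesis ucN : uc_banach N.
Let snN := ucb_sn ucN.

Section Fixed.
Variable a : I -> I -> int -> endo V.
Hypothesis st : steinberg_rep a.

Lemma st_one_param i j : i != j -> one_param N (a i j).
Proof. by move=> ij; split=> [t||s t]; [exact: st_iso|exact: st_0|exact: st_D]. Qed.

Lemma st_exp i j (n : nat) : i != j -> a i j 1 ^+ n = a i j n%:Z.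
Proof.
move=> ij; elim: n => [|n IHn]; first by rewrite expr0 st_0.
by rewrite exprS IHn -st_D // -PoszD add1n.
Qed.

Lemma st_N i j t : i != j -> a i j (- t) * a i j t = 1.
Proof. by move=> ij; rewrite -st_D // addNr st_0. Qed.

Lemma st_heisenberg i j k : i != j -> j != k -> i != k ->
  heisenberg N (a i j 1) (a j k 1) (a i k 1).
Proof.
move=> ij jk ik; have [ji kj ki] : [/\ j != i, k != j & k != i].
  by rewrite !(eq_sym j) !(eq_sym k) ij jk ik.
split; try exact: st_iso; try by apply: st_C.
exists (a i k (-1)); split; first exact: st_iso.
- exact: st_N.
- by rewrite -{2}[1%R : int]opprK -{1}[1]opprK st_N.
by left; rewrite st_R // mulr1.
Qed.

Lemma st_hexagon k l m : all_distinct k l m ->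
  hexagon N (a k l 1) (a k m 1) (a l m 1) (a l k 1) (a m k 1) (a m l 1).
Proof.
case/and3P=> kl lm km; have [lk ml mk] : [/\ l != k, m != l & m != k].
  by rewrite !(eq_sym m) (eq_sym l) kl lm km.
split; try exact: st_heisenberg; apply: heisenberg_sym; exact: st_heisenberg.
Qed.

Lemma st_disp_abs i j v r : i != j -> (forall n : nat, N (a i j n%:Z v - v) <= r) ->
  forall t, N (a i j t v - v) <= r.
Proof.
move=> ij h [n|n]; first exact: h.
rewrite NegzE -[X in _ - X]endo1E -(st_N n.+1%:Z ij) endoME -endoB st_iso //.
by rewrite snC.
Qed.

End Fixed.

Theorem elementary_bounded : exists2 C : R, 0 <= C &
  forall a k l m v d, steinberg_rep a -> all_distinct k l m ->
  (forall i j, i \in [:: k; l; m] -> j \in [:: k; l; m] -> i != j ->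
     N (a i j 1 v - v) <= d) ->
  forall t, N (a k l t v - v) <= C * d.
Proof.
have [C C0 hC] := hexagon_bounded snN (ucb_uc ucN); exists C => // a k l m v d st klm h.
have /and3P[kl lm km] := klm.
have [lk ml mk] : [/\ l != k, m != l & m != k].
  by rewrite !(eq_sym m) (eq_sym l) kl lm km.
apply: st_disp_abs => // n; rewrite -st_exp //.
by apply: (hC _ _ _ _ _ _ _ _ (st_hexagon st klm)); apply: h; rewrite ?inE ?eqxx ?orbT.
Qed.

Section Weyl.
Variable a : I -> I -> int -> endo V.
Hypothesis st : steinberg_rep a.
Variables k l m : I.
Hypothesis klm : all_distinct k l m.

Let kl : k != l. Proof. by case/and3P: klm. Qed.
Let lm : l != m. Proof. by case/and3P: klm. Qed.
Let km : k != m. Proof. by case/and3P: klm. Qed.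
Let lk : l != k. Proof. by rewrite eq_sym. Qed.
Let ml : m != l. Proof. by rewrite eq_sym. Qed.
Let mk : m != k. Proof. by rewrite eq_sym. Qed.

Definition weyl := a k m 1 * a m k (-1) * a k m 1.
Definition weylV := a k m (-1) * a m k 1 * a k m (-1).

Lemma weyl_inv : weylV * weyl = 1 /\ weyl * weylV = 1.
Proof.
have N1 i j : i != j -> a i j 1 * a i j (-1) = 1.
  by move=> ij; rewrite -st_D // addrN st_0.
have N2 i j : i != j -> a i j (-1) * a i j 1 = 1.
  by move=> ij; rewrite -st_D // addNr st_0.
rewrite /weyl /weylV; split; rewrite -!mulrA.
  by rewrite (mulrA (a k m (-1)) (a k m 1)) N2 // mul1r (mulrA (a m k 1))
    N1 // mul1r N2.
by rewrite (mulrA (a k m 1) (a k m (-1))) N1 // mul1r (mulrA (a m k (-1)))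
  N2 // mul1r N1.
Qed.

(** Conjugating a root subgroup by a Weyl element x * y * x amounts to
    pushing it through three unipotents, each of which creates or cancels one
    commutator. *)
Lemma push_through (A : pzRingType) (x y g g' h : A) : x * g = g * x ->
  y * g = g' * g * y -> x * g' = h * g' * x -> h * g' * g = g' ->
  (x * y * x) * g = g' * (x * y * x).
Proof.
move=> xg yg xg' e; rewrite -(mulrA (x * y)) xg (mulrA (x * y)) -(mulrA x) yg.
by rewrite !mulrA xg' -(mulrA (h * g')) xg !mulrA e.
Qed.

Lemma push_through' (A : pzRingType) (x y g g' h : A) : x * g = h * g * x ->
  y * g = g * y -> y * h = g' * h * y -> g' * h * g = h -> x * h = h * x ->
  (x * y * x) * g = h * (x * y * x).
Proof.
move=> xg yg yh e xh; rewrite -(mulrA (x * y)) xg !mulrA -(mulrA x y h) yh.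
rewrite -(mulrA x _ g) -(mulrA _ y g) yg (mulrA _ g y) e.
by rewrite !mulrA xh.
Qed.

Lemma push_commutator (A : pzRingType) (z p p' q q' c c' pi qi : A) :
  z * p = p' * z -> z * q = q' * z -> p * q = c * q * p -> p' * q' = c' * q' * p' ->
  p * pi = 1 -> q * qi = 1 -> z * c = c' * z.
Proof.
move=> zp zq pq pq' ppi qqi.
have e : z * c * (q * p) = c' * z * (q * p).
  rewrite -!mulrA (mulrA c) -pq mulrA zp -mulrA zq mulrA pq' -!mulrA.
  by rewrite -zp (mulrA q') -zq -!mulrA.
have e2 : q * p * pi * qi = 1 by rewrite -(mulrA q) ppi mulr1 qqi.
rewrite !mulrA in e; by rewrite -[LHS]mulr1 -[RHS]mulr1 -e2 !mulrA e.
Qed.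

Let invr i j t : i != j -> a i j t * a i j (- t) = 1.
Proof. by move=> ij; rewrite -st_D // addrN st_0. Qed.

Let R' i j p s t : i != j -> j != p -> i != p ->
  a j p t * a i j s = a i p (- (s * t)) * a i j s * a j p t.
Proof.
move=> ij jp ip; have ji : j != i by rewrite eq_sym.
have pj : p != j by rewrite eq_sym.
rewrite -mulrA (st_R st) // !mulrA -st_D // addNr st_0 // mul1r.
by [].
Qed.

Lemma weyl_kl t : weyl * a k l t = a m l (- t) * weyl.
Proof.
apply: (@push_through _ _ _ _ _ (a k l (- t))).
- exact: (st_C st _ _ km kl mk kl).
- by rewrite (st_R st) // mulN1r.
- by rewrite (st_R st) // mul1r.
rewrite (st_C st (- t) (- t) kl ml lm kl) -mulrA -(st_D st) // addNr (st_0 st).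
by rewrite mulr1.
Qed.

Lemma weyl_ml t : weyl * a m l t = a k l t * weyl.
Proof.
apply: (@push_through' _ _ _ _ (a m l (- t))).
- by rewrite (st_R st) // mul1r.
- exact: (st_C st _ _ mk ml km ml).
- by rewrite (st_R st) // mulN1r.
- rewrite (st_C st (- t) t ml kl lk ml) -mulrA -(st_D st) // addNr (st_0 st).
  by rewrite mulr1.
exact: (st_C st _ _ km kl mk kl).
Qed.

Lemma weyl_lm t : weyl * a l m t = a l k t * weyl.
Proof.
apply: (@push_through _ _ _ _ _ (a l m (- t))).
- exact: (st_C st _ _ km lm ml km).
- by rewrite R' // mulrN1 opprK.
- by rewrite R' // mulr1.
rewrite (st_C st (- t) t lm lk ml lk) -mulrA -(st_D st) // addNr (st_0 st).
by rewrite mulr1.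
Qed.

Lemma weyl_lk t : weyl * a l k t = a l m (- t) * weyl.
Proof.
apply: (@push_through' _ _ _ _ (a l k (- t))).
- by rewrite R' // mulr1.
- exact: (st_C st _ _ mk lk kl mk).
- by rewrite R' // mulrN1 opprK.
- rewrite (st_C st (- t) (- t) lk lm kl lm) -mulrA -(st_D st) // addNr (st_0 st).
  by rewrite mulr1.
exact: (st_C st _ _ km lm ml km).
Qed.

Lemma weyl_km t : weyl * a k m t = a m k (- t) * weyl.
Proof.
apply: (push_commutator (weyl_kl t) (weyl_lm 1) _ _ (invr t kl) (invr 1 lm)).
  by rewrite (st_R st) // mulr1.
by rewrite (st_R st) // mulr1.
Qed.

Lemma weyl_mk t : weyl * a m k t = a k m (- t) * weyl.
Proof.
apply: (push_commutator (weyl_ml t) (weyl_lk 1) _ _ (invr t ml) (invr 1 lk)).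
  by rewrite (st_R st) // mulr1.
by rewrite (st_R st) // mulrN1.
Qed.

Lemma st_sl3_action :
  sl3_action N (a k m) (a l m) (a m k) (a m l) (a k l) (a l k) weyl weylV.
Proof.
split; try exact: st_one_param.
- by move=> s t; exact: (st_C st _ _ km lm ml km).
- by move=> s t; exact: (st_C st _ _ mk ml km ml).
- by move=> s t; exact: (st_C st _ _ mk lk kl mk).
- by move=> s t; exact: (st_C st _ _ km kl mk kl).
- by move=> t; rewrite (st_R st) // mulr1.
- by move=> t; rewrite (st_R st) // mulr1.
- by move=> t; rewrite (st_R st) // mulr1.
- move=> t u [ukm ulm]; split=> s; rewrite -endoME.
    by rewrite (st_C st _ _ km kl mk kl) endoME ukm.
  by rewrite R' // (st_C st _ _ km kl mk kl) -mulrA !endoME ulm ukm.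
- move=> t u [umk uml]; split=> s; rewrite -endoME.
    rewrite (st_R st) // (st_C st _ _ ml kl lk ml) -mulrA.
    by rewrite !endoME umk uml.
  by rewrite (st_C st _ _ ml kl lk ml) endoME uml.
- move=> t u [ukm ulm]; split=> s; rewrite -endoME.
    by rewrite R' // (st_C st _ _ lm lk ml lk) -mulrA !endoME ukm ulm.
  by rewrite (st_C st _ _ lm lk ml lk) endoME ulm.
- move=> t u [umk uml]; split=> s; rewrite -endoME.
    by rewrite (st_C st _ _ mk lk kl mk) endoME umk.
  by rewrite (st_R st) // (st_C st _ _ mk lk kl mk) -mulrA !endoME uml umk.
- by [].
- exact: weyl_inv.
- by move=> t; exists (- t); exact: weyl_km.
- by move=> t; exists t; exact: weyl_lm.
- by move=> t; exists (- t); exact: weyl_mk.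
- by move=> t; exists t; exact: weyl_ml.
Qed.

End Weyl.

Theorem near_invariant : exists2 C : R, 0 <= C &
  forall a k l m v r, steinberg_rep a -> all_distinct k l m -> 0 <= r ->
  (forall t, N (a k m t v - v) <= r) -> (forall t, N (a l m t v - v) <= r) ->
  (forall t, N (a m k t v - v) <= r) -> (forall t, N (a m l t v - v) <= r) ->
  exists2 u, N (v - u) <= C * r &
    forall i j t, i \in [:: k; l; m] -> j \in [:: k; l; m] -> i != j -> a i j t u = u.
Proof.
have [C C0 hC] := game_bound ucN; exists C => // a k l m v r st klm r0 h1 h2 h3 h4.
have [u vu [[ukm ulm] [umk uml]]] :=
  hC _ _ _ _ _ _ _ _ (st_sl3_action st klm) v r r0 (And4 h1 h2 h3 h4).
have /and3P[kl lm km] := klm.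
have [lk ml mk] : [/\ l != k, m != l & m != k].
  by rewrite !(eq_sym m) (eq_sym l) kl lm km.
have comm i j p : i != j -> j != p -> i != p -> (forall t, a i j t u = u) ->
    (forall t, a j p t u = u) -> forall t, a i p t u = u.
  move=> ij jp ip h h' t; have := congr1 (fun f : endo V => f u) (st_R st t 1 ij jp ip).
  by rewrite !endoME mulr1 h h' h.
have kl_u := comm _ _ _ km ml kl ukm uml.
have lk_u := comm _ _ _ lm mk lk ulm umk.
by exists u => // i j t; rewrite !inE => /or3P[]/eqP-> /or3P[]/eqP->; rewrite ?eqxx.
Qed.

End SteinbergRep.

(** * Elementary matrices and block embeddings *)

Section Elementary.
Local Open Scope ring_scope.
Variables (A : comNzRingType) (n : nat).
Implicit Types (i j k l : 'I_n) (s t : A).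

(** For i = j this is the identity, so that elt is defined for all indices
    and always lies in SL. *)
Definition elt_mx i j t : 'M[A]_n := 1%:M + (if i == j then 0 else t) *: delta_mx i j.

Lemma det_elt i j t : \det (elt_mx i j t) == 1.
Proof.
rewrite /elt_mx; have [->|ij] := eqVneq i j; first by rewrite scale0r addr0 det1.
wlog lt_ji : i j ij / (j < i)%N => [hw|].
  move: (ij); rewrite -(inj_eq val_inj) neq_ltn => /orP[lt_ij|]; last exact: hw.
  rewrite -det_tr linearD /= trmx1 linearZ /= trmx_delta.
  by apply: hw; rewrite // eq_sym.
rewrite det_trig; last first.
  apply/is_trig_mxP => p q lt_pq; rewrite !mxE -(inj_eq val_inj) (ltn_eqF lt_pq) add0r.
  case: eqP => [pi|_]; last by rewrite mulr0.
  case: eqP => [qj|_]; last by rewrite mulr0.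
  by move: (ltn_trans lt_pq (etrans (congr1 (fun x : 'I_n => (x < i)%N) qj)
    lt_ji)); rewrite pi ltnn.
apply/eqP/big1 => p _; rewrite !mxE eqxx; have [->|_] := eqVneq p i.
  by rewrite (negPf ij) mulr0 addr0.
by rewrite mulr0 addr0.
Qed.

Definition elt i j t : SL A n := exist _ (elt_mx i j t) (det_elt i j t).

Lemma mulmx_1D (X Y : 'M[A]_n) :
  (1%:M + X) *m (1%:M + Y) = 1%:M + (X + Y + X *m Y).
Proof. by rewrite mulmxDl !mulmxDr !mulmx1 !mul1mx -!addrA [Y + _]addrCA. Qed.

Lemma mul_delta i j k l s t : (s *: delta_mx i j) *m (t *: delta_mx k l) =
  (s * t) *: (delta_mx i l *+ (j == k)) :> 'M[A]_n.
Proof. by rewrite -scalemxAl -scalemxAr scalerA mul_delta_mx_cond. Qed.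

Lemma elt0 i j : elt i j 0 = 1%g.
Proof. by apply: val_inj; rewrite /= /elt_mx if_same scale0r addr0. Qed.

Lemma eltD i j s t : elt i j (s + t) = (elt i j s * elt i j t)%g.
Proof.
apply: val_inj; rewrite /= /elt_mx mulmx_1D mul_delta eq_sym.
case: (j == i); first by rewrite !scale0r mul0r scale0r !addr0.
by rewrite mulr0n scaler0 addr0 scalerDl.
Qed.

Lemma elt_comm i j k l s t : j != k -> i != l ->
  (elt i j s * elt k l t)%g = (elt k l t * elt i j s)%g.
Proof.
move=> jk il; apply: val_inj; rewrite /= /elt_mx !mulmx_1D !mul_delta.
by rewrite (negPf jk) [l == i]eq_sym (negPf il)
  !mulr0n !scaler0 !addr0 [X in _ + X]addrC.
Qed.

Lemma elt_commutator i j k s t : i != j -> j != k -> i != k ->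
  (elt i j s * elt j k t)%g = (elt i k (s * t) * elt j k t * elt i j s)%g.
Proof.
move=> ij jk ik; apply: val_inj; rewrite /= /elt_mx.
rewrite (negPf ij) (negPf jk) (negPf ik) !mulmx_1D.
rewrite mulmxDl mulmxDl !mul_delta eqxx [k == j]eq_sym (negPf jk).
rewrite [k == i]eq_sym (negPf ik) mulr1n !mulr0n !scaler0 !addr0 mul0mx addr0.
by congr (_ + _); rewrite addr0 [LHS]addrC [s *: _ + _]addrC addrA.
Qed.

End Elementary.

Section Embedding.
Local Open Scope ring_scope.
Variables (A : comNzRingType).

(** Both determinants are that of the block matrix with blocks 1, X, - Y, 1,
    factored in two ways. *)
Lemma det_1D_mulmx m n (X : 'M[A]_(m, n)) (Y : 'M[A]_(n, m)) :
  \det (1%:M + X *m Y) = \det (1%:M + Y *m X).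
Proof.
have h1 : block_mx 1%:M X (- Y) 1%:M =
    block_mx 1%:M 0 (- Y) 1%:M *m block_mx 1%:M X 0 (1%:M + Y *m X) :> 'M_(m + n).
  rewrite mulmx_block !mul1mx ?mul0mx ?mulmx0 !addr0 mulmx1 mulNmx.
  by rewrite addrCA addNr addr0.
have h2 : block_mx 1%:M X (- Y) 1%:M =
    block_mx (1%:M + X *m Y) X 0 1%:M *m block_mx 1%:M 0 (- Y) 1%:M :> 'M_(m + n).
  rewrite mulmx_block !mulmx1 ?mul0mx ?mulmx0 !add0r mul1mx mulmxN.
  by rewrite addrK.
have := congr1 determinant h1; rewrite h2 !det_mulmx !det_lblock !det_ublock !det1.
by rewrite !mulr1 !mul1r.
Qed.

Variables (m n : nat) (f : 'I_m -> 'I_n).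
Hypothesis f_inj : injective f.

Let P : 'M[A]_(n, m) := \matrix_(i, a) (i == f a)%:R.

Let PTP : P^T *m P = 1%:M.
Proof.
apply/matrixP => a b; rewrite !mxE (bigD1 (f a)) //= !mxE eqxx mul1r big1.
  by rewrite addr0 (inj_eq f_inj).
by move=> i /negPf ifa; rewrite !mxE ifa mul0r.
Qed.

(** With P the matrix whose columns are the basis vectors selected by f, this
    is 1 + P (M - 1) P^T: the matrix M acting on the coordinates in the range
    of f. It is multiplicative in M since P^T P = 1. *)
Definition emb_mx (M : 'M[A]_m) : 'M[A]_n :=
  1%:M + (\matrix_(i, a) (i == f a)%:R : 'M_(n, m)) *m (M - 1%:M) *m
    (\matrix_(i, a) (i == f a)%:R : 'M_(n, m))^T.

Lemma det_emb (g : SL A m) : \det (emb_mx (val g)) == 1.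
Proof.
rewrite /emb_mx -/P -mulmxA det_1D_mulmx -mulmxA PTP mulmx1 addrC subrK.
exact: (valP g).
Qed.

Definition emb (g : SL A m) : SL A n := exist _ (emb_mx (val g)) (det_emb g).

Lemma embM g h : emb (g * h)%g = (emb g * emb h)%g.
Proof.
apply: val_inj; rewrite /= /emb_mx -/P mulmx_1D; congr (_ + _).
have aux (X Y : 'M[A]_m) : P *m X *m P^T *m (P *m Y *m P^T) = P *m (X *m Y) *m P^T.
  by rewrite !mulmxA -(mulmxA _ P^T) PTP mulmx1.
rewrite aux -!mulmxDl -!mulmxDr; congr (_ *m _ *m _).
rewrite mulmxBr mulmx1 mulmxBl mul1mx.
set a := _ *m _; set x := sval g; set y := sval h.
by rewrite [x - _ + _]addrC addrACA subrr addr0 addrC addrA subrK.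
Qed.

Lemma emb_elt a b t : emb (elt a b t) = elt (f a) (f b) t.
Proof.
apply: val_inj; rewrite /= /emb_mx /elt_mx -/P [X in P *m X]addrC addKr.
rewrite -scalemxAr -scalemxAl (inj_eq f_inj); congr (_ + _ *: _).
have Pd i c : (P *m delta_mx a b) i c = ((i == f a) && (c == b))%:R.
  rewrite mxE (bigD1 a) //= big1 ?addr0.
    by rewrite !mxE eqxx -natrM mulnb.
  by move=> d /negPf da; rewrite !mxE da mulr0.
apply/matrixP => i j; rewrite mxE (bigD1 b) //= big1 ?addr0.
  by rewrite Pd !mxE eqxx andbT -natrM mulnb.
by move=> c /negPf cb; rewrite Pd cb andbF mul0r.
Qed.

Lemma emb_mul_row (g : SL A m) (X : 'M[A]_n) a j :
  (emb_mx (val g) *m X) (f a) j = \sum_b (val g : 'M[A]_m) a b * X (f b) j.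
Proof.
rewrite /emb_mx -/P mulmxDl mul1mx -!mulmxA.
have Pr k (Y : 'M[A]_(m, k)) c d : (P *m Y) (f c) d = Y c d.
  rewrite mxE (bigD1 c) //= !mxE eqxx mul1r big1 ?addr0 // => e ec.
  by rewrite !mxE (inj_eq f_inj) [c == e]eq_sym (negPf ec) mul0r.
have PTr b : (P^T *m X) b j = X (f b) j.
  rewrite mxE (bigD1 (f b)) //= !mxE eqxx mul1r big1 ?addr0 // => e ec.
  by rewrite !mxE (negPf ec) mul0r.
rewrite mxE Pr mulmxBl mul1mx mxE [X in _ + (_ + X)]mxE PTr addrC subrK mxE.
by apply: eq_bigr => b _; rewrite PTr.
Qed.

Lemma emb_mul_out (g : SL A m) (X : 'M[A]_n) i j : (forall a, i != f a) ->
  (emb_mx (val g) *m X) i j = X i j.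
Proof.
move=> hi; rewrite /emb_mx -/P mulmxDl mul1mx -!mulmxA mxE [X in _ + X]mxE.
by rewrite big1 ?addr0 // => a _; rewrite mxE (negPf (hi a)) mul0r.
Qed.

End Embedding.

(** * Quasi-cocycles on elementary matrices *)

Section QuasiCocycle.
Local Open Scope ring_scope.
Variables (R : realType) (V : lmodType R) (N : V -> R).

Record isometric_rep (G : groupType) (rho : G -> endo V) : Prop := IsometricRep {
  rep_iso : forall g, isometric N (rho g);
  rep_1 : rho 1%g = 1;
  rep_M : forall g h, rho (g * h)%g = rho g * rho h }.

Definition qcocycle (G : groupType) (rho : G -> endo V) (Q : R) (c : G -> V) :=
  forall g h, N (c (g * h)%g - (c g + rho g (c h))) <= Q.

Lemma qcocycle_comp (G H : groupType) (f : H -> G) rho Q c :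
  f 1%g = 1%g -> (forall g h, f (g * h)%g = (f g * f h)%g) ->
  @isometric_rep G rho -> qcocycle rho Q c ->
  isometric_rep (rho \o f) /\ qcocycle (rho \o f) Q (c \o f).
Proof.
move=> f1 fM rr qc; split=> [|g h]; last by rewrite /= fM.
by split=> [g||g h] /=; rewrite ?f1 ?fM; [exact: rep_iso|exact: rep_1|exact: rep_M].
Qed.

Hypothesis snN : seminorm N.

Section OneGroup.
Variables (G : groupType) (rho : G -> endo V) (Q : R) (c : G -> V).
Hypotheses (rr : isometric_rep rho) (qc : qcocycle rho Q c).

Lemma qc_ge0 : 0 <= Q.
Proof. by apply: le_trans (qc 1%g 1%g); exact: sn_ge0. Qed.

Lemma qc_1 : N (c 1%g) <= Q.
Proof.
have := qc 1%g 1%g; rewrite mulg1 (rep_1 rr) endo1E opprD addrA subrr add0r.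
by rewrite snopp.
Qed.

Lemma qc_M g h : N (c (g * h)%g) <= N (c g) + N (c h) + Q.
Proof.
rewrite -[c (g * h)%g](subrK (c g + rho g (c h))) [leRHS]addrC.
apply: le_trans (snD snN _ _) _; rewrite lerD //.
by apply: le_trans (snD snN _ _) _; rewrite (rep_iso rr).
Qed.

Lemma qc_V g : N (c g^-1%g) <= N (c g) + 2 * Q.
Proof.
have := qc g g^-1%g; rewrite mulgV => h; rewrite -(rep_iso rr g).
have -> : rho g (c g^-1%g) =
    c 1%g - c g - (c 1%g - (c g + rho g (c g^-1%g))).
  by rewrite opprB addrC addrA subrK addrAC subrr add0r.
apply: le_trans (snB snN _ _) _.
have := snB snN (c 1%g) (c g); have := qc_1; lra.
Qed.

(** Compare the expansions of c at g * h and at h * k. In particular c h is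
    almost fixed by every g that commutes with h and has a small value c g. *)
Lemma qc_intertwine g h k : (g * h = h * k)%g ->
  N (rho g (c h) - c h) <= N (c g) + N (c k) + 2 * Q.
Proof.
move=> ghk; have h1 := qc g h; have := qc h k; rewrite -ghk => h2.
have h3 : N (c h + rho h (c k) - (c g + c h)) <= N (c g) + N (c k).
  rewrite [c h + _]addrC [c g + _]addrC addrKA.
  by apply: le_trans (snB snN _ _) _; rewrite (rep_iso rr) [leRHS]addrC.
have -> : rho g (c h) - c h = c g + rho g (c h) - (c g + c h).
  by rewrite [c g + rho g _]addrC addrKA.
apply: le_trans (sn_tri snN (c (g * h)%g) _ _) _.
have := sn_tri snN (c h + rho h (c k)) (c (g * h)%g) (c g + c h).
by rewrite (snC snN) in h1; lra.
Qed.

Lemma qc_almost_additive g h e : N (rho g (c h) - c h) <= e ->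
  N (c (g * h)%g - (c g + c h)) <= Q + e.
Proof.
move=> he; apply: le_trans (sn_tri snN (c g + rho g (c h)) _ _) _.
by apply: lerD (qc g h) _; rewrite [c g + rho g _]addrC addrKA.
Qed.

Lemma qc_commutator x y z : (x * y = z * y * x)%g ->
  N (c z) <= 2 * (N (c x) + N (c y)) + 5 * Q.
Proof.
move=> xyz; have -> : z = ((x * y) * (y * x)^-1)%g by rewrite xyz -(mulgA z) mulgK.
have := qc_M (x * y)%g (y * x)^-1%g; have := qc_V (y * x)%g.
have := qc_M x y; have := qc_M y x; lra.
Qed.

End OneGroup.

Lemma almost_additive_mul (f : nat ->
  V) D : (forall s t, N (f (s + t)%N - (f s + f t)) <= D) ->
  forall k t, N (f (k.+1 * t)%N - k.+1%:R *: f t) <= k%:R * D.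
Proof.
move=> h k t; elim: k => [|k IHk]; first by rewrite mul1n scale1r subrr sn0 // mul0r.
rewrite mulSn [k.+2%:R]mulrS scalerDl scale1r.
apply: le_trans (sn_tri snN (f t + f (k.+1 * t)%N) _ _) _.
rewrite [k.+1%:R * D]mulr_natl [D *+ _]mulrS; apply: lerD (h _ _) _.
by rewrite [f t + f _]addrC addrKA -[leRHS]mulr_natl.
Qed.

End QuasiCocycle.

Section ElementaryBound.
Local Open Scope ring_scope.
Variables (R : realType) (V : lmodType R) (N : V -> R).
Hypothesis ucN : uc_banach N.
Let snN := ucb_sn ucN.

Lemma rep_steinberg n (rho : SL int n -> endo V) : isometric_rep N rho ->
  steinberg_rep N (fun i j t => rho (elt i j t)).
Proof.
move=> rr; split=> [i j t|i j|i j s t _|i j k l s t _ _ jk il|i j k s t ij jk ik].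
- exact: rep_iso.
- by rewrite elt0 (rep_1 rr).
- by rewrite eltD (rep_M rr).
- by rewrite /GRing.comm -!(rep_M rr) elt_comm.
- by rewrite -!(rep_M rr) elt_commutator.
Qed.

Variable n : nat.
Hypothesis n5 : (5 <= n)%N.
Variables (rho : SL int n -> endo V) (Q : R) (c : SL int n -> V).
Hypotheses (rr : isometric_rep N rho) (qc : qcocycle N rho Q c).

Lemma fresh (s : seq 'I_n) : (size s < n)%N -> exists k : 'I_n, k \notin s.
Proof.
move=> sn; apply/existsP; rewrite -negb_forall; apply/negP => /forallP h.
have := leq_trans (card_size s) (leqnn _); rewrite leqNgt.
by rewrite (eq_card (B := predT)) ?card_ord ?sn // => x; rewrite h.
Qed.

(** An elementary matrix with indices i, j commutes with the copy of SL_3 on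
    three other indices, which exist as n >= 5. By qc_intertwine its value is
    moved by a bounded amount by the generators of this SL_3, hence by all
    its elementary matrices by elementary_bounded. Commutators then give the
    root subgroups that share one index with (i, j), and finally (i, j)
    itself. *)
Lemma elt_displacement : exists2 D, 0 <= D & forall i j s t, i != j ->
  N (rho (elt i j s) (c (elt i j t)) - c (elt i j t)) <= D.
Proof.
have [C C0 hC] := elementary_bounded 'I_n ucN; have st := rep_steinberg rr.
pose M := \sum_(p : 'I_n * 'I_n) N (c (elt p.1 p.2 1)).
have M1 i j : N (c (elt i j 1)) <= M.
  rewrite /M (bigD1 (i, j)) //= lerDl; apply: sumr_ge0 => p _; exact: sn_ge0.
have Q0 := qc_ge0 snN qc.
have M0 : 0 <= M by apply: sumr_ge0 => p _; exact: sn_ge0.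
pose d := 2 * M + 2 * Q; have d0 : 0 <= d by rewrite addr_ge0 // mulr_ge0.
exists (2 * (2 * (d + C * d) + d)).
  by rewrite mulr_ge0 // !addr_ge0 // mulr_ge0 // addr_ge0 // mulr_ge0.
move=> i j s t ij; set v := c _.
have comm1 k l : k != j -> l != i -> N (rho (elt k l 1) v - v) <= d.
  move=> kj li; have := qc_intertwine snN rr qc (elt_comm 1 t li kj).
  by have := M1 k l; rewrite -/v /d; lra.
(* The SL_3 on k, l and a third index m away from i and j; this is where n >=
   5 is used. *)
have out k l u : k != i -> k != j -> l != i -> l != j -> k != l ->
    N (rho (elt k l u) v - v) <= C * d.
  move=> ki kj li lj kl.
  have [m] := fresh (s := [:: i; j; k; l]) n5.
  rewrite !inE !negb_or => /and4P[mi mj mk ml].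
  apply: (hC _ _ _ m _ _ st).
    by rewrite /all_distinct kl (eq_sym l m) (eq_sym k m) ml mk.
  move=> p q pklm qklm pq; apply: comm1.
    by move: pklm; rewrite !inE => /or3P[]/eqP->.
  by move: qklm; rewrite !inE => /or3P[]/eqP->.
have [l] := fresh (s := [:: i; j]) (ltn_trans (isT : 2 < 4)%N n5).
rewrite !inE !negb_or => /andP[li lj].
have ji : j != i by rewrite eq_sym.
have row p u : p != i -> p != j -> N (rho (elt i p u) v - v) <= 2 * (d + C * d).
  move=> pi_ pj; have [q] := fresh (s := [:: i; j; p]) (ltn_trans (isT : 3 < 4)%N n5).
  rewrite !inE !negb_or => /and3P[qi qj qp].
  apply: (comm_rel_disp ucN _ _ _ _ (comm1 i q ij qi) (out q p u qi qj pi_ pj qp));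
    try exact: (rep_iso rr).
  by rewrite -!(rep_M rr) elt_commutator ?mul1r // eq_sym.
apply: (comm_rel_disp ucN _ _ _ _ (row l s li lj) (comm1 l j lj ji));
  try exact: (rep_iso rr).
by rewrite -!(rep_M rr) elt_commutator ?mulr1 // eq_sym.
Qed.

(** By elt_displacement the map t |-> c (elt i j t) is additive up to a
    constant, so its value at t ^+ 2 is close to t times its value at t. But
    elt i j (t ^+ 2) is the commutator of two elementary matrices with entry
    t, so its value is at most four times the largest value at t plus a
    constant. For large t these are incompatible unless the values at t are
    bounded. *)
Theorem elementary_cocycle_bounded : exists B, forall i j t, i != j ->
  N (c (elt i j t)) <= B.
Proof.
have [D D0 hD] := elt_displacement; have Q0 := qc_ge0 snN qc.
have add i j (s t : int) : i != j ->
    N (c (elt i j (s + t)) - (c (elt i j s) + c (elt i j t))) <= Q + D.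
  by move=> ij; rewrite eltD; apply: (qc_almost_additive snN qc); exact: hD.
pose F p (t : nat) := if p.1 == p.2 then 0 else N (c (elt p.1 p.2 t%:Z)).
have small i j : exists b, forall t : nat, (t < 8)%N -> N (c (elt i j t%:Z)) <= b.
  exists (\sum_(t < 8) N (c (elt i j t%:Z))) => t t8.
  rewrite (bigD1 (Ordinal t8)) //= lerDl; apply: sumr_ge0 => k _; exact: sn_ge0.
have [b hb] := choice (fun p => small p.1 p.2).
pose B1 := \sum_p `|b p|.
have hB1 p : b p <= B1.
  by apply: le_trans (ler_norm _) _; rewrite /B1 (bigD1 p) //= lerDl sumr_ge0.
pose D' := Q + D; have D'0 : 0 <= D' by rewrite addr_ge0.
(* q is the pair of indices for which the value at k.+1 is largest. *)
have large k p : (7 <= k)%N -> F p k.+1 <= 5 * Q + 2 * D'.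
  move=> k7; pose q := [arg max_(q > p) F q k.+1]%O.
  have qmax p' : F p' k.+1 <= F q k.+1.
    by rewrite /q; case: Order.TotalTheory.arg_maxP => // q' _; exact.
  apply: le_trans (qmax p) _; case: (eqVneq q.1 q.2) => [q12|q12].
    by rewrite /F q12 eqxx addr_ge0 // mulr_ge0.
  have [l] := fresh (s := [:: q.1; q.2]) (ltn_trans (isT : 2 < 4)%N n5).
  rewrite !inE !negb_or => /andP[l1 l2].
  have l1' : q.1 != l by rewrite eq_sym.
  have := qc_commutator snN rr qc (elt_commutator k.+1%:Z k.+1%:Z l1' l2 q12).
  have := qmax (q.1, l); have := qmax (l, q.2).
  rewrite /F /= (negPf l1') (negPf l2) (negPf q12) => f1 f2 f3.
  have := almost_additive_mul snN (f := fun t : nat => c (elt q.1 q.2 t%:Z)) (D := D')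
    (fun s t => add _ _ s%:Z t%:Z q12) k k.+1.
  rewrite /= PoszM => f4.
  set y := c (elt _ _ (_ * _)) in f3 f4; set x := c (elt q.1 q.2 _) in f1 f2 f4 *.
  have f5 : k.+1%:R * N x <= N y + k%:R * D'.
    rewrite -[k.+1%:R in leLHS](ger0_norm (ler0n _ _)) -(snZ snN).
    rewrite -[_ *: x](subKr y); apply: le_trans (snB snN _ _) _.
    by rewrite lerD2l.
  have k7' : 7 <= k%:R :> R by rewrite ler_nat.
  move: f5; rewrite mulrS => f5.
  rewrite leNgt; apply/negP => hx.
  have : (k%:R - 3) * (5 * Q + 2 * D') < (k%:R - 3) * N x by rewrite ltr_pM2l //; lra.
  have : 0 <= (k%:R - 7) * D' by rewrite mulr_ge0 // subr_ge0.
  have : 0 <= (k%:R - 7) * Q by rewrite mulr_ge0 // subr_ge0.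
  by move: Q0 D'0 f1 f2 f3 f5; clear; nra.
exists (Num.max (5 * Q + 2 * D') B1 + 2 * Q) => i j t ij.
have nat_case (m : nat) : N (c (elt i j m%:Z)) <= Num.max (5 * Q + 2 * D') B1.
  rewrite le_max; case: (ltnP m 8) => m8.
    by rewrite (le_trans (hb (i, j) m m8) (hB1 _)) orbT.
  by case: m m8 => // m m8; have := large m (i, j) m8; rewrite /F /= (negPf ij) => ->.
case: t => m; first by apply: le_trans (nat_case m) _; rewrite lerDl mulr_ge0.
have -> : elt i j (Negz m) = ((elt i j m.+1%:Z)^-1)%g.
  by apply: (mulgI (elt i j m.+1%:Z)); rewrite -eltD NegzE subrr elt0 mulgV.
by apply: le_trans (qc_V snN rr qc _) _; rewrite lerD2r.
Qed.

End ElementaryBound.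

(** * Mennicke symbols and quasi-cocycles on SL_2 *)

Section Mx3.
Local Open Scope ring_scope.
Variable A : comNzRingType.

Definition i0 : 'I_3 := Ordinal (isT : 0 < 3)%N.
Definition i1 : 'I_3 := Ordinal (isT : 1 < 3)%N.
Definition i2 : 'I_3 := Ordinal (isT : 2 < 3)%N.

Definition mx3 (a b c d e f g h i : A) : 'M[A]_3 := \matrix_(p, q)
  nth 0 (nth [::] [:: [:: a; b; c]; [:: d; e; f]; [:: g; h; i]] p) q.

Lemma sum3 (F : 'I_3 -> A) : \sum_p F p = F i0 + F i1 + F i2.
Proof.
rewrite !big_ord_recr big_ord0 /= add0r; congr (F _ + F _ + F _); exact: val_inj.
Qed.

Lemma mx3M a b c d e f g h i a' b' c' d' e' f' g' h' i' :
  mx3 a b c d e f g h i *m mx3 a' b' c' d' e' f' g' h' i' =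
  mx3 (a * a' + b * d' + c * g') (a * b' + b * e' + c * h') (a * c' + b * f' + c * i')
      (d * a' + e * d' + f * g') (d * b' + e * e' + f * h') (d * c' + e * f' + f * i')
      (g * a' + h * d' + i * g') (g * b' + h * e' + i * h') (g * c' + h * f' + i * i').
Proof.
by apply/matrixP => -[[|[|[|//]]] ?] [[|[|[|//]]] ?]; rewrite !mxE sum3 !mxE.
Qed.

Lemma mx3_1 : 1%:M = mx3 1 0 0 0 1 0 0 0 1.
Proof. by apply/matrixP => -[[|[|[|//]]] ?] [[|[|[|//]]] ?]; rewrite !mxE. Qed.

Lemma det_mx3 a b c d e f g h i : \det (mx3 a b c d e f g h i) =
  a * (e * i - f * h) - b * (d * i - f * g) + c * (d * h - e * g).
Proof.
rewrite (expand_det_row _ i0) sum3 /cofactor.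
have det2 (M : 'M[A]_2) : \det M = M 0 0 * M 1 1 - M 0 1 * M 1 0.
  rewrite (expand_det_row _ 0) !big_ord_recr big_ord0 /= /cofactor !det_mx11 !mxE.
  have -> : widen_ord (leqnSn 1) ord_max = 0 :> 'I_2 by exact: val_inj.
  have -> : ord_max = 1 :> 'I_2 by exact: val_inj.
  have -> : lift 0 0 = 1 :> 'I_2 by exact: val_inj.
  have -> : lift 1 0 = 0 :> 'I_2 by exact: val_inj.
  by rewrite add0r expr0 mul1r expr1 mulN1r mulrN.
rewrite !det2 !mxE /=.
rewrite expr0 expr1 expr2; ring.
Qed.

Lemma val_elt (p q : 'I_3) t : p != q -> val (elt p q t) = mx3
  1 (if (p == i0) && (q == i1) then t else 0) (if (p == i0) && (q == i2) then t else 0)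
  (if (p == i1) && (q == i0) then t else 0) 1 (if (p == i1) && (q == i2) then t else 0)
  (if (p == i2) && (q == i0) then t else 0) (if (p == i2) && (q == i1) then t else 0) 1.
Proof.
move=> pq; rewrite /= /elt_mx (negPf pq) /mx3.
move: p q pq => [[|[|[|//]]] pp] [[|[|[|//]]] qq] // _;
  by apply/matrixP => -[[|[|[|//]]] ?] [[|[|[|//]]] ?]; rewrite !mxE /=
    ?mulr0 ?mulr1 ?addr0 ?add0r.
Qed.

Definition SLmx (M : 'M[A]_3) : SL A 3 := insubd (1%g : SL A 3) M.

Lemma SLmxK M : \det M = 1 -> val (SLmx M) = M.
Proof. by move=> h; rewrite insubdK //; apply/eqP. Qed.

Definition blk12 a b c d := mx3 a b 0 c d 0 0 0 1.
Definition blk23 a b c d := mx3 1 0 0 0 a b 0 c d.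

Lemma det_blk12 a b c d : \det (blk12 a b c d) = a * d - b * c.
Proof. rewrite det_mx3; ring. Qed.

Lemma det_blk23 a b c d : \det (blk23 a b c d) = a * d - b * c.
Proof. rewrite det_mx3; ring. Qed.

Lemma blk12_det (g : SL A 3) a b c d : val g = blk12 a b c d -> a * d - b * c = 1.
Proof. by move=> vg; rewrite -det_blk12 -vg; apply/eqP; exact: (valP g). Qed.

End Mx3.
Section SL3Identities.
Local Open Scope ring_scope.

Lemma val_mulSL (A : comNzRingType) n (g h : SL A n) : val (g * h)%g = val g *m val h.
Proof. by []. Qed.

Section Values.
Variable (A : comNzRingType) (t : A).

Lemma val_elt01 : val (elt i0 i1 t) = mx3 1 t 0 0 1 0 0 0 1.
Proof. by rewrite val_elt. Qed.
Lemma val_elt02 : val (elt i0 i2 t) = mx3 1 0 t 0 1 0 0 0 1.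
Proof. by rewrite val_elt. Qed.
Lemma val_elt10 : val (elt i1 i0 t) = mx3 1 0 0 t 1 0 0 0 1.
Proof. by rewrite val_elt. Qed.
Lemma val_elt12 : val (elt i1 i2 t) = mx3 1 0 0 0 1 t 0 0 1.
Proof. by rewrite val_elt. Qed.
Lemma val_elt20 : val (elt i2 i0 t) = mx3 1 0 0 0 1 0 t 0 1.
Proof. by rewrite val_elt. Qed.
Lemma val_elt21 : val (elt i2 i1 t) = mx3 1 0 0 0 1 0 0 t 1.
Proof. by rewrite val_elt. Qed.

End Values.

Definition val_eltE := (val_elt01, val_elt02, val_elt10, val_elt12, val_elt20,
  val_elt21).

Lemma blk12_normalizes (g : SL int 3) a b c d : val g = blk12 a b c d ->
  [/\ forall t, (elt i0 i2 t * g = g * (elt i0 i2 (t * d) * elt i1 i2 (- (t * c))))%g,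
      forall t, (elt i1 i2 t * g = g * (elt i0 i2 (- (t * b)) * elt i1 i2 (t * a)))%g,
      forall t, (elt i2 i0 t * g = g * (elt i2 i0 (t * a) * elt i2 i1 (t * b)))%g
    & forall t, (elt i2 i1 t * g = g * (elt i2 i0 (t * c) * elt i2 i1 (t * d)))%g].
Proof.
move=> vg; have dt := blk12_det vg.
split=> t; have dtt := congr1 (fun x => t * x) dt; apply: val_inj;
  rewrite !val_mulSL vg !val_eltE !mx3M; congr mx3; try nia.
Qed.

Lemma blk23_normalizes (g : SL int 3) a b c d : val g = blk23 a b c d ->
  [/\ forall t, (elt i1 i0 t * g = g * (elt i1 i0 (t * d) * elt i2 i0 (- (t * c))))%g,
      forall t, (elt i2 i0 t * g = g * (elt i1 i0 (- (t * b)) * elt i2 i0 (t * a)))%g,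
      forall t, (elt i0 i1 t * g = g * (elt i0 i1 (t * a) * elt i0 i2 (t * b)))%g
    & forall t, (elt i0 i2 t * g = g * (elt i0 i1 (t * c) * elt i0 i2 (t * d)))%g].
Proof.
move=> vg; have dt : a * d - b * c = 1.
  by rewrite -det_blk23 -vg; apply/eqP; exact: (valP g).
split=> t; have dtt := congr1 (fun x => t * x) dt; apply: val_inj;
  rewrite !val_mulSL vg !val_eltE !mx3M; congr mx3; try nia.
Qed.

(** When b is congruent to 1 modulo a, the matrix is a product of four
    elementary ones. *)
Lemma short_row (g : SL int 3) a c d k : val g = blk12 a (1 + k * a) c d ->
  g = (elt i1 i0 (d - k * c - 1)%R * elt i0 i1 1%R * elt i1 i0 (a - 1)%R * elt i0 i1 k)%g.
Proof.
move=> vg; have dt := blk12_det vg.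
have e1 : c = a * (d - k * c) - 1 by lia.
apply: val_inj; rewrite !val_mulSL vg !val_eltE !mx3M.
move: (d - k * c) e1 (subrK (k * c) d) => e -> <-.
by congr mx3; ring.
Qed.

Definition sigma : SL int 3 := (elt i1 i2 (-1)%R * elt i2 i1 1%R * elt i1 i2 (-1)%R)%g.
Definition rotation : SL int 3 := (elt i0 i1 (-1)%R * elt i1 i0 1%R * elt i0 i1 (-1)%R * sigma)%g.

(** A form of the multiplicativity of Mennicke symbols in their second entry:
    up to elementary matrices, the row (a, b1 * b2) is obtained from the rows
    (a, b1) and (a, b2) placed in overlapping blocks. *)
Lemma mennicke (h1 h2 h12 g : SL int 3) a b1 c1 d1 b2 c2 d2 :
  val h1 = blk12 a b1 c1 d1 -> val h2 = blk12 a b2 c2 d2 ->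
  val h12 = blk12 a (b1 * b2) (- (c1 * c2)) (d2 - c2 * d1 * b2) ->
  val g = blk23 b2 (- a) d2 (- c2) ->
  (h1 * g * elt i0 i2 b1 = elt i2 i1 c2 * sigma *
     (h12 * (elt i2 i0 (- c1)%R * elt i2 i1 (- (d1 * b2))%R)))%g.
Proof.
move=> v1 v2 v12 vg; have e1 := blk12_det v1; have e2 := blk12_det v2.
apply: val_inj; rewrite !val_mulSL v1 v12 vg !val_eltE !mx3M; congr mx3.
all: by [ring | nia].
Qed.

Definition unrotation : SL int 3 :=
  (elt i1 i2 1%R * elt i2 i1 (-1)%R * elt i1 i2 1%R * rotation)%g.

(** The blocks on the indices 0, 1 and 1, 2 differ by fixed factors. *)
Lemma rotate_block (h g : SL int 3) a b c d : val h = blk12 a b c d ->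
  val g = blk23 b (- a) d (- c) -> g = (rotation * (h * unrotation^-1))%g.
Proof.
move=> vh vg; apply: (mulIg unrotation); rewrite -!mulgA mulVg mulg1.
apply: val_inj; rewrite !val_mulSL vh vg !val_eltE !mx3M; congr mx3.
all: by ring.
Qed.

Lemma unit_pm1 (x y : int) : x * y = 1 -> x = 1 \/ x = -1.
Proof.
move=> /(congr1 absz)/eqP; rewrite abszM muln_eq1 => /andP[/eqP hx _]; lia.
Qed.

(** Euclid's algorithm on the first row. *)
Lemma sl2_induction (S : SL int 3 -> Prop) :
  (forall g h, S g -> S h -> S (g * h)%g) ->
  (forall p q t, p != q -> S (elt p q t)) ->
  forall (g : SL int 3) a b c d, val g = blk12 a b c d -> S g.
Proof.
move=> SM Se g a b c d; have [m] := ubnP (`|a| + `|b|)%N.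
elim: m g a b c d => // m IHm g a b c d; rewrite ltnS => abm vg.
have dt := blk12_det vg.
have base k (g' : SL int 3) a' c' d' : val g' = blk12 a' (1 + k * a') c' d' -> S g'.
  move=> vg'; rewrite (short_row vg').
  by apply: (SM _ _ (SM _ _ (SM _ _ (Se _ _ _ _) (Se _ _ _ _)) (Se _ _ _ _))
    (Se _ _ _ _)).
have right01 x : S (g * elt i0 i1 x)%g -> S g.
  move=> h; rewrite -[g]mulg1 -(elt0 _ i0 i1) -(addrN x) eltD mulgA.
  by apply: SM h _; exact: Se.
have right10 x : S (g * elt i1 i0 x)%g -> S g.
  move=> h; rewrite -[g]mulg1 -(elt0 _ i1 i0) -(addrN x) eltD mulgA.
  by apply: SM h _; exact: Se.
have val01 x : val (g * elt i0 i1 x)%g = blk12 a (b + a * x) c (d + c * x).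
  rewrite !val_mulSL vg !val_eltE !mx3M; congr mx3; ring.
have val10 x : val (g * elt i1 i0 x)%g = blk12 (a + b * x) b (c + d * x) d.
  rewrite !val_mulSL vg !val_eltE !mx3M; congr mx3; ring.
have [a0|a0] := eqVneq a 0.
  have b1 : b = 1 \/ b = -1 by apply: (@unit_pm1 _ (- c)); lia.
  apply: (right10 b); apply: (base (b - 1) _ 1 (c + d * b) d).
  by rewrite val10; congr mx3; case: b1 => ->; lia.
have [b0|b0] := eqVneq b 0.
  have a1 : a = 1 \/ a = -1 by apply: (@unit_pm1 _ d); lia.
  apply: (right01 (a - 1)); apply: (base (- 1) _ a c (d + c * (a - 1))).
  by rewrite val01; congr mx3; case: a1 => ->; lia.
have [ba|ab] := leqP `|b|%N `|a|%N.
  apply: (right10 (- (sgz a * sgz b))); apply: IHm (val10 _).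
  apply: leq_trans abm; rewrite ltn_add2r.
  nia.
apply: (right01 (- (sgz a * sgz b))); apply: IHm (val01 _).
apply: leq_trans abm; rewrite ltn_add2l.
nia.
Qed.

(** Euler's theorem; the exponent 2 * totient `|a| also takes care of the
    sign of b. *)
Lemma power_mod (a b c d : int) : a * d - b * c = 1 ->
  exists k m, b ^+ m.+1 = 1 + k * a.
Proof.
move=> dt; have [a0|a0] := eqVneq a 0.
  have b1 : b = 1 \/ b = -1 by apply: (@unit_pm1 _ (- c)); lia.
  by exists 0, 1%N; rewrite mul0r addr0; case: b1 => ->.
have cop : coprime `|b| `|a|.
  rewrite -coprimezE; apply/coprimezP; exists (- c, d) => /=; lia.
have t0 : (0 < totient `|a|)%N by rewrite totient_gt0 absz_gt0.
have tS : (2 * totient `|a|)%N = (2 * totient `|a|).-1.+1 by rewrite prednK // muln_gt0.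
have : (a %| b ^+ (2 * totient `|a|) - 1)%Z.
  have b2 : b ^+ 2 = (`|b| ^ 2)%N%:Z by rewrite -abszX gez0_abs // sqr_ge0.
  have -> : b ^+ (2 * totient `|a|) = ((`|b| ^ totient `|a|) ^ 2)%N%:Z.
    by rewrite exprM b2 -!natz -natrX -!expnM mulnC.
  rewrite -[1]/(1%N%:Z) -eqz_mod_dvd; apply/eqP.
  have := Euler_exp_totient cop; set X := (_ ^ _)%N => hX.
  have : (X ^ 2 = 1 %[mod `|a|])%N by rewrite -modnXm hX modnXm exp1n.
  move=> h; rewrite -(modz_abs _ a) -[in RHS](modz_abs _ a).
  by rewrite !modz_nat h.
case/dvdzP => k hk; exists k, (2 * totient `|a|).-1.
by rewrite -tS -hk addrC subrK.
Qed.

End SL3Identities.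

Section Mennicke.
Local Open Scope ring_scope.
Variables (R : realType) (V : lmodType R) (N : V -> R).
Hypothesis ucN : uc_banach N.
Let snN := ucb_sn ucN.
Variables (rho : SL int 3 -> endo V) (Q : R) (c : SL int 3 -> V).
Hypotheses (rr : isometric_rep N rho) (qc : qcocycle N rho Q c).
Variable B : R.
Hypothesis cB : forall p q t, p != q -> N (c (elt p q t)) <= B.

Definition invariant (u : V) := forall p q t, p != q -> rho (elt p q t) u = u.

Definition nearly_invariant D v := exists2 u, N (v - u) <= D & invariant u.

Let Q0 : 0 <= Q. Proof. exact: (qc_ge0 snN qc). Qed.
Let B0 : 0 <= B.
Proof. by apply: le_trans (sn_ge0 snN _) (cB 0 (isT : i0 != i1)). Qed.

(** The block g normalises the root subgroups that link it to the third
    index, and c is bounded on these. *)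
Lemma normalizes_disp (p q p1 q1 p2 q2 : 'I_3) x y t g : p != q -> p1 != q1 ->
  p2 != q2 ->
  (elt p q t * g = g * (elt p1 q1 x * elt p2 q2 y))%g ->
  N (rho (elt p q t) (c g) - c g) <= 3 * B + 3 * Q.
Proof.
move=> pq pq1 pq2 e; have := qc_intertwine snN rr qc e.
have := qc_M snN rr qc (elt p1 q1 x) (elt p2 q2 y).
have := cB t pq; have := cB x pq1; have := cB y pq2; lra.
Qed.

Lemma block_nearly_invariant : exists2 D, 0 <= D &
  forall (g : SL int 3) a b e d, val g = blk12 a b e d \/ val g = blk23 a b e d ->
  nearly_invariant D (c g).
Proof.
have [C C0 hC] := near_invariant 'I_3 ucN; have st := rep_steinberg rr.
have D0 : 0 <= 3 * B + 3 * Q by rewrite addr_ge0 // mulr_ge0.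
exists (C * (3 * B + 3 * Q)); first by rewrite mulr_ge0.
move=> g a b e d [] vg.
  have [e1 e2 e3 e4] := blk12_normalizes vg.
  have [t|t|t|t|u gu hu] := hC _ i0 i1 i2 (c g) _ st isT D0;
    try exact: (normalizes_disp _ _ _ (e1 t));
      try exact: (normalizes_disp _ _ _ (e2 t));
    try exact: (normalizes_disp _ _ _ (e3 t));
      try exact: (normalizes_disp _ _ _ (e4 t)).
  exists u => // p q t; apply: hu; rewrite !inE;
    [by case: p => [[|[|[|//]]] ?] | by case: q => [[|[|[|//]]] ?]].
have [e1 e2 e3 e4] := blk23_normalizes vg.
have [t|t|t|t|u gu hu] := hC _ i1 i2 i0 (c g) _ st isT D0;
    try exact: (normalizes_disp _ _ _ (e1 t));
      try exact: (normalizes_disp _ _ _ (e2 t));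
    try exact: (normalizes_disp _ _ _ (e3 t));
      try exact: (normalizes_disp _ _ _ (e4 t)).
exists u => // p q t; apply: hu; rewrite !inE;
  [by case: p => [[|[|[|//]]] ?] | by case: q => [[|[|[|//]]] ?]].
Qed.

Definition stabilizes (g : SL int 3) := forall u, invariant u -> rho g u = u.

Lemma stabilizesM g h : stabilizes g -> stabilizes h -> stabilizes (g * h)%g.
Proof. by move=> sg sh u iu; rewrite (rep_M rr) endoME sh ?sg. Qed.

Lemma stabilizes_elt p q t : p != q -> stabilizes (elt p q t).
Proof. by move=> pq u iu; exact: iu. Qed.

Lemma stabilizes_blk12 (g : SL int 3) a b e d : val g = blk12 a b e d -> stabilizes g.
Proof. exact: (sl2_induction stabilizesM stabilizes_elt). Qed.

Lemma stabilizes_sigma : stabilizes sigma.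
Proof. by apply: (stabilizesM (stabilizesM (stabilizes_elt _ _)
  (stabilizes_elt _ _)) (stabilizes_elt _ _)). Qed.

Lemma stabilizes_rotation : stabilizes rotation.
Proof.
apply: stabilizesM stabilizes_sigma.
by apply: (stabilizesM (stabilizesM (stabilizes_elt _ _) (stabilizes_elt _ _))
  (stabilizes_elt _ _)).
Qed.

Lemma nearly_invariant_disp D v g : stabilizes g -> nearly_invariant D v ->
  N (rho g v - v) <= 2 * D.
Proof.
move=> sg [u vu iu]; apply: le_trans (sn_tri snN u _ _) _.
rewrite -{1}(sg u iu) -endoB (rep_iso rr) mulr_natl mulr2n lerD //.
by rewrite snC.
Qed.

(** The values of c at blocks are close to vectors fixed by all of SL_3, so
    multiplying such a block on the left by g changes its value by c g, up to
    a bounded error. *)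
Lemma left_mul_close D g h k r : stabilizes g -> nearly_invariant D (c h) ->
  N (c k - c h) <= r -> N (c (g * k)%g - c h) <= Q + N (c g) + r + 2 * D.
Proof.
move=> sg ih kh; apply: le_trans (sn_tri snN (c g + rho g (c k)) _ _) _.
rewrite -!addrA; apply: lerD (qc g k) _.
apply: le_trans (snD snN _ _) _; rewrite lerD2l.
apply: le_trans (sn_tri snN (rho g (c h)) _ _) _.
by rewrite -endoB (rep_iso rr) lerD // nearly_invariant_disp.
Qed.

Lemma right_mul_close g h : N (c (g * h)%g - c g) <= Q + N (c h).
Proof.
apply: le_trans (sn_tri snN (c g + rho g (c h)) _ _) _.
apply: lerD (qc g h) _.
by rewrite addrC addKr (rep_iso rr).
Qed.

(** In the identity mennicke all factors other than the blocks have bounded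
    values, and by left_mul_close the values of the blocks add up. *)
Lemma mennicke_additive : exists2 K, 0 <= K &
  forall (h1 h2 h12 : SL int 3) a b1 c1 d1 b2 c2 d2,
  val h1 = blk12 a b1 c1 d1 -> val h2 = blk12 a b2 c2 d2 ->
  val h12 = blk12 a (b1 * b2) (- (c1 * c2)) (d2 - c2 * d1 * b2) ->
  N (c h12 - (c h1 + c h2)) <= K.
Proof.
have [D D0 hD] := block_nearly_invariant.
pose W := N (c rotation) + N (c unrotation^-1%g) + N (c sigma).
have W0 : 0 <= W by rewrite !addr_ge0 //; exact: sn_ge0.
exists (20 * Q + 20 * B + 20 * D + W); first by have q0 := Q0; have b0 := B0; lra.
move=> h1 h2 h12 a b1 c1 d1 b2 c2 d2 v1 v2 v12.
have dt2 := blk12_det v2.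
pose g : SL int 3 := SLmx (blk23 b2 (- a) d2 (- c2)).
have vg : val g = blk23 b2 (- a) d2 (- c2).
  by apply: SLmxK; rewrite det_blk23; lia.
have near_h2 := hD h2 _ _ _ _ (or_introl v2).
have near_h12 := hD h12 _ _ _ _ (or_introl v12).
have near_g := hD g _ _ _ _ (or_intror vg).
(* c g is close to c h2. *)
have e2 := left_mul_close stabilizes_rotation near_h2
  (right_mul_close h2 unrotation^-1%g).
rewrite -(rotate_block v2 vg) in e2.
have e1 := qc_almost_additive snN qc (nearly_invariant_disp (stabilizes_blk12 v1)
  near_g).
have e3 := right_mul_close (h1 * g)%g (elt i0 i2 b1).
(* c (h1 * g), up to elementary factors, is close to c h12. *)
have e4 := left_mul_close (stabilizesM (stabilizes_elt c2 (isT : i2 != i1))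
  stabilizes_sigma)
  near_h12 (right_mul_close h12 (elt i2 i0 (- c1)%R * elt i2 i1 (- (d1 * b2))%R)%g).
rewrite -(mennicke v1 v2 v12 vg) in e4.
have e5 := qc_M snN rr qc (elt i2 i0 (- c1)) (elt i2 i1 (- (d1 * b2))).
have e6 := qc_M snN rr qc (elt i2 i1 c2) sigma.
have b1' := cB b1 (isT : i0 != i2); have b2' := cB (- c1) (isT : i2 != i0).
have b3' := cB (- (d1 * b2)) (isT : i2 != i1); have b4' := cB c2 (isT : i2 != i1).
rewrite snC // in e4.
have f1 := sn_tri snN (c (h1 * g * elt i0 i2 b1)%g) (c h12) (c h1 + c h2).
have f2 := sn_tri snN (c (h1 * g)%g) (c (h1 * g * elt i0 i2 b1)%g) (c h1 + c h2).
have f3 := sn_tri snN (c h1 + c g) (c (h1 * g)%g) (c h1 + c h2).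
have f4 : N (c h1 + c g - (c h1 + c h2)) = N (c g - c h2).
  by rewrite [c h1 + _]addrC addrKA.
have q0 := Q0; have b0 := B0; rewrite /W.
lra.
Qed.

(** By mennicke_additive there is a block with first row (a, b ^+ m.+1) whose
    value is close to m.+1 times the value at h, with an error of at most m *
    K. For a suitable m this block is a product of four elementary matrices,
    so its value is bounded independently of m. Dividing by m.+1 bounds the
    value at h. *)
Theorem blk12_cocycle_bounded : exists C, forall (g : SL int 3) a b e d,
  val g = blk12 a b e d -> N (c g) <= C.
Proof.
have [K K0 hK] := mennicke_additive; exists (4 * B + 3 * Q + K) => h a b e d vh.
have dt := blk12_det vh.
have pow m : exists g e' d', val (g : SL int 3) = blk12 a (b ^+ m.+1) e' d' /\
    N (c g - m.+1%:R *: c h) <= m%:R * K.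
  elim: m => [|m [g [e' [d' [vg hg]]]]].
    by exists h, e, d; rewrite expr1 scale1r subrr sn0 // mul0r.
  have dg := blk12_det vg.
  pose k := SLmx (blk12 a (b ^+ m.+1 * b) (- (e' * e)) (d - e * d' * b)).
  have vk : val k = blk12 a (b ^+ m.+1 * b) (- (e' * e)) (d - e * d' * b).
    apply: SLmxK; rewrite det_blk12; move: (b ^+ m.+1) dg => b' dg.
    transitivity (a * d - b * e * (a * d' - b' * e')); first by ring.
    by rewrite dg mulr1.
  exists k, (- (e' * e)), (d - e * d' * b); split; first by rewrite vk -exprSr.
  apply: le_trans (sn_tri snN (c g + c h) _ _) _.
  rewrite [m.+1%:R * K]mulr_natl [K *+ _]mulrS;
    apply: lerD (hK _ _ _ _ _ _ _ _ _ _ vg vh vk) _.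
  rewrite [m.+2%:R]mulrS scalerDl scale1r addrKA.
  by rewrite mulr_natl in hg.
have [k [m bm]] := power_mod dt; have [g [e' [d' [vg hg]]]] := pow m.
rewrite bm in vg; have gE := short_row vg.
set x1 := elt i1 i0 _ in gE; set x2 := elt i0 i1 _ in gE.
set x3 := elt i1 i0 _ in gE; set x4 := elt i0 i1 _ in gE.
have g1 : N (c g) <= 4 * B + 3 * Q.
  have y1 : N (c x1) <= B by exact: cB.
  have y2 : N (c x2) <= B by exact: cB.
  have y3 : N (c x3) <= B by exact: cB.
  have y4 : N (c x4) <= B by exact: cB.
  have := qc_M snN rr qc (x1 * x2 * x3)%g x4; have := qc_M snN rr qc (x1 * x2)%g x3.
  have := qc_M snN rr qc x1 x2; rewrite gE; lra.
have h1 : m.+1%:R * N (c h) <= N (c g) + m%:R * K.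
  rewrite -[m.+1%:R in leLHS](ger0_norm (ler0n _ _)) -(snZ snN).
  rewrite -[_ *: c h](subKr (c g)); apply: le_trans (snB snN _ _) _.
  by rewrite lerD2l.
rewrite -(ler_pM2l (ltr0Sn _ m)); apply: le_trans h1 _.
rewrite mulrDr; apply: lerD; last by rewrite ler_wpM2r // ler_nat.
apply: le_trans g1 _; rewrite ler_peMl ?ler1n //.
by have q0 := Q0; have b0 := B0; lra.
Qed.

End Mennicke.

(** * Bounded generation by SL_2 blocks *)

Section BoundedGeneration.
Local Open Scope ring_scope.
Variables (A : comNzRingType) (R : realType) (n : nat).
Hypothesis n3 : (2 < n)%N.
Hypothesis bezout : forall x y : A, exists a b c d : A,
  a * d - b * c = 1 /\ c * x + d * y = 0.
Variables (L : SL A n -> R) (Q B : R).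
Hypothesis LM : forall g h, L (g * h)%g <= L g + L h + Q.
Hypothesis LB : forall (f : 'I_3 -> 'I_n) (f_inj : injective f) (h : SL A 3) a b c d,
  val h = blk12 a b c d -> L (emb f_inj h) <= B.

Implicit Types (g x : SL A n) (i j p q : 'I_n).

Lemma triple p q : p != q -> exists2 f : 'I_3 ->
  'I_n, injective f & f i0 = p /\ f i1 = q.
Proof.
move=> pq; have [m] := fresh (s := [:: p; q]) n3.
rewrite !inE !negb_or => /andP[mp mq].
exists (fun a : 'I_3 => nth m [:: p; q] a) => //.
by move=> [[|[|[|//]]] ?] [[|[|[|//]]] ?] //= e; apply: val_inj => //=;
  move: pq mp mq; rewrite ?e ?eqxx // -?e ?eqxx.
Qed.

(** The bound is on the inverse of x because g is recovered as the product of
    this inverse with x * g. *)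
Lemma row_operation p q a b c d g : p != q -> a * d - b * c = 1 -> exists x,
  [/\ L x^-1%g <= B,
      forall j, (val (x * g)%g : 'M_n) p j = a * (val g : 'M_n)
        p j + b * (val g : 'M_n) q j,
      forall j, (val (x * g)%g : 'M_n) q j = c * (val g : 'M_n)
        p j + d * (val g : 'M_n) q j
    & forall i j, i != p -> i != q -> (val (x * g)%g : 'M_n) i j = (val g : 'M_n) i j].
Proof.
move=> pq dt; have [f f_inj [fp fq]] := triple pq.
have vh : val (SLmx (blk12 a b c d)) = blk12 a b c d by rewrite SLmxK // det_blk12.
have vh' : val (SLmx (blk12 d (- b) (- c) a)) = blk12 d (- b) (- c) a.
  by rewrite SLmxK // det_blk12 mulrNN mulrC.
exists (emb f_inj (SLmx (blk12 a b c d))); split.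
- rewrite [(_^-1)%g](_ : _ = emb f_inj (SLmx (blk12 d (- b) (- c) a)));
  first exact: LB vh'.
  apply: (mulIg (emb f_inj (SLmx (blk12 a b c d)))); rewrite mulVg -embM.
  rewrite (_ : (_ * _)%g = elt i0 i1 0); first by rewrite emb_elt elt0.
  apply: val_inj; rewrite elt0 val_mulSL vh vh' /= mx3_1 mx3M.
  by congr mx3; first [ring | rewrite -dt; ring].
- move=> j; rewrite val_mulSL /= -{1}fp emb_mul_row // sum3 vh !mxE /= fp fq mul0r addr0.
  by [].
- move=> j; rewrite val_mulSL /= -{1}fq emb_mul_row // sum3 vh !mxE /= fp fq mul0r addr0.
  by [].
move=> i j ip iq; rewrite val_mulSL /=.
have [/existsP[e /eqP ie]|/existsPn hi] := boolP [exists e, i == f e]; last first.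
  by rewrite emb_mul_out.
rewrite ie emb_mul_row // sum3 vh.
case: e ie => -[|[|[|//]]] le ie.
- by case/eqP: ip; rewrite ie -fp; congr f; exact: val_inj.
- by case/eqP: iq; rewrite ie -fq; congr f; exact: val_inj.
rewrite !mxE /= !mul0r !add0r mul1r; congr (sval g (f _) j); exact: val_inj.
Qed.

(** L is a length function for which blocks are short, so sets of matrices
    may be bounded by reducing them, one block at a time, to a set already
    known to be bounded. *)
Definition L_bounded (S : SL A n -> Prop) := exists C, forall g, S g -> L g <= C.

Lemma L_bounded_step (S S' : SL A n -> Prop) :
  (forall g, S g -> exists2 x, L x^-1%g <= B & S' (x * g)%g) ->
  L_bounded S' -> L_bounded S.
Proof.
move=> h [C hC]; exists (B + C + Q) => g /h[x xB /hC xg].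
by rewrite -[g](mulKg x); apply: le_trans (LM _ _) _; rewrite !lerD.
Qed.

Lemma L_bounded_sub (S S' : SL A n -> Prop) :
  (forall g, S g -> S' g) -> L_bounded S' -> L_bounded S.
Proof. by move=> h [C hC]; exists C => g /h/hC. Qed.

Notation "g '@e' i j" := ((val (g : SL A n) : 'M[A]_n) i j) (at level 10, i at level 9, j at level 9).

Definition unit_columns (k : nat) g := forall i j, (j < k)%N -> g @e i j = (i == j)%:R.

Section Column.
Variable k : 'I_n.

Definition cleared_below (m : nat) g := unit_columns k g /\
  forall i, (k < i)%N -> (i < m)%N -> g @e i k = 0.
Definition cleared_above (m : nat) g := [/\ cleared_below n g, g @e k k = 1 &
  forall i, (i < m)%N -> (i < k)%N -> g @e i k = 0].

Lemma unit_columns_op p q x g : (k <= p)%N -> (k <= q)%N -> unit_columns k g ->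
  (exists a b, forall j, (x * g)%g @e p j = a * g @e p j + b * g @e q j) ->
  (exists a b, forall j, (x * g)%g @e q j = a * g @e p j + b * g @e q j) ->
  (forall i j, i != p -> i != q -> (x * g)%g @e i j = g @e i j) ->
  unit_columns k (x * g)%g.
Proof.
move=> kp kq ug [a [b hp]] [c [d hq]] ho i j jk.
have jp : (p == j) = false by apply/eqP => e; move: jk; rewrite -e ltnNge kp.
have jq : (q == j) = false by apply/eqP => e; move: jk; rewrite -e ltnNge kq.
have [->|ip] := eqVneq i p; first by rewrite hp !ug // jp jq !mulr0 addr0.
have [->|iq] := eqVneq i q; first by rewrite hq !ug // jp jq !mulr0 addr0.
by rewrite ho // ug.
Qed.

Lemma clear_below_step (m : nat) : (k < m)%N -> (m < n)%N ->
  L_bounded (cleared_below m.+1) -> L_bounded (cleared_below m).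
Proof.
move=> km mn; pose q := Ordinal mn; apply: L_bounded_step => g [ug cg].
have kq : k != q by rewrite -(inj_eq val_inj) /= (ltn_eqF km).
have [a [b [c [d [dt h]]]]] := bezout (g @e k k) (g @e q k).
have [x [xB xk xq xo]] := row_operation g kq dt.
exists x => //; split.
  by apply: (unit_columns_op _ _ ug _ _ xo); rewrite ?leqnn ?(ltnW km) //; eauto.
move=> i ki; rewrite ltnS leq_eqVlt => /orP[/eqP im|im].
  by have -> : i = q by [exact: val_inj]; rewrite xq.
rewrite xo ?cg // -(inj_eq val_inj) /=; first by rewrite gtn_eqF.
by rewrite ltn_eqF.
Qed.

Lemma clear_above_step (m : nat) : (m < k)%N ->
  L_bounded (cleared_above m.+1) -> L_bounded (cleared_above m).
Proof.
move=> mk; pose p := Ordinal (ltn_trans mk (ltn_ord k)).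
apply: L_bounded_step => g [[ug cg] gk ag].
have pk : p != k by rewrite -(inj_eq val_inj) /= (ltn_eqF mk).
have dt : 1 * 1 - (- g @e p k) * 0 = 1 by rewrite mulr0 subr0 mulr1.
have [x [xB xp xk xo]] := row_operation g pk dt.
have xk' j : (x * g)%g @e k j = g @e k j by rewrite xk mul0r mul1r add0r.
exists x => //; split; first split.
- move=> i j jk; have kj : (k == j) = false by apply/eqP => e; move: jk; rewrite e ltnn.
  have [->|ip] := eqVneq i p;
    first by rewrite xp (ug p j jk) (ug k j jk) kj mulr0 addr0 mul1r.
  have [->|ik] := eqVneq i k; first by rewrite xk' ug.
  by rewrite xo // ug.
- move=> i ki il; rewrite xo ?cg // -(inj_eq val_inj) /=; last by rewrite gtn_eqF.
  by rewrite gtn_eqF // (ltn_trans mk).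
- by rewrite xk' gk.
move=> i; rewrite ltnS leq_eqVlt => /orP[/eqP im _|im ik].
  by have -> : i = p by [exact: val_inj]; rewrite xp gk mul1r mulr1 addrN.
by rewrite xo ?ag // -(inj_eq val_inj) /= ltn_eqF.
Qed.

(** The first k columns being unit vectors, the row k of the inverse vanishes
    before the diagonal, and below the diagonal the column k vanishes. *)
Lemma diagonal_unit g : cleared_below n g -> g^-1%g @e k k * g @e k k = 1.
Proof.
case=> ug cg; have col i j : \sum_l g^-1%g @e i l * g @e l j = (i == j)%:R.
  have := congr1 (fun M : SL A n => (val M : 'M_n) i j) (mulVg g).
  by rewrite val_mulSL !mxE.
have inv0 i : (i < k)%N -> g^-1%g @e k i = 0.
  move=> ik; have := col k i; rewrite (bigD1 i) //= ug // eqxx mulr1 big1 ?addr0.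
    by move=> ->; rewrite -(inj_eq val_inj) gtn_eqF.
  by move=> l li; rewrite ug // (negPf li) mulr0.
have := col k k; rewrite eqxx (bigD1 k) //= big1 ?addr0 // => l lk.
have [lt|gt|/val_inj e] := ltngtP l k; last by rewrite e eqxx in lk.
  by rewrite inv0 // mul0r.
by rewrite cg // mulr0.
Qed.

(** The entry at (k, k) is a unit. In the last column it is the determinant;
    in the others the block diag(u, u^-1) acting on the rows k and k + 1
    turns it into 1. *)
Lemma normalize_diagonal : L_bounded (cleared_above 0) -> L_bounded (cleared_below n).
Proof.
have [kn|] := ltnP k.+1 n; last first.
  move=> nk; apply: L_bounded_sub => g [ug cg]; split=> //.
  have kE : k.+1 = n by apply/eqP; rewrite eqn_leq nk ltn_ord.
  have /eqP := valP g; rewrite -det_tr det_trig.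
    rewrite (bigD1 k) //= big1 ?mulr1 => [|i ik]; first by rewrite mxE.
    rewrite mxE ug ?eqxx // ltn_neqAle ik -ltnS kE; exact: ltn_ord.
  apply/is_trig_mxP => i j ij; rewrite mxE ug.
    by rewrite -(inj_eq val_inj) gtn_eqF.
  by rewrite -ltnS kE; exact: leq_ltn_trans ij (ltn_ord j).
pose q := Ordinal kn; apply: L_bounded_step => g [ug cg].
have kq : k != q by rewrite -(inj_eq val_inj) /= (ltn_eqF (ltnSn k)).
have u := diagonal_unit (conj ug cg).
have dt : g^-1%g @e k k * g @e k k - 0 * 0 = 1 by rewrite mulr0 subr0.
have [x [xB xk xq xo]] := row_operation g kq dt.
exists x => //; split=> //; last by rewrite xk mul0r addr0.
split.
  by apply: (unit_columns_op _ _ ug _ _ xo); rewrite ?leqnn ?leqnSn //; eauto.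
move=> i ki il; have [->|iq] := eqVneq i q.
  by rewrite xq mul0r add0r (cg q) ?mulr0 //=.
by rewrite xo ?cg // -(inj_eq val_inj) gtn_eqF.
Qed.

Lemma unit_columns_step : L_bounded (unit_columns k.+1) -> L_bounded (unit_columns k).
Proof.
move=> h.
have h1 : L_bounded (cleared_above k).
  apply: L_bounded_sub h => g [[ug cg] gk ag] i j; rewrite ltnS leq_eqVlt.
  case/orP=> [/eqP/val_inj ->|]; last exact: ug.
  have [lt|gt|/val_inj ->] := ltngtP i k; last by rewrite eqxx.
    by rewrite ag // -(inj_eq val_inj) ltn_eqF.
  by rewrite cg // -(inj_eq val_inj) gtn_eqF.
have h2 m : (m <= k)%N -> L_bounded (cleared_above (k - m)).
  elim: m => [|m IHm] mk; first by rewrite subn0.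
  apply: clear_above_step; first by rewrite ltn_subrL (leq_ltn_trans _ mk).
  by rewrite subnSK //; apply: IHm; exact: ltnW.
have := h2 k (leqnn k); rewrite subnn => /normalize_diagonal h3.
have h4 m : (m <= n - k.+1)%N -> L_bounded (cleared_below (n - m)).
  elim: m => [|m IHm] mk; first by rewrite subn0.
  have mn : (m.+1 <= n)%N := leq_trans mk (leq_subr _ _).
  apply: clear_below_step.
  - by have := ltn_ord k; lia.
  - by rewrite ltn_subrL (leq_ltn_trans _ mn).
  by rewrite subnSK //; apply: IHm; exact: ltnW.
have := h4 _ (leqnn _); rewrite subKn ?ltn_ord //.
by apply: L_bounded_sub => g ug; split=> // i ki; rewrite ltnS leqNgt ki.
Qed.

End Column.

(** Gaussian elimination, one column after the other, with a number of blocks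
    that depends on n only. Bezout's identity is what clears an entry by
    means of a single block. *)
Theorem SL_bounded_generation : exists C, forall g, L g <= C.
Proof.
have hn : L_bounded (unit_columns n).
  exists (L 1%g) => g ug; rewrite (_ : g = 1%g) //; apply: val_inj.
  by apply/matrixP => i j; rewrite ug // !mxE.
have h m : (m <= n)%N -> L_bounded (unit_columns (n - m)).
  elim: m => [|m IHm] mn; first by rewrite subn0.
  have lt : (n - m.+1 < n)%N by rewrite ltn_subrL (leq_ltn_trans _ mn).
  apply: (@unit_columns_step (Ordinal lt)) => /=.
  by rewrite subnSK //; apply: IHm; exact: ltnW.
have [C hC] := h n (leqnn n); exists C => g; apply: hC => i j.
by rewrite subnn ltn0.
Qed.

End BoundedGeneration.

(** * Bounded quasi-cocycles on SL_n over the integers and the reals *)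

Section Bezout.
Local Open Scope ring_scope.

Lemma int_bezout (x y : int) : exists a b c d : int,
  a * d - b * c = 1 /\ c * x + d * y = 0.
Proof.
have [g0|g0] := eqVneq (gcdz x y) 0.
  exists 1, 0, 0, 1; rewrite mulr1 mulr0 subr0 mul0r add0r mul1r; split=> //.
  by move/eqP: g0; rewrite gcdz_eq0 => /andP[_ /eqP].
have [u [v uv]] := Bezoutz x y.
have /dvdzP[x' xE] := dvdz_gcdl x y; have /dvdzP[y' yE] := dvdz_gcdr x y.
move: (gcdz x y) g0 uv xE yE => G G0 uv xE yE; rewrite {}xE {}yE in uv *.
exists u, v, (- y'), x'; split; last by ring.
apply: (mulIf G0); rewrite mul1r -[RHS]uv; ring.
Qed.

Lemma field_bezout (F : fieldType) (x y : F) : exists a b c d : F,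
  a * d - b * c = 1 /\ c * x + d * y = 0.
Proof.
have [->|x0] := eqVneq x 0.
  by exists 0, 1, (-1), 0; rewrite !mulr0 mul0r addr0 mul1r sub0r opprK.
by exists 1, 0, (- (y / x)), 1; rewrite !mul1r mul0r subr0 mulNr divfK // addNr.
Qed.

End Bezout.

Section Bounded.
Local Open Scope ring_scope.
Variables (R : realType) (V : lmodType R) (N : V -> R).
Hypothesis ucN : uc_banach N.
Let snN := ucb_sn ucN.
Variable n : nat.
Hypothesis n5 : (5 <= n)%N.
Let n3 : (2 < n)%N. Proof. exact: leq_trans n5. Qed.

Lemma emb1 (A : comNzRingType) m (f : 'I_m -> 'I_n) (f_inj : injective f) :
  emb f_inj (1%g : SL A m) = 1%g.
Proof. by apply: val_inj; rewrite /= /emb_mx subrr mulmx0 mul0mx addr0. Qed.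

Theorem SLZ_cocycle_bounded (rho : SL int n -> endo V) Q c :
  isometric_rep N rho -> qcocycle N rho Q c -> exists C, forall g, N (c g) <= C.
Proof.
move=> rr qc; have [B hB] := elementary_cocycle_bounded ucN n5 rr qc.
have blocks (f : {ffun 'I_3 ->
  'I_n}) : exists C, forall (f_inj : injective f) (g : SL int 3) a b e d,
    val g = blk12 a b e d -> N (c (emb f_inj g)) <= C.
  have [f_inj|f_ninj] := pselect (injective f); last by exists 0.
  have [rf qf] := qcocycle_comp (emb1 int f_inj) (embM f_inj) rr qc.
  have hBf p q t : p != q -> N ((c \o emb f_inj) (elt p q t)) <= B.
    by move=> pq /=; rewrite emb_elt; apply: hB; rewrite (inj_eq f_inj).
  have [C hC] := blk12_cocycle_bounded ucN rf qf hBf.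
  by exists C => f_inj' g a b e d vg; rewrite (Prop_irrelevance f_inj' f_inj);
    exact: hC vg.
have [C hC] := choice blocks.
apply: (SL_bounded_generation (L := fun g => N (c g)) (Q := Q)
  (B := \sum_f `|C f|) n3 int_bezout (qc_M snN rr qc)).
move=> f f_inj h a b e d vh.
have fE : (finfun f : 'I_3 -> 'I_n) = f by apply/funext => k; rewrite ffunE.
move: f_inj; rewrite -fE => f_inj; apply: le_trans (hC _ f_inj _ _ _ _ _ vh) _.
by apply: le_trans (ler_norm _) _; rewrite (bigD1 (finfun f)) //= lerDl sumr_ge0.
Qed.

Lemma int_SL_subproof (g : SL int n) : \det (map_mx (intr : int -> R) (val g)) == 1.
Proof. by rewrite det_map_mx (eqP (valP g)) rmorph1. Qed.

Definition int_SL (g : SL int n) : SL R n :=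
  exist _ (map_mx (intr : int -> R) (val g)) (int_SL_subproof g).

Lemma int_SL1 : int_SL 1%g = 1%g.
Proof. by apply: val_inj; rewrite /= map_mx1. Qed.

Lemma int_SLM g h : int_SL (g * h)%g = (int_SL g * int_SL h)%g.
Proof. by apply: val_inj; rewrite /= map_mxM. Qed.

Lemma int_SL_elt i j t : int_SL (elt i j t) = elt i j t%:~R.
Proof.
apply: val_inj; rewrite /= /elt_mx map_mxD map_mx1 map_mxZ map_delta_mx.
by case: (i == j); rewrite ?rmorph0.
Qed.

Lemma real_block_elementary (g : SL R 3) a b e d : val g = blk12 a b e d ->
  exists x y z t,
    g = (elt i1 i0 x * (elt i0 i1 y * (elt i1 i0 z * elt i0 i1 t)))%g.
Proof.
move=> vg; have dt := blk12_det vg; have [e0|e0] := eqVneq e 0.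
  have a0 : a != 0.
    by apply/eqP => a0; move: dt; rewrite a0 e0 mul0r mulr0 subr0 => /eqP;
      rewrite eq_sym oner_eq0.
  exists (-1), ((a - 1) / a), a, ((b + d - 1) / a).
  apply: val_inj; rewrite !val_mulSL vg !val_eltE !mx3M e0.
  have dE : d = a^-1 by rewrite e0 mulr0 subr0 in dt; apply: (mulfI a0);
    rewrite dt mulfV.
  by rewrite dE; congr mx3; field.
have bE : b = (a * d - 1) / e by rewrite -dt opprB addrC subrK mulfK.
exists 0, ((a - 1) / e), e, ((d - 1) / e).
apply: val_inj; rewrite !val_mulSL vg !val_eltE !mx3M bE.
by congr mx3; field.
Qed.

(** Each real elementary matrix is an integral one times one with entry in
    [0, 1], and every real SL_2 block is a product of four elementary
    matrices. *)
Theorem SLR_cocycle_bounded (rho : SL R n -> endo V) Q c B :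
  isometric_rep N rho -> qcocycle N rho Q c ->
  (forall i j t, 0 <= t <= 1 -> N (c (elt i j t)) <= B) ->
  exists C, forall g, N (c g) <= C.
Proof.
move=> rr qc hB.
have [rz qz] := qcocycle_comp int_SL1 int_SLM rr qc.
have [B' hB'] := elementary_cocycle_bounded ucN n5 rz qz.
have elt_bounded i j t : i != j -> N (c (elt i j t)) <= B' + B + Q.
  move=> ij; have -> : t = (Num.floor t)%:~R + (t - (Num.floor t)%:~R)
    by rewrite addrC subrK.
  rewrite eltD; apply: le_trans (qc_M snN rr qc _ _) _; rewrite !lerD //.
    by rewrite -int_SL_elt; exact: hB'.
  apply: hB; have := floor_itv t; rewrite intrD => /andP[h1 h2]; apply/andP; split; lra.
apply: (SL_bounded_generation (L := fun g => N (c g)) (Q := Q)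
  (B := 4 * (B' + B + Q) + 3 * Q) n3 (@field_bezout R) (qc_M snN rr qc)).
move=> f f_inj h a b e d vh.
have [x [y [z [t ->]]]] := real_block_elementary vh.
rewrite !embM !emb_elt.
have f01 : f i0 != f i1 by rewrite (inj_eq f_inj).
have f10 : f i1 != f i0 by rewrite (inj_eq f_inj).
have := elt_bounded _ _ x f10; have := elt_bounded _ _ y f01.
have := elt_bounded _ _ z f10; have := elt_bounded _ _ t f01.
set x1 := elt _ _ x; set x2 := elt _ _ y; set x3 := elt _ _ z; set x4 := elt _ _ t.
have := qc_M snN rr qc x1 (x2 * (x3 * x4))%g; have := qc_M snN rr qc x2 (x3 * x4)%g.
have := qc_M snN rr qc x3 x4; lra.
Qed.

End Bounded.

(** * Invariant uniformly convex norms *)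

Section Renorm.
Local Open Scope ring_scope.
Variables (R : realType) (V : lmodType R) (n0 : V -> R).
Hypothesis sn0' : seminorm n0.

Definition sphere_convex := forall e : R, 0 < e <= 2 -> exists2 d : R, 0 < d <= 1 &
  forall u v, n0 u = 1 -> n0 v = 1 -> e <= n0 (u - v) ->
    n0 (2^-1 *: (u + v)) <= 1 - d.

Lemma normalize_close u : 0 < n0 u <= 1 ->
  n0 ((n0 u)^-1 *: u) = 1 /\ n0 (u - (n0 u)^-1 *: u) = 1 - n0 u.
Proof.
case/andP=> u0 u1; have ui : 1 <= (n0 u)^-1 by rewrite invf_ge1.
split; first by rewrite (snZ sn0') ger0_norm ?invr_ge0 ?(ltW u0) // mulVf // gt_eqF.
rewrite -{1}[u]scale1r -scalerBl (snZ sn0') distrC ger0_norm ?subr_ge0 //.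
by rewrite mulrBl mul1r mulVf // gt_eqF.
Qed.

(** Vectors of the unit ball that are not close to the sphere have a short
    midpoint by the triangle inequality; the others are normalised. *)
Lemma unit_ball_convex : sphere_convex -> forall e : R, 0 < e ->
  exists2 d : R, 0 < d < 1 &
  forall u v, n0 u <= 1 -> n0 v <= 1 -> e <= n0 (u - v) ->
    n0 (2^-1 *: (u + v)) <= 1 - d.
Proof.
move=> sc e e0; pose e' := Num.min e 2 / 2.
have e'0 : 0 < e' by rewrite divr_gt0 // lt_min e0 /=.
have e'e : e' <= e / 2 by rewrite ler_pM2r ?invr_gt0 // ge_min lexx.
have e'1 : e' <= 1 by rewrite ler_pdivrMr // mul1r ge_min lexx orbT.
have [|dl /andP[dl0 dl1] hdl] := sc e'; first by rewrite e'0 (le_trans e'1) // ler1n.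
pose t := Num.min (e' / 2) (dl / 2).
have t0 : 0 < t by rewrite lt_min; apply/andP; split; lra.
have te : t <= e' / 2 by rewrite ge_min lexx.
have td : t <= dl / 2 by rewrite ge_min lexx orbT.
exists (t / 2); first by apply/andP; split; lra.
move=> u v u1 v1 euv.
have mid p q : n0 (2^-1 *: (p + q)) <= 2^-1 * (n0 p + n0 q).
  rewrite (sn_half sn0') ler_pM2l ?invr_gt0 //; exact: snD.
have [ut|ut] := leP (n0 u) (1 - t); first by have := mid u v; lra.
have [vt|vt] := leP (n0 v) (1 - t); first by have := mid u v; lra.
have [|pu cu] := @normalize_close u; first by rewrite u1 andbT; lra.
have [|pv cv] := @normalize_close v; first by rewrite v1 andbT; lra.
set u' := _ *: u in pu cu; set v' := _ *: v in pv cv.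
have f : e' <= n0 (u' - v').
  have := sn_tri sn0' u' u v; have := sn_tri sn0' v' u' v.
  by rewrite (snC sn0' v'); lra.
have := hdl _ _ pu pv f; have g := mid (u - u') (v - v').
have -> : 2^-1 *: (u + v) = 2^-1 *: (u - u' + (v - v')) + 2^-1 *: (u' + v').
  by rewrite -scalerDr [u - u' + _]addrACA -opprD subrK.
have := snD sn0' (2^-1 *: (u - u' + (v - v'))) (2^-1 *: (u' + v')).
lra.
Qed.

Lemma sphere_convex_unif : sphere_convex -> unif_convex n0.
Proof.
move=> sc e e0; have [d d01 hd] := unit_ball_convex sc e0;
  exists d => // r u v ur vr euv.
have : 0 <= r by apply: le_trans ur; exact: sn_ge0.
rewrite le_eqVlt => /orP[/eqP r0|r0].
  rewrite -r0 mulr0 in ur vr *; rewrite (sn_half sn0') pmulr_rle0 ?invr_gt0 //.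
  by apply: le_trans (snD sn0' _ _) _; lra.
have scl w : n0 (r^-1 *: w) = r^-1 * n0 w.
  by rewrite (snZ sn0') ger0_norm // invr_ge0 ltW.
have := hd (r^-1 *: u) (r^-1 *: v); rewrite -scalerBr -scalerDr !scl.
rewrite (sn_half sn0') scl mulrCA -(sn_half sn0')
  ![r^-1 * _]mulrC !ler_pdivrMr // ?mul1r ler_pdivlMr //.
exact.
Qed.

Variable nn : V -> R.
Hypotheses (snn : seminorm nn) (nn_sep : forall v, nn v = 0 -> v = 0).
Hypothesis nn_complete : forall u, cauchy_seq_norm nn u -> exists l, cvg_seq nn u l.
Variables a b : R.
Hypotheses (a_gt0 : 0 < a) (b_gt0 : 0 < b).
Hypothesis equiv : forall v, a * nn v <= n0 v /\ n0 v <= b * nn v.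
Hypothesis sc : sphere_convex.
Variables (G : groupType) (rho : G -> endo V).
Hypothesis rr : isometric_rep nn rho.

Definition orbit_values v : set R := fun r => exists g, r = n0 (rho g v).

Definition sup_norm v := sup (orbit_values v).

Let has_sup_orbit v : has_sup (orbit_values v).
Proof.
split; first by exists (n0 (rho 1%g v)), 1%g.
by exists (b * nn v) => _ [g ->]; have := (equiv (rho g v)).2; rewrite (rep_iso rr).
Qed.

Let le_sup_norm g v : n0 (rho g v) <= sup_norm v.
Proof. by apply: sup_upper_bound => //; exists g. Qed.

Let sup_norm_le v r : (forall g, n0 (rho g v) <= r) -> sup_norm v <= r.
Proof.
move=> h; apply: ge_sup; first by case: (has_sup_orbit v).
by move=> _ [g ->].
Qed.

Lemma sup_norm_equiv v : a * nn v <= sup_norm v /\ sup_norm v <= b * nn v.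
Proof.
split; last by apply: sup_norm_le => g; have := (equiv (rho g v)).2;
  rewrite (rep_iso rr).
apply: le_trans (le_sup_norm 1%g v); rewrite -{1}(rep_iso rr 1%g).
by have := (equiv (rho 1%g v)).1.
Qed.

Lemma sup_norm_seminorm : seminorm sup_norm.
Proof.
have sZ c v : sup_norm (c *: v) <= `|c| * sup_norm v.
  by apply: sup_norm_le => g; rewrite endoZ (snZ sn0') ler_wpM2l.
split=> [u v|c v].
  apply: sup_norm_le => g; rewrite endoD; apply: le_trans (snD sn0' _ _) _.
  by rewrite lerD.
apply/eqP; rewrite eq_le sZ /=; have [->|c0] := eqVneq c 0.
  rewrite normr0 mul0r scale0r; apply: le_trans (sn_ge0 sn0' _) (le_sup_norm 1%g _).
rewrite -ler_pdivlMl ?normr_gt0 // -normfV.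
by apply: le_trans (sZ _ _); rewrite scalerA mulVf // scale1r.
Qed.

Lemma sup_norm_isometric : isometric_rep sup_norm rho.
Proof.
split; [|exact: rep_1 rr|exact: rep_M rr].
have le h v : sup_norm (rho h v) <= sup_norm v.
  by apply: sup_norm_le => g; rewrite -endoME -(rep_M rr).
move=> h v; apply/eqP; rewrite eq_le le /=.
by rewrite -{1}[v](endo1E v) -(rep_1 rr) -(mulVg h) (rep_M rr) endoME.
Qed.

(** All the translates rho g (u - v) have the same original norm, so by
    comparability they are uniformly far from 0 for n0. The convexity of n0
    can thus be applied to each translate of u and v with the same modulus. *)
Lemma sup_norm_uc_banach : uc_banach sup_norm.
Proof.
have ss := sup_norm_seminorm; split=> //.
- move=> v v0; apply: nn_sep; apply/eqP; rewrite eq_le (sn_ge0 snn) // andbT.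
  by rewrite -(pmulr_rle0 _ a_gt0) -v0; exact: (sup_norm_equiv v).1.
- move=> e e0; have [|d d01 hd] := sphere_convex_unif sc (e := a * e / b).
    by rewrite divr_gt0 // mulr_gt0.
  exists d => // r u v ur vr euv; apply: sup_norm_le => g.
  rewrite endoZ endoD; apply: hd; try exact: le_trans (le_sup_norm g _) _.
  rewrite -endoB; apply: le_trans (equiv _).1; rewrite (rep_iso rr).
  rewrite -!mulrA ler_pM2l // [b^-1 * _]mulrC mulrA ler_pdivrMr // [nn _ * b]mulrC.
  by apply: le_trans euv _; exact: (sup_norm_equiv _).2.
move=> w cw; have [|l hl] := nn_complete (u := w).
  move=> e e0; have [|m0 hm] := cw (a * e); first by rewrite mulr_gt0.
  exists m0 => m m' h h'; rewrite -(ler_pM2l a_gt0).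
  by apply: le_trans (hm m m' h h'); exact: (sup_norm_equiv _).1.
exists l => e e0; have [|m0 hm] := hl (e / b); first by rewrite divr_gt0.
exists m0 => m h; apply: le_trans (sup_norm_equiv _).2 _.
by rewrite -ler_pdivlMl // mulrC; exact: hm.
Qed.

End Renorm.

(** * Real and complex Banach spaces *)

From mathcomp Require Import all_classical all_reals all_analysis.
From mathcomp Require Import complex.
Import numFieldNormedType.Exports.

Section RealScalars.
Local Open Scope ring_scope.
Variables (R : realType) (K : numFieldType).

(** This treats the scalars R and R[i] at once: iota embeds the reals, and re
    recovers nonnegative elements of K. *)
Record real_part (iota : {rmorphism R -> K}) (re : K -> R) : Prop := RealPart {
  re_iota : forall a, re (iota a) = a;
  iota_re : forall x, 0 <= x -> iota (re x) = x;
  iota_le : forall a b, (iota a <= iota b) = (a <= b);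
  iota_norm : forall a, `|iota a| = iota `|a| }.

(** E with its scalars restricted to the reals along iota. *)
Definition realified (iota : {rmorphism R -> K}) (E : lmodType K) : Type := E.

Section Module.
Variables (iota : {rmorphism R -> K}) (E : lmodType K).

HB.instance Definition _ := GRing.Zmodule.copy (realified iota E) E.

Definition real_scale (a : R) (v : realified iota E) : realified iota E :=
  iota a *: (v : E).

Lemma real_scaleA a b v : real_scale a (real_scale b v) = real_scale (a * b) v.
Proof. by rewrite /real_scale scalerA rmorphM. Qed.
Lemma real_scale1 : left_id 1 real_scale.
Proof. by move=> v; rewrite /real_scale rmorph1 scale1r. Qed.
Lemma real_scaleDr : right_distributive real_scale +%R.
Proof. by move=> a u v; exact: scalerDr. Qed.
Lemma real_scaleDl v : {morph real_scale^~ v : a b / a + b}.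
Proof. by move=> a b; rewrite /real_scale rmorphD scalerDl. Qed.

HB.instance Definition _ := GRing.Zmodule_isLmodule.Build R (realified iota E)
  real_scaleA real_scale1 real_scaleDr real_scaleDl.

End Module.

Variables (iota : {rmorphism R -> K}) (re : K -> R).
Hypothesis rp : real_part iota re.

Lemma iota_lt a b : (iota a < iota b) = (a < b).
Proof.
rewrite !lt_neqAle (iota_le rp); congr (~~ _ && _).
by apply/eqP/eqP => [h|->//]; rewrite -(re_iota rp a) h (re_iota rp).
Qed.

Lemma re_le x y : 0 <= x -> 0 <= y -> (re x <= re y) = (x <= y).
Proof. by move=> x0 y0; rewrite -(iota_le rp) !(iota_re rp). Qed.

Lemma re_gt0 x : 0 < x -> 0 < re x.
Proof. by move=> x0; rewrite -iota_lt rmorph0 (iota_re rp) // ltW. Qed.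

Lemma reD x y : 0 <= x -> 0 <= y -> re (x + y) = re x + re y.
Proof.
by move=> x0 y0; rewrite -{1}(iota_re rp x0) -{1}(iota_re rp y0) -rmorphD (re_iota rp).
Qed.

Lemma reM x y : 0 <= x -> 0 <= y -> re (x * y) = re x * re y.
Proof.
by move=> x0 y0; rewrite -{1}(iota_re rp x0) -{1}(iota_re rp y0) -rmorphM (re_iota rp).
Qed.

Variable E : completeNormedModType K.
Let V : lmodType R := realified iota E.

Definition real_norm (v : V) : R := re `|(v : E)|.

Lemma is_norm_ge0 (N0 : E -> K) : is_norm N0 -> forall x, 0 <= N0 x.
Proof.
case=> tri hom _ x; have := tri x (- x); rewrite subrr.
rewrite -(scale0r 0) hom normr0 mul0r -scaleN1r hom normrN1 mul1r.
by rewrite -mulr2n pmulrn_lge0.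
Qed.

Lemma is_norm_seminorm (N0 : E -> K) : is_norm N0 ->
  seminorm (fun v : V => re (N0 v)).
Proof.
move=> nm; have N0ge := is_norm_ge0 nm; case: nm => tri hom _; split=> [u v|a v].
  by rewrite -reD // re_le ?addr_ge0.
by rewrite hom (iota_norm rp) reM ?(re_iota rp) // -(rmorph0 iota) (iota_le rp).
Qed.

Lemma norm_is_norm : is_norm (fun x : E => `|x|).
Proof. by split=> [x y|a x|x /normr0_eq0]; [exact: ler_normD|exact: normrZ|]. Qed.

Lemma real_norm_complete u : cauchy_seq_norm real_norm u ->
  exists l, cvg_seq real_norm u l.
Proof.
move=> cu; pose w : nat -> E := u.
have /cvg_ex[l wl] : cvg (w @ \oo)%classic.
  apply/cauchy_cvgP; apply/cauchyP => e e0.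
  have [|m hm] := cu (re e / 2); first by rewrite divr_gt0 // re_gt0.
  exists (w m); exists m => // k /= mk; rewrite -ball_normE /=.
  have h := hm m k (leqnn m) mk.
  rewrite -(iota_re rp (normr_ge0 _)) -(iota_re rp (ltW e0)) iota_lt.
  by apply: le_lt_trans h _; have := re_gt0 e0; lra.
exists l => e e0; have e0' : 0 < iota e by rewrite -(rmorph0 iota) iota_lt.
have /cvgrPdist_le/(_ _ e0')[m _ hm] := wl.
exists m => k mk; have := hm k mk; rewrite /= distrC => h.
by rewrite /real_norm -(re_iota rp e) re_le // ltW.
Qed.

Lemma uniformly_convex_sphere N0 : is_norm N0 -> uniformly_convex N0 ->
  sphere_convex (fun v : V => re (N0 v)).
Proof.
move=> nm [delta hd] e /andP[e0 e2]; have N0ge := is_norm_ge0 nm.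
have re1 : re 1 = 1 by rewrite -(rmorph1 iota) (re_iota rp).
have half_eq : iota 2^-1 = 2^-1 by rewrite fmorphV rmorph_nat.
have [|/andP[d0 d1] h] := hd (iota e).
  by rewrite -(rmorph0 iota) iota_lt e0 -(rmorph_nat iota) (iota_le rp).
exists (re (delta (iota e))).
  by rewrite re_gt0 // -re1 re_le ?(ltW d0).
move=> u v u1 v1 euv.
have one w : re (N0 w) = 1 -> N0 w = 1.
  by move=> w1; rewrite -(iota_re rp (N0ge w)) w1 rmorph1.
have := h u v (one u u1) (one v v1).
rewrite -{1}(iota_re rp (N0ge (u - v))) (iota_le rp) => /(_ euv) h2.
rewrite -(iota_le rp) (iota_re rp (N0ge _)) rmorphB rmorph1 (iota_re rp (ltW d0)).
by move: h2; rewrite -half_eq.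
Qed.

Lemma bounded_fun_le (T : Type) (f : T -> E) :
  [bounded f x | x in [set: T]]%classic <-> exists M : R, forall x, re `|f x| <= M.
Proof.
split=> [[M [Mr hM]]|[M hM]].
  have M0 : 0 <= `|M| + 1 by rewrite addr_ge0.
  exists (re (`|M| + 1)) => x; rewrite re_le //; apply: hM => //.
  by apply: le_lt_trans (real_ler_norm Mr) _; rewrite ltrDl.
exists (iota M); split=> [|x Mx t _] /=.
  by have [] := ltP 0 M => [h|h];
    rewrite realE -(rmorph0 iota) !(iota_le rp) ?(ltW h) ?h ?orbT.
by apply: le_trans (ltW Mx); rewrite -(iota_re rp (normr_ge0 _)) (iota_le rp).
Qed.

(** Replace the uniformly convex norm by its supremum over the orbit of the
    group. *)
Lemma renormed_quasi_cocycle (G : topologicalGroupType)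
    (pi : {multiplicative G -> isometry_group E}) (c : G -> E) :
  super_reflexive E -> quasi_cocycle pi c ->
  exists N : V -> R, uc_banach N /\ exists rho : G -> endo V, exists Q a b,
  [/\ isometric_rep N rho, qcocycle N rho Q c, 0 < a, 0 < b &
    forall v, a * real_norm v <= N v /\ N v <= b * real_norm v].
Proof.
move=> [N0 [[nm [a [b [a0 b0 ab]]]] uc]] qc.
have lin g : linear (isometry_fun (pi g) : V -> V).
  move=> t u v; have [l _ _] := isometry_funP (pi g); exact: l.
pose rho g : endo V := Endo (lin g).
have rr : isometric_rep real_norm rho.
  split=> [g v||g h].
  - by rewrite /real_norm /=; have [_ -> _] := isometry_funP (pi g).
  - have p1 : pi 1%g = 1%g by apply: (mulgI (pi 1%g)); rewrite -gmulfM !mulg1.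
    by apply: endo_ext => v; rewrite /= p1.
  by apply: endo_ext => v /=; rewrite gmulfM.
have ss := is_norm_seminorm nm; have sr := is_norm_seminorm norm_is_norm.
have sep (v : V) : real_norm v = 0 -> v = 0.
  move=> v0; apply: (@normr0_eq0 _ E); rewrite -(iota_re rp (normr_ge0 (v : E))).
  by rewrite [re _]v0 rmorph0.
have eqv (v : V) : re a * real_norm v <= re (N0 v) /\ re (N0 v) <= re b * real_norm v.
  have [h1 h2] := ab v.
  by rewrite /real_norm -!reM ?re_le ?mulr_ge0 ?(ltW a0) ?(ltW b0) // (is_norm_ge0 nm).
have sc := uniformly_convex_sphere nm uc.
exists (sup_norm (fun v : V => re (N0 v)) rho); split.
  exact: (sup_norm_uc_banach ss sr sep real_norm_complete (re_gt0 a0) (re_gt0 b0)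
    eqv sc rr).
have /bounded_fun_le[M hM] := qc.
exists rho, (re b * M), (re a), (re b); split.
- exact: (sup_norm_isometric eqv rr).
- move=> g h; apply: le_trans (sup_norm_equiv eqv rr _).2 _.
  rewrite ler_pM2l ?re_gt0 //; exact: (hM (g, h)).
- exact: re_gt0.
- exact: re_gt0.
exact: (sup_norm_equiv eqv rr).
Qed.

(** The topology of SLR is induced by the entries, and those of elt i j t are
    affine in t. *)
Lemma elt_continuous n (i j : 'I_n) : continuous (fun t : R => elt i j t : SLR R n).
Proof.
move=> t D [_ [[C oC <-] /= Ct] CD].
have [P nP PC] : nbhs (elt_mx i j t) C by apply: open_nbhs_nbhs; split.
pose f (pq : 'I_n * 'I_n) (s : R) : Prop := P pq.1 pq.2 (elt_mx i j s pq.1 pq.2).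
suff : (\forall s \near (t : R), forall pq, f pq s)%classic.
  by apply: filterS => s Ps; apply: CD; apply: PC => p q; exact: (Ps (p, q)).
refine (@filter_forall R ('I_n * 'I_n)%type f (nbhs (t : R)) (nbhs_filter (t : R))
  _) => -[p q].
have cpq : continuous (fun s : R => elt_mx i j s p q).
  rewrite (_ : (fun s => _) = fun s : R =>
      (p == q)%:R + (if i == j then 0 else s) * ((p == i) && (q == j))%:R).
    case: (i == j) => s; first exact: cvg_cst.
    apply: cvgD; first exact: cvg_cst.
    by apply: cvgM; [exact: cvg_id|exact: cvg_cst].
  by apply/funext => s; rewrite !mxE.
exact: (cpq t _ (nP p q)).
Qed.

Lemma real_norm_bounded_on_segment (f : R -> E) : continuous f ->
  exists B, forall t, 0 <= t <= 1 -> re `|f t| <= B.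
Proof.
move=> fc; have hc : continuous (fun t => re `|f t|).
  move=> t; apply/cvgrPdist_le => e e0.
  have e0' : 0 < iota e by rewrite -(rmorph0 iota) iota_lt.
  have /cvgrPdist_le/(_ _ e0') := fc t; apply: filterS => s hs.
  have sr := is_norm_seminorm norm_is_norm.
  have h : re `|f t - f s| <= e by rewrite -(re_iota rp e) re_le // ltW.
  have h' : re `|f s - f t| <= e by rewrite distrC.
  have h1 : re `|f t| <= re `|f t - f s| + re `|f s|.
    by have := sn_tri sr (f s) (f t : V) 0; rewrite !subr0.
  have h2 : re `|f s| <= re `|f s - f t| + re `|f t|.
    by have := sn_tri sr (f t) (f s : V) 0; rewrite !subr0.
  by rewrite ler_norml; apply/andP; split; lra.
have [s _ hs] := EVT_max ler01 (continuous_subspaceT hc).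
by exists (re `|f s|) => t t01; apply: hs; rewrite in_itv.
Qed.

Theorem SLZ_property_FF n : (5 <= n)%N -> super_reflexive E -> property_FF (SLZ n) E.
Proof.
move=> n5 sE pi _ c _ qc.
have [N [ucN [rho [Q [a [b [rr qN a0 b0 eqv]]]]]]] := renormed_quasi_cocycle sE qc.
have [C hC] := @SLZ_cocycle_bounded R V N ucN n n5 rho Q c rr qN.
apply/bounded_fun_le; exists (C / a) => g.
by rewrite ler_pdivlMr // mulrC; apply: le_trans (eqv (c g)).1 (hC g).
Qed.

Theorem SLR_property_FF n : (5 <= n)%N -> super_reflexive E -> property_FF (SLR R n) E.
Proof.
move=> n5 sE pi _ c cc qc.
have [N [ucN [rho [Q [a [b [rr qN a0 b0 eqv]]]]]]] := renormed_quasi_cocycle sE qc.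
have seg (p : 'I_n * 'I_n) : exists B, forall t : R, 0 <= t <= 1 ->
    re `|c (elt p.1 p.2 t : SLR R n)| <= B.
  apply: real_norm_bounded_on_segment => t.
  by apply: (@continuous_comp R (SLR R n) E (fun t : R => elt p.1 p.2 t : SLR R n) c t);
    [exact: elt_continuous|exact: cc].
have [B hB] := choice seg.
have hBN i j (t : R) : 0 <= t <= 1 -> N (c (elt i j t)) <= b * \sum_p `|B p|.
  move=> t01; apply: le_trans (eqv _).2 _; rewrite ler_pM2l //.
  apply: le_trans (hB (i, j) t t01) _; apply: le_trans (ler_norm _) _.
  by rewrite (bigD1 (i, j)) //= lerDl sumr_ge0.
have [C hC] := @SLR_cocycle_bounded R V N ucN n n5 rho Q c _ rr qN hBN.
apply/bounded_fun_le; exists (C / a) => g.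
by rewrite ler_pdivlMr // mulrC; apply: le_trans (eqv (c g)).1 (hC g).
Qed.

End RealScalars.

Section Scalars.
Local Open Scope ring_scope.
Local Open Scope complex_scope.
Variable R : realType.

Lemma real_part_id : real_part (idfun : {rmorphism R -> R}) id.
Proof. by []. Qed.

Lemma real_part_complex :
  real_part (real_complex R : {rmorphism R -> R[i]}) (@complex.Re R).
Proof.
split=> // [[x y]|a b|a].
- by rewrite lecE /= => /andP[/eqP-> _].
- exact: lecR.
- by rewrite normc_def /= expr0n addr0 sqrtr_sqr.
Qed.

End Scalars.

Local Open Scope complex_scope.

Theorem corollary1p8 (R : realType) (n : nat) (hn : 5 <= n) :
  (forall E : completeNormedModType R,
     super_reflexive E -> property_FF (SLZ n) E /\ property_FF (SLR R n) E) /\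
  (forall E : completeNormedModType R[i],
     super_reflexive E -> property_FF (SLZ n) E /\ property_FF (SLR R n) E).
Proof.
by split=> E sE; split;
  [exact: SLZ_property_FF (real_part_id R) _ _ hn sE
  |exact: SLR_property_FF (real_part_id R) _ _ hn sE
  |exact: SLZ_property_FF (real_part_complex R) _ _ hn sE
  |exact: SLR_property_FF (real_part_complex R) _ _ hn sE].
Qed.
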